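(* Consider the $2$-user Gaussian symmetric Z interference channel with unidirectional transmitter cooperation of rate $C_G$ from transmitter $2$ to transmitter $1$ and with the secrecy constraint at receiver $1$. Let $\mathrm{SNR}=h_d^2P$ and $\mathrm{INR}=h_c^2P$, and suppose $\mathrm{INR}\le\mathrm{SNR}$ (weak/moderate interference regime). Then every rate pair $(R_1,R_2)$ in the secrecy capacity region satisfies $$R_1\le \tfrac12\log(1+\mathrm{SNR}),$$ $$R_2\le\max_{-1\le\rho\le 1}\tfrac12\log\left(1+\mathrm{SNR}-\frac{\left(\rho\,\mathrm{SNR}+\sqrt{\mathrm{SNR}\cdot\mathrm{INR}}\right)^2}{1+\mathrm{SNR}+\mathrm{INR}+2\rho\sqrt{\mathrm{SNR}\cdot\mathrm{INR}}}\right),$$ $$R_1+R_2\le\log(1+\mathrm{SNR})-\tfrac12\log(1+\mathrm{INR})+C_G.$$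
   Context: Gaussian symmetric Z interference channel: in each channel use the real inputs $x_1,x_2$ produce $$y_1=h_dx_1+h_cx_2+z_1,\qquad y_2=h_dx_2+z_2,$$ where $h_d,h_c$ are fixed real channel gains of the direct and interfering links, and $z_1,z_2$ are $\mathcal{N}(0,1)$ noises, i.i.d. over channel uses, independent of each other and of the messages and of all randomness used by the transmitters. The inputs satisfy the power constraint $E[|x_i|^2]\le P$, $i=1,2$, with $P>0$. The channel is used $N$ times; $\mathbf{x}_i^N,\mathbf{y}_i^N$ denote the blocks of $N$ inputs and outputs. Messages and encoding: $W_1,W_2$ are independent and uniformly distributed, $W_i$ on a set of size $2^{NR_i}$. A noiseless and secure cooperative link of rate $C_G\ge 0$ bits per channel use goes from transmitter $2$ to transmitter $1$; the (discrete) signal sent on it during the block is $\mathbf{v}_{21}^N$, with $H(\mathbf{v}_{21}^N)\le NC_G$. The signals $\mathbf{x}_2^N$ and $\mathbf{v}_{21}^N$ are functions of $W_2$ and possibly local randomness at transmitter $2$, so they are independent of $W_1$. The input of transmitter $1$ is a function of $W_1$, of the cooperative signal received so far (causality: it may not depend on cooperative signals sent in the future), and possibly of local randomness (artificial noise). The local randomness at the two transmitters is independent of each other and of the messages. In particular, $(W_1,\mathbf{x}_1^N)\to\mathbf{v}_{21}^N\to(W_2,\mathbf{x}_2^N)$ is a Markov chain. Secrecy capacity region: $(R_1,R_2)$ is achievable if there is a sequence of such codes with $N\to\infty$ for which receiver $i$ decodes $W_i$ from $\mathbf{y}_i^N$ with error probability tending to $0$ ($i=1,2$) and weak secrecy holds: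 $\frac1N I(W_2;\mathbf{y}_1^N)\to 0$. (Secrecy of $W_1$ at receiver $2$ is automatic, since transmitter $1$ is not connected to receiver $2$.) The secrecy capacity region is the closure of the set of achievable pairs. Logarithms are base $2$. The weak/moderate interference regime is $0\le\alpha\le1$ with $\alpha=\log\mathrm{INR}/\log\mathrm{SNR}$. *)

(* Defs.v *)
From HB Require Import structures.
From mathcomp Require Import all_boot all_order all_algebra.
From mathcomp Require Import all_classical all_reals all_analysis.
From mathcomp Require Import measurable_realfun.

Set Implicit Arguments.
Unset Strict Implicit.
Unset Printing Implicit Defensive.

Import Order.TTheory GRing.Theory Num.Theory.
Import numFieldNormedType.Exports.

Local Open Scope classical_set_scope.
Local Open Scope ring_scope.

Definition log2 (R : realType) (x : R) : R := ln x / ln 2.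

Definition is_max (R : realType) (A : set R) (m : R) : Prop :=
  A m /\ ubound A m.

Section probability_notions.
Context d (T : measurableType d) (R : realType) (P : probability T R).

(* A finite subfamily is given by an injection [i] of ['I_n] into the index
   type, so that [I] needs no structure. *)
Definition mutually_independent (I : Type) (F : I -> set_system T) : Prop :=
  forall (n : nat) (i : 'I_n -> I) (E : 'I_n -> set T),
    injective i -> (forall k, F (i k) (E k)) ->
    P (\bigcap_k E k) = (\prod_(k < n) fine (P (E k)))%:E.

Definition generated_algebra d' (S : measurableType d') (X : T -> S) :
    set_system T :=
  preimage_set_system setT X measurable.

(* Shannon entropy in bits of a discrete random element; [ln 0 = 0], so atoms
   of probability 0 do not contribute. *)
Definition entropy (A : choiceType) (X : T -> A) : \bar R :=
  \esum_(a in [set: A])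
    (let p := fine (P (X @^-1` [set a])) in - (p * log2 p))%:E.

End probability_notions.

(* Kullback-Leibler divergence in bits. *)
Definition kl_divergence d (T : measurableType d) (R : realType)
    (mu nu : probability T R) : \bar R :=
  if pselect (mu `<< nu) then
    (\int[mu]_x
       (log2 (fine (Radon_Nikodym (charge_of_finite_measure mu) nu x)))%:E)%E
  else +oo%E.

Definition pairRV d d1 d2 (T : measurableType d) (T1 : measurableType d1)
    (T2 : measurableType d2) (X : {mfun T >-> T1}) (Y : {mfun T >-> T2}) :
    T -> T1 * T2 :=
  fun t => (X t, Y t).

Section pairRV_measurable.
Context d d1 d2 (T : measurableType d) (T1 : measurableType d1)
  (T2 : measurableType d2) (X : {mfun T >-> T1}) (Y : {mfun T >-> T2}).

Let measurable_pairRV : measurable_fun setT (pairRV X Y).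
Proof. exact: measurable_fun_pair. Qed.

HB.instance Definition _ :=
  isMeasurableFun.Build _ _ _ _ (pairRV X Y) measurable_pairRV.

End pairRV_measurable.

Definition mutual_information d d1 d2 (T : measurableType d)
    (T1 : measurableType d1) (T2 : measurableType d2) (R : realType)
    (P : probability T R) (X : {RV P >-> T1}) (Y : {RV P >-> T2}) : \bar R :=
  kl_divergence (distribution P (pairRV X Y))
    (distribution P X \x distribution P Y)%E.

(* The elementary random sources of one block of length [N]. *)
Inductive source (N : nat) : Type :=
  | message1 | message2
  | local1 | local2
  | noise1 of 'I_N | noise2 of 'I_N.

Arguments message1 {N}.
Arguments message2 {N}.
Arguments local1 {N}.
Arguments local2 {N}.

(* The message sets are {0, .., M1 - 1} and {0, .., M2 - 1}. *)
Record zic_code (R : realType) (M1 M2 N : nat) := ZicCode {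
  sample_display : measure_display;
  sample : measurableType sample_display;
  prob : probability sample R;

  W1 : {RV prob >-> nat};
  W2 : {RV prob >-> nat};
  W1_uniform : forall w, (w < M1)%N -> prob (W1 @^-1` [set w]) = (M1%:R^-1)%:E;
  W2_uniform : forall w, (w < M2)%N -> prob (W2 @^-1` [set w]) = (M2%:R^-1)%:E;

  local1_display : measure_display;
  local1_space : measurableType local1_display;
  local2_display : measure_display;
  local2_space : measurableType local2_display;
  Q1 : {RV prob >-> local1_space};
  Q2 : {RV prob >-> local2_space};

  Z1 : 'I_N -> {RV prob >-> R};
  Z2 : 'I_N -> {RV prob >-> R};
  Z1_normal : forall k A, measurable A ->
    distribution prob (Z1 k) A = normal_prob 0 1 A;
  Z2_normal : forall k A, measurable A ->
    distribution prob (Z2 k) A = normal_prob 0 1 A;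

  sources_independent :
    mutually_independent prob (fun s : source N =>
      match s with
      | message1 => generated_algebra W1
      | message2 => generated_algebra W2
      | local1 => generated_algebra Q1
      | local2 => generated_algebra Q2
      | noise1 k => generated_algebra (Z1 k)
      | noise2 k => generated_algebra (Z2 k)
      end);

  (* Only the countability of the alphabet of the cooperative link matters,
     since its letters enter through encoders and the entropy alone; it is
     therefore taken to be [nat]. *)
  coop : {mfun (nat * local2_space)%type >-> N.-tuple nat};
  enc2 : {mfun (nat * local2_space)%type >-> N.-tuple R};
  enc1 : {mfun (nat * N.-tuple nat * local1_space)%type >-> N.-tuple R};
  enc1_causal : forall (k : 'I_N) (w : nat) (v v' : N.-tuple nat) q,
    (forall j : 'I_N, (j <= k)%N -> tnth v j = tnth v' j) ->
    tnth (enc1 (w, v, q)) k = tnth (enc1 (w, v', q)) k;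

  dec1 : {mfun N.-tuple R >-> nat};
  dec2 : {mfun N.-tuple R >-> nat}
}.

Section channel.
Context (R : realType) (M1 M2 N : nat).
Variable c : zic_code R M1 M2 N.

Definition V21 (t : sample c) : N.-tuple nat := coop c (W2 c t, Q2 c t).

Definition X2 (t : sample c) : N.-tuple R := enc2 c (W2 c t, Q2 c t).

Definition X1 (t : sample c) : N.-tuple R := enc1 c (W1 c t, V21 t, Q1 c t).

Definition meets_constraints (pw cg : R) : Prop :=
  [/\ (entropy (prob c) V21 <= (N%:R * cg)%:E)%E,
      forall k : 'I_N,
        ('E_(prob c)[fun t => (`|tnth (X1 t) k| ^+ 2)%R] <= pw%:E)%E &
      forall k : 'I_N,
        ('E_(prob c)[fun t => (`|tnth (X2 t) k| ^+ 2)%R] <= pw%:E)%E].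

Definition Y1 (hd hc : R) (t : sample c) : N.-tuple R :=
  [tuple hd * tnth (X1 t) k + hc * tnth (X2 t) k + Z1 c k t | k < N].

Definition Y2 (hd : R) (t : sample c) : N.-tuple R :=
  [tuple hd * tnth (X2 t) k + Z2 c k t | k < N].

Lemma measurable_X1 : measurable_fun setT X1.
Proof.
apply: measurableT_comp => //; apply: measurable_fun_pair => //.
apply: measurable_fun_pair => //; apply: measurableT_comp => //.
exact: measurable_fun_pair.
Qed.

Lemma measurable_X2 : measurable_fun setT X2.
Proof. by apply: measurableT_comp => //; exact: measurable_fun_pair. Qed.

Lemma measurable_Y1 hd hc : measurable_fun setT (Y1 hd hc).
Proof.
apply/measurable_fun_tnthP => k.
rewrite (_ : _ \o _ =
  (fun t => hd * tnth (X1 t) k + hc * tnth (X2 t) k + Z1 c k t)); last first.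
  by apply/funext => t /=; rewrite tnth_mktuple.
apply: measurable_funD => //.
have mtnth X : measurable_fun setT X ->
    measurable_fun setT (fun t : sample c => tnth (X t : N.-tuple R) k).
  by move=> mX; exact: (measurableT_comp (measurable_tnth k) mX).
by apply: measurable_funD; apply: measurable_funM => //; apply: mtnth;
  [exact: measurable_X1|exact: measurable_X2].
Qed.

HB.instance Definition _ hd hc :=
  isMeasurableFun.Build _ _ _ _ (Y1 hd hc) (measurable_Y1 hd hc).

Definition error1 (hd hc : R) : \bar R :=
  prob c [set t | dec1 c (Y1 hd hc t) <> W1 c t].

Definition error2 (hd : R) : \bar R :=
  prob c [set t | dec2 c (Y2 hd t) <> W2 c t].

Definition leakage (hd hc : R) : \bar R :=
  mutual_information (P := prob c) (W2 c) (Y1 hd hc).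

End channel.

(* The integer size of a message set at rate [r] over [N] channel uses. *)
Definition message_count (R : realType) (N : nat) (r : R) : nat :=
  `|Num.ceil (2 `^ (N%:R * r))|%N.

Definition achievable (R : realType) (hd hc pw cg : R) (r : R * R) : Prop :=
  [/\ 0 <= r.1, 0 <= r.2 &
   exists (N : nat -> nat)
     (c : forall n, zic_code R
            (message_count (N n) r.1) (message_count (N n) r.2) (N n)),
   [/\ N n @[n --> \oo] --> \oo,
       forall n, meets_constraints (c n) pw cg,
       error1 (c n) hd hc @[n --> \oo] --> 0%E,
       error2 (c n) hd @[n --> \oo] --> 0%E &
       (((N n)%:R^-1)%:E * leakage (c n) hd hc)%E @[n --> \oo] --> 0%E]].

Definition secrecy_capacity_region (R : realType) (hd hc pw cg : R) :
    set (R * R) :=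
  closure [set r | achievable hd hc pw cg r].

(* Main.v *)
Require Import Defs.
From HB Require Import structures.
From mathcomp Require Import all_boot all_order all_algebra.
From mathcomp Require Import all_classical all_reals all_analysis.
From mathcomp Require Import measurable_realfun ring lra.

(* Since INR <= SNR, the maximum in the second bound is attained at
   rho = - sqrt (INR / SNR), where the subtracted term vanishes; hence the first
   two bounds are point-to-point converses.

   For the sum rate, let g = h_c / h_d, give receiver 2 a noise z2 of variance
   s^2 < 1 only, and couple the noises by z1 = g z2 + z', so that
   U = h_c x2 + z1 = g Y2 + z' is a degraded version of Y2. Given the value v of
   the cooperative signal, h_d x1 + z1 is independent of x2. With D_i equal to
   M_i times the indicator of correct decoding at receiver i, e the inverse of
   the density of (W2, Y1) with respect to the product of its marginals, Q a
   Gaussian test channel and f the densities restricted to v, the ratios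
     (1 + D_1) f(Y1) / f(U),
     (1 + D_2) e P(v) f(h_d x1 + z1) f(Y2) / (f(z2) f(Y1)),
     N(0, 1 + SNR)(h_d x1 + z1) / f(h_d x1 + z1),
     f(U) Q(Y2 | U) / (f(Y2) f(z'))
   have expectations O(P(v)), and in their product all unknown densities cancel.
   Applying ln x <= x to each of them and summing over v bounds
   (1 - err_1) ln M_1 + (1 - err_2) ln M_2 by Gaussian terms, plus the leakage
   E(- ln e), plus the entropy of the cooperative signal. Finally N tends to
   infinity and s to 1. *)

Set Implicit Arguments.
Unset Strict Implicit.
Unset Printing Implicit Defensive.

Import Order.TTheory GRing.Theory Num.Theory.
Import numFieldNormedType.Exports.

Local Open Scope classical_set_scope.
Local Open Scope ring_scope.

(** * Tuples and product measures *)

(** The four ratios are pointwise forms of entropy inequalities given v. With B = h_d x1 + z1 they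
    say, up to constants, ln M_1 <= h(Y1) - h(U), ln M_2 <= leakage - ln P(v) + h(B) + h(Y2) - h(Y1)
    - h(z2), h(B) <= its Gaussian value, and h(Y2) - h(U) <= Gaussian value of h(Y2 | U) - h(z').
    Ratios avoid differential entropies and their existence: once negative terms are moved to the
    other side, every integrand is nonnegative and Tonelli's theorem applies. The summand 1 in 1 +
    D_i keeps the logarithm defined at decoding errors. Coupling the noises is legitimate because
    each error event sees the noise of one receiver. Taking s < 1 keeps the variance 1 - g^2 s^2 of
    z' positive even if INR = SNR, where z' would vanish at s = 1; the decoder of receiver 2 makes
    up for the smaller noise by averaging over the missing part. Each of the four bounds is
    proportional to P(v), so the sum over v leaves the constant 2 + 2 + 1 + 1 = 6, which disappears
    after division by N. *)

Section tuple_zmodule.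
Variables (V : zmodType) (n : nat).
Implicit Types x y z : n.-tuple V.

(** The group structure lets identities between blocks be settled by [addrA], [addrC] and
    [addrK]. *)
Definition addt x y : n.-tuple V := [tuple tnth x i + tnth y i | i < n].
Definition oppt x : n.-tuple V := [tuple - tnth x i | i < n].
Definition zerot : n.-tuple V := [tuple 0 | _ < n].

Let addtA : associative addt.
Proof. by move=> x y z; apply: eq_from_tnth => i; rewrite !tnth_mktuple addrA. Qed.
Let addtC : commutative addt.
Proof. by move=> x y; apply: eq_from_tnth => i; rewrite !tnth_mktuple addrC. Qed.
Let add0t : left_id zerot addt.
Proof. by move=> x; apply: eq_from_tnth => i; rewrite !tnth_mktuple add0r. Qed.
Let addNt : left_inverse zerot oppt addt.
Proof. by move=> x; apply: eq_from_tnth => i; rewrite !tnth_mktuple addNr. Qed.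

HB.instance Definition _ := GRing.isZmodule.Build (n.-tuple V) addtA addtC add0t addNt.

Lemma tnthD x y i : tnth (x + y) i = tnth x i + tnth y i.
Proof. by rewrite tnth_mktuple. Qed.
Lemma tnthN x i : tnth (- x) i = - tnth x i.
Proof. by rewrite tnth_mktuple. Qed.
End tuple_zmodule.

Section scalet.
Variables (R : pzRingType) (n : nat).
Definition scalet (a : R) (x : n.-tuple R) : n.-tuple R :=
  [tuple a * tnth x i | i < n].
Lemma tnthZ a x i : tnth (scalet a x) i = a * tnth x i.
Proof. by rewrite tnth_mktuple. Qed.
End scalet.

Section measurable_tuple_operations.
Context d (T : measurableType d) (R : realType) (n : nat).
Implicit Types f g : T -> n.-tuple R.

Lemma measurable_tnthT f i : measurable_fun setT f ->
  measurable_fun setT (fun t => tnth (f t) i).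
Proof. by move=> mf; exact: (measurableT_comp (measurable_tnth i) mf). Qed.

Lemma measurable_addt f g : measurable_fun setT f -> measurable_fun setT g ->
  measurable_fun setT (fun t => f t + g t).
Proof.
move=> mf mg; apply/measurable_fun_tnthP => i.
rewrite (_ : _ \o _ = (fun t => tnth (f t) i + tnth (g t) i)).
  by apply: measurable_funD; exact: measurable_tnthT.
by apply/funext => t /=; rewrite tnthD.
Qed.

Lemma measurable_scalet a f : measurable_fun setT f ->
  measurable_fun setT (fun t => scalet a (f t)).
Proof.
move=> mf; apply/measurable_fun_tnthP => i.
rewrite (_ : _ \o _ = (fun t => a * tnth (f t) i)).
  by apply: measurable_funM => //; exact: measurable_tnthT.
by apply/funext => t /=; rewrite tnthZ.
Qed.

Lemma measurable_oppt f : measurable_fun setT f ->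
  measurable_fun setT (fun t => - f t).
Proof.
move=> mf; apply/measurable_fun_tnthP => i.
rewrite (_ : _ \o _ = (fun t => - tnth (f t) i)).
  by apply: measurableT_comp => //; exact: measurable_tnthT.
by apply/funext => t /=; rewrite tnthN.
Qed.

End measurable_tuple_operations.

(* In the library the sigma-finite structure of [m1 \x m2] is shadowed by the
   one declared for subprobabilities; a new head constant restores it. *)
Definition prodm d1 d2 (T1 : measurableType d1) (T2 : measurableType d2)
    (R : realType) (m1 : {sigma_finite_measure set T1 -> \bar R})
    (m2 : {sigma_finite_measure set T2 -> \bar R}) : set (T1 * T2) -> \bar R :=
  (m1 \x m2)%E.

Section prodm.
Context d1 d2 (T1 : measurableType d1) (T2 : measurableType d2) (R : realType).
Variables (m1 : {sigma_finite_measure set T1 -> \bar R})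
  (m2 : {sigma_finite_measure set T2 -> \bar R}).
Local Open Scope ereal_scope.

HB.instance Definition _ := Measure.copy (prodm m1 m2) (m1 \x m2).

Let prodm_sigma_finite : sigma_finite setT (prodm m1 m2).
Proof.
have [F TF Foo] := sigma_finiteT m1; have [G TG Goo] := sigma_finiteT m2.
pose h n : nat * nat := odflt (0, 0)%N (unpickle n).
exists (fun n => F (h n).1 `*` G (h n).2).
  apply/esym; rewrite -subTset => -[x y] _.
  have [i _ Fix] : (\bigcup_k F k) x by rewrite -TF.
  have [j _ Gjy] : (\bigcup_k G k) y by rewrite -TG.
  by exists (pickle (i, j)) => //; rewrite /h pickleK.
move=> n; have [mF Fn] := Foo (h n).1; have [mG Gn] := Goo (h n).2.
split; first exact: measurableX.
by rewrite /prodm product_measure1E// lte_mul_pinfty// ge0_fin_numE.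
Qed.

HB.instance Definition _ := Measure_isSigmaFinite.Build _ _ _ (prodm m1 m2)
  prodm_sigma_finite.

Lemma integral_prodm f : measurable_fun setT f -> (forall x, 0 <= f x) ->
  \int[prodm m1 m2]_z f z = \int[m1]_x \int[m2]_y f (x, y).
Proof. by move=> mf f0; rewrite -(fubini_tonelli1 f). Qed.

End prodm.

Section cons_measure.
Context d (T : measurableType d) (R : realType) (n : nat).
Local Open Scope ereal_scope.

Definition consp (p : T * n.-tuple T) : n.+1.-tuple T := [tuple of p.1 :: p.2].

Lemma measurable_consp : measurable_fun setT consp.
Proof. exact: measurable_cons. Qed.

Definition uncons (x : n.+1.-tuple T) : T * n.-tuple T :=
  (tnth x ord0, [tuple of behead x]).

Lemma conspK : cancel consp uncons.
Proof.
by move=> [a v]; rewrite /uncons /consp/=; congr (_, _); exact/val_inj.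
Qed.

Lemma measurable_uncons : measurable_fun setT uncons.
Proof.
by apply: measurable_fun_pair; [exact: measurable_tnth|exact: measurable_behead].
Qed.

Variables (m1 : {sigma_finite_measure set T -> \bar R})
  (m2 : {sigma_finite_measure set (n.-tuple T) -> \bar R}).

Definition cons_measure : set (n.+1.-tuple T) -> \bar R :=
  pushforward (prodm m1 m2) consp.

Let cons0 : cons_measure set0 = 0.
Proof. by rewrite /cons_measure /pushforward preimage_set0 measure0. Qed.
Let cons_ge0 A : 0 <= cons_measure A.
Proof. exact: (measure_ge0 (prodm m1 m2)). Qed.
Let cons_sigma_additive : semi_sigma_additive cons_measure.
Proof.
move=> F mF tF mU; rewrite /cons_measure /pushforward preimage_bigcup.
apply: measure_semi_sigma_additive.
- by move=> k; rewrite -[X in measurable X]setTI; exact: measurable_consp.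
- apply/trivIsetP => /= i j _ _ ij; rewrite -preimage_setI.
  by move/trivIsetP : tF => /(_ _ _ _ _ ij) ->; rewrite ?preimage_set0.
- by rewrite -preimage_bigcup -[X in measurable X]setTI; exact: measurable_consp.
Qed.

HB.instance Definition _ := isMeasure.Build _ _ _ cons_measure
  cons0 cons_ge0 cons_sigma_additive.

Let cons_sigma_finite : sigma_finite setT cons_measure.
Proof.
have [F TF Foo] := sigma_finiteT
  (prodm m1 m2).
exists (fun k => uncons @^-1` F k).
  by rewrite -preimage_bigcup -TF preimage_setT.
move=> k; have [mFk Fkoo] := Foo k; split.
  by rewrite -[X in measurable X]setTI; exact: measurable_uncons.
rewrite /cons_measure /pushforward -comp_preimage.
by rewrite (_ : uncons \o consp = id) //; apply/funext => p; exact: conspK.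
Qed.

HB.instance Definition _ := Measure_isSigmaFinite.Build _ _ _ cons_measure
  cons_sigma_finite.

Lemma integral_cons_measure f : measurable_fun setT f -> (forall x, 0 <= f x) ->
  \int[cons_measure]_x f x =
  \int[m1]_a \int[m2]_v f [tuple of a :: v].
Proof.
move=> mf f0; rewrite ge0_integral_pushforward//; last exact: measurable_consp.
rewrite preimage_setT integral_prodm//.
- by apply: measurableT_comp => //; exact: measurable_consp.
- by move=> x; exact: f0.
Qed.

End cons_measure.

(** The n-fold product measure. The empty product is a point mass and each further factor is the
    image of a binary product under [consp], so integrals over blocks unfold by Tonelli's theorem,
    one coordinate at a time. *)
Fixpoint tuple_measure d (T : measurableType d) (R : realType)
    (m : {sigma_finite_measure set T -> \bar R}) (n : nat) :
    {sigma_finite_measure set (n.-tuple T) -> \bar R} :=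
  match n with
  | 0 => dirac ([tuple] : 0.-tuple T)
  | k.+1 => cons_measure m (tuple_measure m k)
  end.

Lemma tuple0_eq (T : Type) (x : 0.-tuple T) : x = [tuple].
Proof. by apply/val_inj; case: x => -[]. Qed.

Lemma integral_tuple_measure0 d (T : measurableType d) (R : realType)
    (m : {sigma_finite_measure set T -> \bar R}) (f : 0.-tuple T -> \bar R) :
  (\int[tuple_measure m 0]_x f x = f [tuple])%E.
Proof.
rewrite /= (_ : f = cst (f [tuple])); last first.
  by apply/funext => x; rewrite (tuple0_eq x).
by rewrite integral_cst//= diracT mule1.
Qed.

Lemma integral_tuple_measureS d (T : measurableType d) (R : realType)
    (m : {sigma_finite_measure set T -> \bar R}) n (f : n.+1.-tuple T -> \bar R) :
  measurable_fun setT f -> (forall x, 0 <= f x)%E ->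
  (\int[tuple_measure m n.+1]_x f x =
   \int[m]_a \int[tuple_measure m n]_v f [tuple of a :: v])%E.
Proof. exact: integral_cons_measure. Qed.

(* Lebesgue measure, moved from the library's [measurableTypeR R] to the
   canonical measurable structure of [R], over which tuples are built. *)
Definition lebR (R : realType) : set R -> \bar R :=
  pushforward (@lebesgue_measure R) (idfun : measurableTypeR R -> R).

Section lebR.
Variable R : realType.
Local Open Scope ereal_scope.

Let measurable_id : measurable_fun setT (idfun : measurableTypeR R -> R).
Proof. by move=> _ A mA; rewrite setTI preimage_id. Qed.

Let lebR0 : @lebR R set0 = 0. Proof. exact: (measure0 (@lebesgue_measure R)). Qed.
Let lebR_ge0 A : 0 <= @lebR R A.
Proof. exact: (measure_ge0 (@lebesgue_measure R)). Qed.
Let lebR_sigma_additive : semi_sigma_additive (@lebR R).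
Proof. exact: (@measure_semi_sigma_additive _ _ _ (@lebesgue_measure R)). Qed.

HB.instance Definition _ := isMeasure.Build _ _ _ (@lebR R)
  lebR0 lebR_ge0 lebR_sigma_additive.

Let lebR_sigma_finite : sigma_finite setT (@lebR R).
Proof. exact: (sigma_finiteT (@lebesgue_measure R)). Qed.

HB.instance Definition _ := Measure_isSigmaFinite.Build _ _ _ (@lebR R)
  lebR_sigma_finite.

Lemma integral_lebR (f : R -> \bar R) :
  measurable_fun setT f -> (forall x, 0 <= f x) ->
  \int[@lebR R]_x f x = \int[lebesgue_measure]_x f x.
Proof. by move=> mf f0; rewrite (ge0_integral_pushforward measurable_id). Qed.

(** Lebesgue measure is determined by its values on bounded half-open intervals, so a map that
    preserves these values preserves every integral. *)
Let ge0_integral_invariant (g : R -> R) (f : R -> \bar R) :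
  measurable_fun setT g ->
  (forall X, ocitv X -> @lebR R X = pushforward (@lebR R) g X) ->
  measurable_fun setT f -> (forall x, 0 <= f x) ->
  \int[@lebR R]_x f (g x) = \int[@lebR R]_x f x.
Proof.
move=> mg H mf f0.
have mg' : measurable_fun setT (g : measurableTypeR R -> measurableTypeR R).
  exact: mg.
pose mgm := isMeasurableFun.Build _ _ _ _ _ mg'.
pose gm : {mfun measurableTypeR R >-> measurableTypeR R} :=
  HB.pack (g : measurableTypeR R -> measurableTypeR R) mgm.
rewrite !integral_lebR//; last exact: measurableT_comp.
transitivity (\int[pushforward lebesgue_measure gm]_(x in setT) f x).
  by rewrite (ge0_integral_pushforward mg').
apply: eq_measure_integral.
move=> A mA _; apply/esym.
exact: (@lebesgue_measure_unique R (pushforward lebesgue_measure gm)).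
Qed.

Lemma ge0_integral_shift (a : R) (f : R -> \bar R) :
  measurable_fun setT f -> (forall x, 0 <= f x) ->
  \int[@lebR R]_x f (x + a)%R = \int[@lebR R]_x f x.
Proof.
apply: ge0_integral_invariant; first exact: measurable_funD.
move=> _ [[x y] /= _ <-]; rewrite /lebR /pushforward/= !preimage_id.
rewrite (_ : _ @^-1` _ = `](x - a)%R, (y - a)%R]%classic); last first.
  by apply/seteqP; split => z /=; rewrite !in_itv/= ltrBlDr lerBrDr.
rewrite !lebesgue_measure_itv/= !lte_fin ltrD2r; case: ifP => // _.
by rewrite -!EFinB; congr EFin; ring.
Qed.

Lemma ge0_integral_oppr (f : R -> \bar R) :
  measurable_fun setT f -> (forall x, 0 <= f x) ->
  \int[@lebR R]_x f (- x)%R = \int[@lebR R]_x f x.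
Proof.
apply: ge0_integral_invariant; first exact: measurable_funN.
move=> _ [[x y] /= _ <-]; rewrite /lebR /pushforward/= !preimage_id.
(* Reflection exchanges the closed and the open end, but the length is unchanged. *)
rewrite (_ : _ @^-1` _ = `[(- y)%R, (- x)%R[%classic); last first.
  by apply/seteqP; split => z /=; rewrite !in_itv/= ltrNr lerNl andbC.
rewrite !lebesgue_measure_itv/= !lte_fin ltrN2; case: ifP => // _.
by rewrite -!EFinB; congr EFin; ring.
Qed.

End lebR.

Notation leb R n := (tuple_measure (@lebR R) n).

Lemma tuple_cons_add (R : realType) n (b : R) (v : n.-tuple R) (a : n.+1.-tuple R) :
  [tuple of b :: v] + a =
  [tuple of (b + tnth a ord0) :: (v + [tuple of behead a] : n.-tuple R)]
  :> n.+1.-tuple R.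
Proof.
apply: eq_from_tnth => i; rewrite tnthD.
have [->|i0] := eqVneq i ord0; first by rewrite [RHS](_ : _ = b + tnth a ord0).
have [j ->] : exists j, i = lift ord0 j by case: (unliftP ord0 i) i0 => [j ->|->//]; exists j.
by rewrite !tnthS tnthD [in LHS](tuple_eta a) tnthS.
Qed.

Lemma measurable_integral_cons d (T : measurableType d) (R : realType)
    (m : {sigma_finite_measure set T -> \bar R}) n (f : n.+1.-tuple T -> \bar R) :
  measurable_fun setT f -> (forall x, 0 <= f x)%E ->
  measurable_fun setT
    (fun b : T => (\int[tuple_measure m n]_v f [tuple of b :: v])%E).
Proof.
move=> mf f0.
apply: (measurable_fun_fubini_tonelli_F
  (fun p : T * n.-tuple T => f [tuple of p.1 :: p.2])) => //.
by apply: measurableT_comp => //; exact: measurable_consp.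
Qed.

Lemma ge0_integral_shift_tuple (R : realType) n (a : n.-tuple R)
    (f : n.-tuple R -> \bar R) :
  measurable_fun setT f -> (forall x, 0 <= f x)%E ->
  (\int[leb R n]_x f (x + a)%R = \int[leb R n]_x f x)%E.
Proof.
elim: n => [|n IH] in a f * => mf f0.
  by apply: eq_integral => x _; congr f; rewrite (tuple0_eq x); exact: tuple0_eq.
rewrite !integral_tuple_measureS//; last first.
  by apply: measurableT_comp => //; exact: measurable_addt.
transitivity (\int[@lebR R]_b
    (\int[leb R n]_v f [tuple of (b + tnth a ord0)%R :: v]))%E.
  apply: eq_integral => b _.
  rewrite -[RHS](IH [tuple of behead a]
    (fun v => f [tuple of (b + tnth a ord0)%R :: v]))//; last first.
    by apply: measurableT_comp => //; exact: measurable_cons.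
  by apply: eq_integral => v _; rewrite tuple_cons_add.
rewrite (ge0_integral_shift (tnth a ord0)
  (f := fun b => \int[leb R n]_v f [tuple of b :: v])%E)//.
- exact: measurable_integral_cons.
- by move=> b; apply: integral_ge0.
Qed.

(** * Gaussian densities *)

Section normal_pdf_facts.
Variables (R : realType) (s : R).
Hypothesis s0 : 0 < s.
Local Open Scope ereal_scope.
Notation phi := (normal_pdf 0 s).

Lemma normal_pdf_gt0 x : (0 < phi x)%R.
Proof.
rewrite normal_pdfE ?gt_eqF// mulr_gt0 ?expR_gt0//.
by rewrite normal_peak_gt0 ?gt_eqF.
Qed.

Lemma normal_pdfN x : phi (- x)%R = phi x.
Proof. by rewrite normal_pdfE ?gt_eqF// /normal_fun !subr0 sqrrN. Qed.

Let mphi : measurable_fun setT phi. Proof. exact: measurable_normal_pdf. Qed.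

Lemma integral_lebR_normal_pdf : \int[@lebR R]_x (phi x)%:E = 1.
Proof.
rewrite integral_lebR ?integral_normal_pdf//; first exact/measurable_EFinP.
by move=> x; rewrite lee_fin normal_pdf_ge0.
Qed.

(** Provides a primitive of [x phi(x)], from which the tail integral and then the variance are
    obtained. *)
Lemma is_derive_normal_pdf (x : R) :
  is_derive x 1%R (fun y => - s ^+ 2 * phi y)%R (x * phi x)%R.
Proof.
rewrite normal_pdfE ?gt_eqF// /normal_fun.
pose h : R -> R := (fun y => - (y - 0) ^+ 2 / (s ^+ 2 *+ 2))%R.
have dh : is_derive x 1%R h (- x / s ^+ 2)%R.
  rewrite /h.
  have -> : (fun y : R => - (y - 0) ^+ 2 / (s ^+ 2 *+ 2))%R =
            (fun y : R => (- (s ^+ 2 *+ 2)^-1) * y ^+ 2)%R.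
    by apply/funext => y; rewrite subr0 mulNr mulrC mulNr.
  apply: is_derive_eq.
  rewrite /GRing.scale/= mulr1.
  by field; rewrite gt_eqF.
have de : is_derive x 1%R (expR \o h) ((- x / s ^+ 2) * expR (h x))%R.
  apply: is_derive_eq.
  exact: mulrC.
have -> : (fun y : R => - s ^+ 2 * (normal_peak s * expR (- (y - 0) ^+ 2 / (s ^+ 2 *+ 2))))%R
   = (fun y => (- s ^+ 2 * normal_peak s) * (expR \o h) y)%R.
  by apply/funext => y; rewrite mulrA.
apply: is_derive_eq.
rewrite /GRing.scale/= -/(h x).
by field; rewrite gt_eqF.
Qed.

Lemma cvg_normal_pdf_pinfty :
  (- s ^+ 2 * phi x)%R @[x --> +oo%R] --> (0 : R)%R.
Proof.
rewrite -[X in _ --> X](mulr0 (- s ^+ 2)%R); apply: cvgMr.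
rewrite normal_pdfE ?gt_eqF// -[X in _ --> X](mulr0 (normal_peak s)); apply: cvgMr.
have E x : normal_fun 0 s x = gauss_fun (x * (Num.sqrt (s ^+ 2 *+ 2))^-1)%R.
  rewrite /normal_fun /gauss_fun/= subr0 exprMn exprVn.
  by rewrite sqr_sqrtr ?mulNr// pmulrn_lge0// sqr_ge0.
rewrite (eq_cvg _ _ E).
apply: (cvg_comp _ gauss_fun _ cvg_gauss_fun).
apply/gt0_cvgMly; last exact: cvg_id.
by rewrite invr_gt0 sqrtr_gt0 pmulrn_lgt0// exprn_gt0.
Qed.

Lemma integral_tail_normal_pdf (t : R) : (0 <= t)%R ->
  \int[lebesgue_measure]_(x in `[t, +oo[) (x * phi x)%:E = (s ^+ 2 * phi t)%:E.
Proof.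
move=> t0.
have dF x := is_derive_normal_pdf x.
rewrite (@ge0_continuous_FTC2y _ _ (fun y => - s ^+ 2 * phi y)%R t 0%R).
- by rewrite -EFinB sub0r mulNr opprK.
- move=> x tx; rewrite mulr_ge0 ?normal_pdf_ge0//; exact: le_trans tx.
- apply: continuous_subspaceT => x; apply: cvgM; first exact: cvg_id.
  by apply: continuous_normal_pdf; rewrite gt_eqF.
- exact: cvg_normal_pdf_pinfty.
- by move=> x _; have [] := dF x.
- apply: cvg_at_right_filter; apply: cvgMr.
  by apply: continuous_normal_pdf; rewrite gt_eqF.
- by move=> x _; rewrite derive1E; have [_ ->] := dF x.
Qed.

Lemma ge0_integral_lebR_mkcond (D : set R) (f : R -> R) :
  measurable D -> measurable_fun setT f -> (forall x, D x -> 0 <= f x)%R ->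
  \int[@lebR R]_x (\1_D x * f x)%:E = \int[lebesgue_measure]_(x in D) (f x)%:E.
Proof.
move=> mD mf f0; rewrite integral_lebR.
- rewrite [RHS]integral_mkcond; apply: eq_integral => x _.
  rewrite patchE indicE; case: ifPn => xD; first by rewrite mul1r.
  by rewrite mul0r.
- by apply/measurable_EFinP; apply: measurable_funM.
- move=> x; rewrite lee_fin indicE; case: (boolP (x \in D)) => xD; rewrite ?mul0r//.
  by rewrite mul1r; apply: f0; rewrite inE in xD.
Qed.

(** In place of an integration by parts, [x^2 phi(x)] is written as the integral of [x phi(x)] over
    [0 <= y <= x]. Exchanging the order leaves, for each y, the tail integral over [x >= y], which
    is [s^2 phi(y)]. *)
Lemma integral_half_sqr_normal_pdf :
  \int[lebesgue_measure]_(x in [set x | (0 <= x)%R]) (x ^+ 2 * phi x)%:E =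
  (s ^+ 2)%:E * \int[lebesgue_measure]_(x in [set x | (0 <= x)%R]) (phi x)%:E.
Proof.
have m0 : measurable [set x : R | (0 <= x)%R] by rewrite -set_itvcy.
pose f (p : R * R) : \bar R :=
  (\1_[set q : R * R | (0 <= q.2 <= q.1)%R] p * (p.1 * phi p.1))%:E.
have mf : measurable_fun setT f.
  apply/measurable_EFinP; apply: measurable_funM; last first.
    by apply: measurable_funM => //; exact: measurableT_comp.
  apply: measurable_indic.
  rewrite (_ : [set _ | _] = (fun q : R * R => (0 <= q.2)%R) @^-1` [set true] `&`
     (fun q : R * R => (q.2 <= q.1)%R) @^-1` [set true]); last first.
    by apply/seteqP; split => q /=; [move=> /andP[]|move=> [-> ->]].
  apply: measurableI; rewrite -[X in measurable X]setTI.
    by apply: measurable_fun_ler.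
  by apply: measurable_fun_ler.
have f0 (p : R * R) : 0 <= f p.
  rewrite /f lee_fin indicE; case: (boolP (p \in _)) => [|_]; last by rewrite mul0r.
  by rewrite inE/= => /andP[h1 h2]; rewrite mul1r mulr_ge0 ?normal_pdf_ge0// (le_trans h1).
have := fubini_tonelli (m1 := @lebR R) (m2 := @lebR R) f mf f0.
rewrite [X in X = _ -> _](_ : _ = \int[lebesgue_measure]_(x in [set x | (0 <= x)%R]) (x ^+ 2 * phi x)%:E); last first.
  rewrite -ge0_integral_lebR_mkcond//; last 2 first.
  - by apply: measurable_funM => //; exact: measurable_funX.
  - by move=> x _; rewrite mulr_ge0 ?sqr_ge0 ?normal_pdf_ge0.
  apply: eq_integral => x _; rewrite /f /=.
  transitivity (\int[lebR (R:=R)]_y (\1_(`[0%R, x]%classic) y * (x * phi x))%:E).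
    by apply: eq_integral => y _; rewrite !indicE/=; congr (_ * _)%:E.
  rewrite indicE; case: (boolP (x \in [set x | (0 <= x)%R])) => [|/negP]; rewrite inE/= => x0.
    rewrite ge0_integral_lebR_mkcond//; last first.
      by move=> _ _; rewrite mulr_ge0 ?normal_pdf_ge0.
    rewrite integral_cst//= lebesgue_measure_itv/= lte_fin.
    case: ifPn => [_|]; first by rewrite sube0 -EFinM; congr EFin; ring.
    rewrite -leNgt => x0'; have -> : x = 0%R by apply/le_anti; rewrite x0 x0'.
    by rewrite mule0 expr2 !mul0r mulr0.
  rewrite mul0r integral0_eq// => y _; rewrite indicE memNset ?mul0r//= in_itv/=.
  by move=> /andP[h1 h2]; apply: x0; exact: le_trans h2.
move=> ->.
rewrite -!ge0_integral_lebR_mkcond//; last by move=> x _; exact: normal_pdf_ge0.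
rewrite -ge0_integralZl//; last 3 first.
- by apply/measurable_EFinP; apply: measurable_funM => //.
- by move=> x _; rewrite lee_fin mulr_ge0 ?normal_pdf_ge0// indicE.
- by rewrite lee_fin sqr_ge0.
apply: eq_integral => y _.
rewrite indicE; case: (boolP (y \in _)) => [|/negP]; rewrite inE/= => y0.
  rewrite mul1r -EFinM -integral_tail_normal_pdf// -ge0_integral_lebR_mkcond//.
  - apply: eq_integral => x _; rewrite /f /= !indicE.
    congr ((nat_of_bool _)%:R * _)%:E.
    by apply/idP/idP; rewrite !inE/= in_itv/= andbT y0.
  - by apply: measurable_funM.
  - move=> x /=; rewrite in_itv/= andbT => yx.
    by rewrite mulr_ge0 ?normal_pdf_ge0// (le_trans y0).
rewrite mul0r mule0 integral0_eq// => x _; rewrite /f /= indicE memNset ?mul0r//=.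
by move=> /andP[].
Qed.

Lemma integral_sqr_normal_pdf :
  \int[@lebR R]_x (x ^+ 2 * phi x)%:E = (s ^+ 2)%:E.
Proof.
have cphi : continuous phi by apply: continuous_normal_pdf; rewrite gt_eqF.
rewrite integral_lebR; last 2 first.
- by apply/measurable_EFinP; apply: measurable_funM => //; exact: measurable_funX.
- by move=> x; rewrite lee_fin mulr_ge0 ?sqr_ge0 ?normal_pdf_ge0.
rewrite ge0_symfun_integralT; last 3 first.
- by move=> x; rewrite mulr_ge0 ?sqr_ge0 ?normal_pdf_ge0.
- by move=> x; apply: cvgM; [exact: exprn_continuous|exact: cphi].
- by move=> x; rewrite /= sqrrN normal_pdfN.
rewrite integral_half_sqr_normal_pdf muleCA.
rewrite -ge0_symfun_integralT ?integral_normal_pdf ?mule1//.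
- by move=> x; exact: normal_pdf_ge0.
- by move=> x /=; rewrite normal_pdfN.
Qed.

(** The substitution of [- x] for [x] turns [b] into [- b]. Adding the two integrals removes the
    cross term, so that only nonnegative integrands occur. *)
Lemma integral_affine_sqr_normal_pdf (c b : R) :
  \int[@lebR R]_x (phi x * (c + b * x) ^+ 2)%:E = (c ^+ 2 + b ^+ 2 * s ^+ 2)%:E.
Proof.
have mJ (b' : R) : measurable_fun setT (fun x => (phi x * (c + b' * x) ^+ 2)%:E).
  apply/measurable_EFinP; apply: measurable_funM => //; apply: measurable_funX.
  by apply: measurable_funD => //; exact: measurable_funM.
have J0 (b' : R) (x : R) : 0 <= (phi x * (c + b' * x) ^+ 2)%:E.
  by rewrite lee_fin mulr_ge0 ?sqr_ge0 ?normal_pdf_ge0.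
pose J b' := \int[@lebR R]_x (phi x * (c + b' * x) ^+ 2)%:E.
have JN : J (- b)%R = J b.
  rewrite /J -(ge0_integral_oppr (f := fun x => (phi x * (c + b * x) ^+ 2)%:E))//.
  by apply: eq_integral => x _; rewrite normal_pdfN mulNr mulrN.
have JJ : J b + J b = (2 * (c ^+ 2 + b ^+ 2 * s ^+ 2))%:E.
  rewrite -{2}JN /J -ge0_integralD//.
  transitivity (\int[@lebR R]_x ((2 * c ^+ 2)%:E * (phi x)%:E +
      (2 * b ^+ 2)%:E * (x ^+ 2 * phi x)%:E)).
    by apply: eq_integral => x _; rewrite -!EFinM -!EFinD; congr EFin; ring.
  have c20 : (0 <= 2 * c ^+ 2)%R by apply: mulr_ge0 => //; exact: sqr_ge0.
  have b20 : (0 <= 2 * b ^+ 2)%R by apply: mulr_ge0 => //; exact: sqr_ge0.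
  have x20 (x : R) : (0 <= x ^+ 2 * phi x)%R.
    by apply: mulr_ge0; [exact: sqr_ge0|exact: normal_pdf_ge0].
  rewrite ge0_integralD//; last 4 first.
  - by move=> x _; rewrite -EFinM lee_fin mulr_ge0// normal_pdf_ge0.
  - by apply: emeasurable_funM => //; exact/measurable_EFinP.
  - by move=> x _; rewrite -EFinM lee_fin mulr_ge0.
  - apply: emeasurable_funM => //; apply/measurable_EFinP.
    by apply: measurable_funM => //; exact: measurable_funX.
  rewrite !ge0_integralZl//.
  all: try exact/measurable_EFinP.
  all: try by move=> x _; rewrite lee_fin ?normal_pdf_ge0.
  all: try by apply/measurable_EFinP; apply: measurable_funM => //; exact: measurable_funX.
  rewrite integral_lebR_normal_pdf integral_sqr_normal_pdf mule1 -EFinM -EFinD.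
  by congr EFin; ring.
(* [J b] can be halved out of [JJ] only as a real number; its finiteness also follows from [JJ]. *)
rewrite -/(J b); have : J b \is a fin_num.
  rewrite ge0_fin_numE ?integral_ge0//; move: JJ; case: (J b) => [r _|//|//].
  exact: ltry.
move: JJ => /[swap] /fineK <-; rewrite -EFinD => -[JJ]; congr EFin; lra.
Qed.

End normal_pdf_facts.

(** [h] and the Radon-Nikodym derivative have the same integral over every measurable set, hence
    agree almost everywhere, and the change of variables for the derivative carries over to [h]. *)
Lemma ge0_integral_density d (T : measurableType d) (R : realType)
    (nu : {finite_measure set T -> \bar R})
    (mu : {sigma_finite_measure set T -> \bar R}) (h f : T -> \bar R) :
  mu.-integrable setT h -> (forall x, 0 <= h x)%E ->
  (forall A, measurable A -> nu A = \int[mu]_(x in A) h x)%E ->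
  measurable_fun setT f -> (forall x, 0 <= f x)%E ->
  (\int[nu]_x f x = \int[mu]_x (f x * h x))%E.
Proof.
move=> ih h0 nuE mf f0.
have numu : nu `<< mu.
  apply/null_content_dominatesP => A mA A0; rewrite nuE//.
  by apply: null_set_integral => //; exact: measurable_funTS (measurable_int _ ih).
rewrite -(Radon_Nikodym_SigmaFinite.change_of_variables numu)//.
have ir := Radon_Nikodym_SigmaFinite.f_integrable numu.
apply: ae_eq_integral => //.
- by apply: emeasurable_funM => //; exact: measurable_int ir.
- by apply: emeasurable_funM => //; exact: measurable_int ih.
apply: ae_eqe_mul2l; apply: integral_ae_eq => //.
- exact: measurable_int ih.
- by move=> A _ mA; rewrite -Radon_Nikodym_SigmaFinite.f_integral// nuE.
Qed.

(* The standard normal law, on the canonical measurable structure of [R]. *)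
Definition stdnormal (R : realType) : set R -> \bar R :=
  pushforward (@normal_prob R 0 1) (idfun : measurableTypeR R -> R).

Section stdnormal.
Variable R : realType.
Local Open Scope ereal_scope.

Let stdnormal0 : @stdnormal R set0 = 0.
Proof. exact: (measure0 (@normal_prob R 0 1)). Qed.
Let stdnormal_ge0 A : 0 <= @stdnormal R A.
Proof. exact: (measure_ge0 (@normal_prob R 0 1)). Qed.
Let stdnormal_sigma_additive : semi_sigma_additive (@stdnormal R).
Proof. exact: (@measure_semi_sigma_additive _ _ _ (@normal_prob R 0 1)). Qed.

HB.instance Definition _ := isMeasure.Build _ _ _ (@stdnormal R)
  stdnormal0 stdnormal_ge0 stdnormal_sigma_additive.

Let stdnormal_setT : @stdnormal R setT = 1.
Proof. exact: (@probability_setT _ _ _ (@normal_prob R 0 1)). Qed.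

HB.instance Definition _ := Measure_isProbability.Build _ _ _ (@stdnormal R)
  stdnormal_setT.

Lemma integral_stdnormal (f : R -> \bar R) :
  measurable_fun setT f -> (forall x, 0 <= f x) ->
  \int[@stdnormal R]_x f x = \int[@lebR R]_x (f x * (normal_pdf 0 1 x)%:E).
Proof.
move=> mf f0.
have mp : measurable_fun [set: R] (fun x => (normal_pdf 0 1 x)%:E : \bar R).
  by apply/measurable_EFinP; exact: measurable_normal_pdf.
have p0 (x : R) : 0 <= (normal_pdf 0 1 x)%:E by rewrite lee_fin normal_pdf_ge0.
apply: (@ge0_integral_density _ _ _ (@stdnormal R) (@lebR R)
  (fun x => (normal_pdf 0 1 x)%:E)) => //.
- apply/integrableP; split => //.
  under eq_integral do rewrite gee0_abs//.
  by rewrite integral_lebR_normal_pdf// ltry.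
- move=> A mA; rewrite [LHS](_ : _ = normal_prob 0 1 A)// /normal_prob.
  rewrite -ge0_integral_lebR_mkcond//.
  + rewrite [RHS]integral_mkcond; apply: eq_integral => x _.
    by rewrite patchE indicE; case: ifPn => _; rewrite ?mul1r ?mul0r.
  + exact: measurable_normal_pdf.
  + by move=> x _; exact: normal_pdf_ge0.
Qed.

End stdnormal.

(** Locked so that the product stays folded inside the long integrands below. *)
HB.lock Definition gaussd (R : realType) (s : R) n (x : n.-tuple R) : R :=
  \prod_(i < n) normal_pdf 0 s (tnth x i).
Arguments gaussd {R} s {n} x.

Section gauss_density.
Variable R : realType.
Local Open Scope ring_scope.

Definition sqnorm n (x : n.-tuple R) : R := \sum_(i < n) tnth x i ^+ 2.

Lemma gaussd_cons s n a (v : n.-tuple R) :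
  gaussd s [tuple of a :: v] = normal_pdf 0 s a * gaussd s v.
Proof.
rewrite gaussd.unlock big_ord_recl; congr (_ * _).
by apply: eq_bigr => i _; rewrite tnthS.
Qed.

Lemma sqnorm_cons n a (v : n.-tuple R) :
  sqnorm [tuple of a :: v] = a ^+ 2 + sqnorm v.
Proof.
rewrite /sqnorm big_ord_recl; congr (_ + _).
by apply: eq_bigr => i _; rewrite tnthS.
Qed.

Lemma sqnorm_ge0 n (x : n.-tuple R) : 0 <= sqnorm x.
Proof. by apply: sumr_ge0 => i _; exact: sqr_ge0. Qed.

Lemma gaussd_ge0 s n (x : n.-tuple R) : 0 <= gaussd s x.
Proof. by rewrite gaussd.unlock; apply: prodr_ge0 => i _; exact: normal_pdf_ge0. Qed.

Lemma measurable_gaussd d (T : measurableType d) s n (f : T -> n.-tuple R) :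
  measurable_fun setT f -> measurable_fun setT (fun t => gaussd s (f t)).
Proof.
rewrite gaussd.unlock => mf; apply: measurable_prod => i _.
by apply: measurableT_comp; [exact: measurable_normal_pdf|exact: measurable_tnthT].
Qed.

Lemma measurable_sqnorm d (T : measurableType d) n (f : T -> n.-tuple R) :
  measurable_fun setT f -> measurable_fun setT (fun t => sqnorm (f t)).
Proof.
move=> mf; apply: measurable_sum => i.
by apply: measurable_funX; exact: measurable_tnthT.
Qed.

Section positive_deviation.
Variable s : R.
Hypothesis s0 : 0 < s.

Lemma gaussd_gt0 n (x : n.-tuple R) : 0 < gaussd s x.
Proof. by rewrite gaussd.unlock; apply: prodr_gt0 => i _; exact: normal_pdf_gt0. Qed.

Lemma gaussd_ub n (x : n.-tuple R) : gaussd s x <= normal_peak s ^+ n.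
Proof.
rewrite gaussd.unlock -[X in _ ^+ X]card_ord -prodr_const; apply: ler_prod => i _.
by rewrite normal_pdf_ge0 normal_pdf_ub// gt_eqF.
Qed.

Lemma normal_peakE : normal_peak s = normal_peak 1 / s.
Proof.
rewrite /normal_peak expr1n mul1r -mulrnAr sqrtrM ?sqr_ge0// sqrtr_sqr gtr0_norm//.
by rewrite invfM mulrC.
Qed.

(** The part [ln (normal_peak 1)] is common to all deviations and cancels whenever as many Gaussian
    logarithms are added as subtracted. *)
Lemma ln_gaussd n (x : n.-tuple R) :
  ln (gaussd s x) = n%:R * (ln (normal_peak 1) - ln s) - sqnorm x / (2 * s ^+ 2).
Proof.
have -> : gaussd s x = normal_peak s ^+ n * expR (- (sqnorm x / (2 * s ^+ 2))).
  rewrite gaussd.unlock normal_pdfE ?gt_eqF// big_split/= prodr_const card_ord.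
  congr (_ * _); rewrite -expR_sum; congr expR.
  rewrite /sqnorm mulr_suml -sumrN; apply: eq_bigr => i _.
  by rewrite subr0 mulNr mulr_natl.
rewrite lnM ?posrE ?exprn_gt0 ?expR_gt0 ?normal_peak_gt0 ?gt_eqF// expRK.
rewrite lnXn ?normal_peak_gt0 ?gt_eqF// normal_peakE ln_div ?posrE//.
  by rewrite -[_ *+ n]mulr_natl.
by rewrite normal_peak_gt0.
Qed.

Lemma integral_gaussd n : (\int[leb R n]_x (gaussd s x)%:E = 1)%E.
Proof.
elim: n => [|n IH].
  by rewrite integral_tuple_measure0 gaussd.unlock big_ord0.
rewrite integral_tuple_measureS; last 2 first.
- by apply/measurable_EFinP; exact: measurable_gaussd.
- by move=> x; rewrite lee_fin gaussd_ge0.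
rewrite -[RHS](integral_lebR_normal_pdf s); apply: eq_integral => a _.
transitivity (\int[leb R n]_v ((normal_pdf 0 s a)%:E * (gaussd s v)%:E))%E.
  by apply: eq_integral => v _; rewrite gaussd_cons EFinM.
rewrite ge0_integralZl ?IH ?mule1//.
- by apply/measurable_EFinP; exact: measurable_gaussd.
- by move=> x _; rewrite lee_fin gaussd_ge0.
- by rewrite lee_fin normal_pdf_ge0.
Qed.

Lemma integral_gaussd_sqnorm n (c : n.-tuple R) (b : R) :
  (\int[leb R n]_x (gaussd s x * sqnorm (c + scalet b x))%:E =
   (sqnorm c + n%:R * (b ^+ 2 * s ^+ 2))%:E)%E.
Proof.
elim: n => [|n IH] in c *.
  rewrite integral_tuple_measure0 gaussd.unlock /sqnorm !big_ord0 mulr0.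
  by rewrite mul0r addr0.
have mg (k : nat) (c' : k.-tuple R) : measurable_fun setT
    (fun x : k.-tuple R => (gaussd s x * sqnorm (c' + scalet b x))%:E).
  apply/measurable_EFinP; apply: measurable_funM; first exact: measurable_gaussd.
  by apply: measurable_sqnorm; apply: measurable_addt => //; exact: measurable_scalet.
have g0 (k : nat) (c' x : k.-tuple R) : (0 <= (gaussd s x * sqnorm (c' + scalet b x))%:E)%E.
  by rewrite lee_fin mulr_ge0 ?gaussd_ge0 ?sqnorm_ge0.
rewrite integral_tuple_measureS//.
pose c0 := tnth c ord0; pose c1 : n.-tuple R := [tuple of behead c].
have cE : c = [tuple of c0 :: c1] by exact: tuple_eta.
have E a (v : n.-tuple R) : sqnorm (c + scalet b [tuple of a :: v]) =
    (c0 + b * a) ^+ 2 + sqnorm (c1 + scalet b v).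
  rewrite cE -sqnorm_cons; congr sqnorm; apply: eq_from_tnth => i.
  have [->|i0] := eqVneq i ord0; first by rewrite tnthD tnthZ.
  have [j ->] : exists j, i = lift ord0 j.
    by case: (unliftP ord0 i) i0 => [j ->|->//]; exists j.
  by rewrite !tnthD tnthZ !tnthS tnthD tnthZ.
transitivity (\int[@lebR R]_a ((normal_pdf 0 s a * (c0 + b * a) ^+ 2)%:E +
   (sqnorm c1 + n%:R * (b ^+ 2 * s ^+ 2))%:E * (normal_pdf 0 s a)%:E))%E.
  apply: eq_integral => a _.
  transitivity (\int[leb R n]_v ((normal_pdf 0 s a * (c0 + b * a) ^+ 2)%:E * (gaussd s v)%:E +
     (normal_pdf 0 s a)%:E * (gaussd s v * sqnorm (c1 + scalet b v))%:E))%E.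
    apply: eq_integral => v _; rewrite gaussd_cons E -!EFinM -!EFinD.
    by congr EFin; ring.
  rewrite ge0_integralD//.
  - rewrite !ge0_integralZl//.
    + by rewrite integral_gaussd IH mule1 [in RHS]muleC.
    all: try by apply/measurable_EFinP; exact: measurable_gaussd.
    all: try by move=> x _; rewrite lee_fin gaussd_ge0.
    all: try by rewrite lee_fin normal_pdf_ge0.
    all: try by rewrite lee_fin mulr_ge0 ?sqr_ge0 ?normal_pdf_ge0.
    all: try by move=> x _; exact: g0.
    all: try exact: mg.
  - by move=> v _; rewrite -EFinM lee_fin mulr_ge0 ?gaussd_ge0// mulr_ge0 ?sqr_ge0 ?normal_pdf_ge0.
  - by apply: emeasurable_funM => //; apply/measurable_EFinP; exact: measurable_gaussd.
  - by move=> v _; rewrite mule_ge0// lee_fin normal_pdf_ge0.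
  - by apply: emeasurable_funM => //; exact: mg.
have mp : measurable_fun setT (fun x : R => (normal_pdf 0 s x)%:E).
  by apply/measurable_EFinP; exact: measurable_normal_pdf.
have k0 : 0 <= sqnorm c1 + n%:R * (b ^+ 2 * s ^+ 2).
  by rewrite addr_ge0 ?sqnorm_ge0// mulr_ge0// mulr_ge0 ?sqr_ge0.
rewrite ge0_integralD//.
- rewrite ge0_integralZl//.
  + rewrite integral_lebR_normal_pdf// integral_affine_sqr_normal_pdf// mule1.
    rewrite -EFinD cE sqnorm_cons; congr EFin; rewrite -natr1; ring.
  + by move=> x _; rewrite lee_fin normal_pdf_ge0.
- by move=> v _; rewrite lee_fin mulr_ge0 ?sqr_ge0 ?normal_pdf_ge0.
- apply/measurable_EFinP; apply: measurable_funM; first exact: measurable_normal_pdf.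
  by apply: measurable_funX; apply: measurable_funD => //; exact: measurable_funM.
- by move=> v _; rewrite mule_ge0 ?lee_fin ?normal_pdf_ge0.
- by apply: emeasurable_funM.
Qed.

End positive_deviation.

(* The joint density of [z2] and [z1 = g z2 + z'], factored the other way
   round: the square is completed in [z2]. *)
Lemma gaussd_convolution n (s tau g : R) (z1 z2 : n.-tuple R) :
  0 < s -> 0 < tau -> g ^+ 2 * s ^+ 2 + tau ^+ 2 = 1 ->
  gaussd s z2 * gaussd tau (z1 - scalet g z2) =
  gaussd 1 z1 * gaussd (s * tau) (z2 - scalet (g * s ^+ 2) z1).
Proof.
move=> s0 t0 gst; rewrite gaussd.unlock -!big_split/=; apply: eq_bigr => i _.
have st0 : 0 < s * tau by exact: mulr_gt0.
rewrite !tnthD !tnthN !tnthZ !normal_pdfE ?gt_eqF//.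
rewrite (normal_peakE s0) (normal_peakE t0) (normal_peakE st0) /normal_fun.
set p := normal_peak 1; set x := tnth z1 i; set y := tnth z2 i.
rewrite !subr0.
transitivity (p ^+ 2 / (s * tau) * expR (- y ^+ 2 / (s ^+ 2 *+ 2) + - (x - g * y) ^+ 2 / (tau ^+ 2 *+ 2))).
  by rewrite expRD; field; rewrite !gt_eqF.
transitivity (p ^+ 2 / (s * tau) * expR (- x ^+ 2 / (1 ^+ 2 *+ 2) + - (y - g * s ^+ 2 * x) ^+ 2 / ((s * tau) ^+ 2 *+ 2))); last first.
  by rewrite expRD; field; rewrite !gt_eqF.
(* Given z1, of variance 1, z2 has mean [g s^2 z1] and variance [s^2 tau^2]. The exponents agree
   once [tau^2] is eliminated by [gst]. *)
congr (_ * expR _).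
have -> : tau ^+ 2 = 1 - g ^+ 2 * s ^+ 2 by rewrite -gst; ring.
have t20 : 1 - g ^+ 2 * s ^+ 2 != 0.
  by rewrite -gst addrAC subrr add0r expf_eq0/= gt_eqF.
rewrite exprMn.
have -> : tau ^+ 2 = 1 - g ^+ 2 * s ^+ 2 by rewrite -gst; ring.
by field; rewrite exprMn t20 gt_eqF.
Qed.

End gauss_density.

(** * Mixture densities of a signal plus independent noise *)

Lemma measurable_invr d (T : measurableType d) (R : realType) (f : T -> R) :
  measurable_fun setT f -> measurable_fun setT (fun t => (f t)^-1).
Proof.
move=> mf.
(* The power function is measurable. The square makes its base nonnegative, and the factor [x]
   yields the conventional value 0 at 0. *)
have E x : x^-1 = x * (x ^+ 2) `^ (-1) :> R.
  have [->|x0] := eqVneq x 0; first by rewrite invr0 mul0r.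
  by rewrite powR_inv1 ?sqr_ge0// expr2 invfM mulrA divff// mul1r.
under eq_fun do rewrite E.
apply: measurable_funM => //.
apply: (@measurableT_comp _ _ _ _ _ _ (fun y : R => y `^ (-1)) _ (fun t => f t ^+ 2)).
  exact: measurable_powR.
exact: measurable_funX.
Qed.

(* Density of [x + Z] for [Z] of density [k] independent of [x]. *)
HB.lock Definition mixture d (T : measurableType d) (R : realType) (n : nat)
    (m : {finite_measure set T -> \bar R}) (k : n.-tuple R -> R)
    (x : T -> n.-tuple R) (y : n.-tuple R) : R :=
  fine (\int[m]_t (k (y - x t))%:E)%E.

Section mixture.
Context d (T : measurableType d) (R : realType) (n : nat).
Variables (m : {finite_measure set T -> \bar R}) (k : n.-tuple R -> R)
  (x : T -> n.-tuple R).
Hypotheses (mx : measurable_fun setT x) (mk : measurable_fun setT k).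
Hypothesis k0 : forall y, 0 <= k y.
Hypothesis kb : exists C, forall y, k y <= C.

Local Notation mixture := (mixture m k x).

Let mk2 : measurable_fun setT (fun p : T * n.-tuple R => (k (p.2 - x p.1))%:E).
Proof.
apply/measurable_EFinP; apply: (measurableT_comp mk); apply: measurable_addt => //.
by apply: measurable_oppt; exact: measurableT_comp.
Qed.

(** A bounded kernel has a finite integral against a finite measure, so [fine] loses nothing. *)
Lemma mixtureE y : (mixture y)%:E = (\int[m]_t (k (y - x t))%:E)%E.
Proof.
rewrite mixture.unlock fineK// ge0_fin_numE; last first.
  by apply: integral_ge0 => t _; rewrite lee_fin.
have [C kC] := kb.
apply: (@le_lt_trans _ _ (\int[m]_t (cst C%:E t))%E).
  apply: ge0_le_integral => //.
  - by move=> t _; rewrite lee_fin.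
  - exact: (measurableT_comp mk2 (measurable_fun_pair (@measurable_id _ _ _) (measurable_cst y))).
  - by move=> t _; rewrite lee_fin.
rewrite integral_cst// lte_mul_pinfty//.
  by rewrite lee_fin (le_trans (k0 0)).
by rewrite ltey_eq fin_num_measure.
Qed.

(** If the integral of a positive function vanished, the whole space would be a null set, contrary
    to its positive mass. *)
Lemma mixture_gt0 y : (forall y, 0 < k y) -> (0 < m setT)%E -> 0 < mixture y.
Proof.
move=> kp m0; rewrite -lte_fin mixtureE lt_neqAle integral_ge0 ?andbT; last first.
  by move=> t _; rewrite lee_fin.
apply/negP => /eqP I0.
have mf : measurable_fun setT (fun t => (k (y - x t))%:E).
  exact: (measurableT_comp mk2 (measurable_fun_pair (@measurable_id _ _ _) (measurable_cst y))).
have /(ae_eq_integral_abs m measurableT mf) : (\int[m]_t `|(k (y - x t))%:E| = 0)%E.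
  rewrite [RHS]I0; apply: eq_integral => t _; rewrite gee0_abs// lee_fin.
  exact: k0.
move=> [N [mN N0 subN]].
move: m0; rewrite (_ : setT = N) ?N0 ?ltxx//.
apply/seteqP; split => // t _; apply: subN => /= /(_ I) [kt].
by have := kp (y - x t); rewrite kt ltxx.
Qed.

Lemma measurable_mixture : measurable_fun setT mixture.
Proof.
apply/measurable_EFinP.
rewrite (_ : EFin \o mixture = fun y => (\int[m]_t (k (y - x t))%:E)%E); last first.
  by apply/funext => y; rewrite -mixtureE.
apply: (measurable_fun_fubini_tonelli_G
  (fun p : T * n.-tuple R => (k (p.2 - x p.1))%:E)) => //.
by move=> p; rewrite lee_fin.
Qed.

(** The substitution [y = x t + z] followed by Tonelli's theorem: an average over signal and noise
    becomes an integral over the received block. *)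
Lemma integral_mixture (H : T -> n.-tuple R -> \bar R) :
  measurable_fun setT (fun p : T * n.-tuple R => H p.1 p.2) ->
  (forall t y, 0 <= H t y)%E ->
  (\int[m]_t \int[leb R n]_z ((k z)%:E * H t (x t + z)%R) =
   \int[leb R n]_y \int[m]_t ((k (y - x t))%:E * H t y))%E.
Proof.
move=> mH H0.
rewrite -(fubini_tonelli (m1 := m) (m2 := leb R n)
  (fun p : T * n.-tuple R => ((k (p.2 - x p.1))%:E * H p.1 p.2)%E)).
- apply: eq_integral => t _.
  rewrite -(ge0_integral_shift_tuple (x t)
    (f := fun y => ((k (y - x t))%:E * H t y)%E)).
  + by apply: eq_integral => z _; rewrite addrK addrC.
  + apply: emeasurable_funM.
      exact: (measurableT_comp mk2 (measurable_fun_pair (measurable_cst t) (@measurable_id _ _ _))).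
    exact: (measurableT_comp mH (measurable_fun_pair (measurable_cst t) (@measurable_id _ _ _))).
  + by move=> y; rewrite mule_ge0// lee_fin.
- by apply: emeasurable_funM.
- by move=> p; rewrite mule_ge0// lee_fin.
Qed.

Lemma integral_mixture_cst (H : n.-tuple R -> \bar R) :
  measurable_fun setT H -> (forall y, 0 <= H y)%E ->
  (\int[m]_t \int[leb R n]_z ((k z)%:E * H (x t + z)%R) =
   \int[leb R n]_y ((mixture y)%:E * H y))%E.
Proof.
move=> mH H0; rewrite (integral_mixture (H := fun=> H))//; last first.
  exact: measurableT_comp.
apply: eq_integral => y _; rewrite mixtureE ge0_integralZr//.
- exact: (measurableT_comp mk2 (measurable_fun_pair (@measurable_id _ _ _) (measurable_cst y))).
- by move=> t _; rewrite lee_fin.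
Qed.

Lemma integral_mixture1 : (\int[leb R n]_y (mixture y)%:E =
  m setT * \int[leb R n]_z (k z)%:E)%E.
Proof.
transitivity (\int[leb R n]_y ((mixture y)%:E * cst 1 y))%E.
  by apply: eq_integral => y _; rewrite mule1.
rewrite -integral_mixture_cst//.
under eq_integral do under eq_integral do rewrite mule1.
by rewrite integral_cst// muleC.
Qed.

End mixture.

(** Measurability by recursion on the expression. Constants are tried before compound terms, and the
    last clause applies a measurability hypothesis on the head function. *)
Ltac mfun_step :=
  first [ assumption | lazymatch goal with
  | |- measurable_fun _ (fun _ => ?c) => exact: measurable_cst
  | |- measurable_fun _ (fun x => x) => exact: measurable_id
  | |- measurable_fun _ (fun x => EFin (@?f x)) => apply/measurable_EFinP
  | |- measurable_fun _ (fun x => (@?f x, @?g x)) => apply: measurable_fun_pair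
  | |- measurable_fun _ (fun x => fst x) => exact: measurable_fst
  | |- measurable_fun _ (fun x => snd x) => exact: measurable_snd
  | |- measurable_fun _ (fun x => fst (@?f x)) =>
      apply: (measurableT_comp measurable_fst)
  | |- measurable_fun _ (fun x => snd (@?f x)) =>
      apply: (measurableT_comp measurable_snd)
  | |- measurable_fun _ (fun x => gaussd _ (@?f x)) => apply: measurable_gaussd
  | |- measurable_fun _ (@gaussd _ _ _) =>
      exact: (measurable_gaussd _ (@measurable_id _ _ _))
  | |- measurable_fun _ (@scalet _ _ _) =>
      exact: (measurable_scalet _ (@measurable_id _ _ _))
  | |- measurable_fun _ (@GRing.add _ ?c) =>
      exact: (measurable_addt (measurable_cst c) (@measurable_id _ _ _))
  | |- measurable_fun _ (@sqnorm _ _) =>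
      exact: (measurable_sqnorm (@measurable_id _ _ _))
  | |- measurable_fun _ (fun x => sqnorm (@?f x)) => apply: measurable_sqnorm
  | |- measurable_fun _ (fun x => scalet _ (@?f x)) => apply: measurable_scalet
  | |- measurable_fun _ (fun x => GRing.inv (@?f x)) => apply: measurable_invr
  | |- measurable_fun _ (fun x => ln (@?f x)) =>
      apply: (measurableT_comp (@measurable_ln _))
  | |- measurable_fun _ (fun x => Order.max (@?f x) (@?g x)) =>
      apply: measurable_maxr
  | |- measurable_fun _ (fun x => @GRing.opp _ (@?f x)) =>
      first [apply: measurable_funN | apply: measurable_oppt]
  | |- measurable_fun _ (fun x => @GRing.add _ (@?f x) (@?g x)) =>
      first [apply: measurable_funD | apply: measurable_addt]
  | |- measurable_fun _ (fun x => @GRing.mul _ (@?f x) (@?g x)) =>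
      apply: measurable_funM
  | |- measurable_fun _ (fun x => mule (@?f x) (@?g x)) => apply: emeasurable_funM
  | |- measurable_fun _ (fun x => adde (@?f x) (@?g x)) => apply: emeasurable_funD
  | H : measurable_fun _ ?h |- measurable_fun _ (fun x => ?h (@?f x)) =>
      apply: (measurableT_comp H)
  end ].
Ltac mfun := repeat mfun_step.

Lemma ge0_integral_scale d (T : measurableType d) (R : realType)
    (m : {measure set T -> \bar R}) (k : R) (f : T -> R) :
  measurable_fun setT f -> (forall t, 0 <= f t) -> 0 <= k ->
  (\int[m]_t (k * f t)%:E = k%:E * \int[m]_t (f t)%:E)%E.
Proof.
move=> mf f0 k0; rewrite -ge0_integralZl//; first exact/measurable_EFinP.
by move=> t _; rewrite lee_fin.
Qed.

Lemma ge0_integral_add d (T : measurableType d) (R : realType)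
    (m : {measure set T -> \bar R}) (f g : T -> R) :
  measurable_fun setT f -> (forall t, 0 <= f t) ->
  measurable_fun setT g -> (forall t, 0 <= g t) ->
  (\int[m]_t (f t + g t)%:E = \int[m]_t (f t)%:E + \int[m]_t (g t)%:E)%E.
Proof.
move=> mf f0 mg g0; rewrite -ge0_integralD//.
- by move=> t _; rewrite lee_fin.
- exact/measurable_EFinP.
- by move=> t _; rewrite lee_fin.
- exact/measurable_EFinP.
Qed.

(** Integrates a pointwise inequality term by term. With all functions nonnegative the integrals may
    be infinite, so no integrability has to be proved for the many terms that occur. *)
Lemma ge0_integral_le_sums d (T : measurableType d) (R : realType)
    (M : {measure set T -> \bar R}) (fs gs : seq (T -> R)) :
  (forall f, List.In f (fs ++ gs) -> measurable_fun setT f) ->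
  (forall f p, List.In f (fs ++ gs) -> 0 <= f p) ->
  (forall p, \sum_(f <- fs) f p <= \sum_(f <- gs) f p) ->
  (\sum_(f <- fs) \int[M]_p (f p)%:E <= \sum_(f <- gs) \int[M]_p (f p)%:E)%E.
Proof.
move=> mf f0 fg.
have E (hs : seq (T -> R)) : (forall f, List.In f hs -> measurable_fun setT f) ->
    (forall f p, List.In f hs -> 0 <= f p) ->
    [/\ measurable_fun setT (fun p => \sum_(f <- hs) f p),
        forall p, 0 <= \sum_(f <- hs) f p &
      (\int[M]_p (\sum_(f <- hs) f p)%:E = \sum_(f <- hs) \int[M]_p (f p)%:E)%E].
  elim: hs => [|h hs IH] mh h0.
    split; [|by move=> p; rewrite big_nil|].
      by under eq_fun do rewrite big_nil; exact: measurable_cst.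
    by rewrite big_nil; under eq_integral do rewrite big_nil; rewrite integral0.
  have [||mS S0 IS] := IH; first by move=> f Hf; apply: mh; right.
    by move=> f p Hf; apply: h0; right.
  have mh' : measurable_fun setT h by apply: mh; left.
  have h0' p : 0 <= h p by apply: h0; left.
  split; [|by move=> p; rewrite big_cons addr_ge0|].
    by under eq_fun do rewrite big_cons; exact: measurable_funD.
  rewrite big_cons -IS -ge0_integral_add//.
  by apply: eq_integral => p _; rewrite big_cons.
have [||mF F0 <-] := E fs.
- by move=> f Hf; apply: mf; apply/List.in_or_app; left.
- by move=> f p Hf; apply: f0; apply/List.in_or_app; left.
have [||mG G0 <-] := E gs.
- by move=> f Hf; apply: mf; apply/List.in_or_app; right.
- by move=> f p Hf; apply: f0; apply/List.in_or_app; right.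
apply: ge0_le_integral => //.
- by move=> p _; rewrite lee_fin.
- exact/measurable_EFinP.
- exact/measurable_EFinP.
- by move=> p _; rewrite lee_fin.
Qed.

(** The bounds [2 p], [2 p], [p] and [p] on the expectations of the four ratios add up to [6 p]. *)
Lemma le_sums_collect (R : realDomainType) (X1 X2 L A1 A2 LP B Q K : \bar R) (c p : R) :
  (X1 + (X2 + (L + (c%:E + (c%:E + 0)))) <=
   A1 + (A2 + (p%:E + (p%:E + (LP + (B + (Q + (K + 0))))))))%E ->
  (A1 <= (2 * p)%:E)%E -> (A2 <= (2 * p)%:E)%E ->
  (X1 + X2 + L + (c + c)%:E <= (6 * p)%:E + LP + B + Q + K)%E.
Proof.
rewrite !adde0 EFinD => H A1p A2p; rewrite -!addeA; apply: le_trans H _.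
rewrite (_ : 6 * p = 2 * p + (2 * p + (p + p))); last by ring.
rewrite 3!EFinD -!addeA; apply: leeD => //; exact: leeD.
Qed.

(* Four applications of [ln x <= x]; all auxiliary densities cancel on the left. *)
Lemma sum_ln_le (R : realType) (d1 d2 e p fy1 fu b fy2 gs gt qb q : R) :
  0 < d1 -> 0 < d2 -> 0 < e -> 0 < p -> 0 < fy1 -> 0 < fu -> 0 < b ->
  0 < fy2 -> 0 < gs -> 0 < gt -> 0 < qb -> 0 < q ->
  ln d1 + ln d2 + ln e + ln p + ln qb + ln q - ln gs - ln gt <=
  d1 * fy1 / fu + d2 * e * p * b * fy2 / (gs * fy1) + qb / b + fu * q / (fy2 * gt).
Proof.
move=> d10 d20 e0 p0 fy10 fu0 b0 fy20 gs0 gt0 qb0 q0.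
have H (x : R) : 0 < x -> ln x <= x by move=> x0; exact/ltW/ln_sublinear.
have := H (d1 * fy1 / fu) ltac:(by rewrite divr_gt0 ?mulr_gt0).
have := H (d2 * e * p * b * fy2 / (gs * fy1)) ltac:(by rewrite divr_gt0 ?mulr_gt0).
have := H (qb / b) ltac:(by rewrite divr_gt0).
have := H (fu * q / (fy2 * gt)) ltac:(by rewrite divr_gt0 ?mulr_gt0).
rewrite !ln_div ?posrE ?mulr_gt0// !lnM ?posrE ?mulr_gt0//.
set x1 := d1 * fy1 / fu; set x2 := d2 * e * p * b * fy2 / (gs * fy1).
set x3 := qb / b; set x4 := fu * q / (fy2 * gt).
lra.
Qed.

(** * Splitting the noise of receiver 1 along that of receiver 2 *)

Section noise_laws.
Variables (R : realType) (n : nat) (s tau g : R).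
Hypotheses (s0 : 0 < s) (tau0 : 0 < tau).
Hypothesis gst : g ^+ 2 * s ^+ 2 + tau ^+ 2 = 1.
Notation E := (n.-tuple R).

Lemma integral_gaussd_shift (r : R) (c : E) : 0 < r ->
  (\int[leb R n]_x (gaussd r (x - c))%:E = 1)%E.
Proof.
move=> r0; rewrite -(integral_gaussd r n) -(ge0_integral_shift_tuple (- c)
  (f := fun x => (gaussd r x)%:E))//.
- by mfun.
- by move=> x; rewrite lee_fin gaussd_ge0.
Qed.

Lemma gaussd_convolutionE (z1 : E) :
  (\int[leb R n]_z (gaussd s z * gaussd tau (z1 - scalet g z))%:E =
   (gaussd 1 z1)%:E)%E.
Proof.
under eq_integral do rewrite gaussd_convolution// EFinM.
rewrite ge0_integralZl//.
- by rewrite integral_gaussd_shift ?mule1// mulr_gt0.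
- by mfun.
- by move=> z _; rewrite lee_fin gaussd_ge0.
- by rewrite lee_fin gaussd_ge0.
Qed.

(** The block [g z + z'] is standard normal: it replaces [z'] as the variable of integration, and z
    is then integrated out by completing the square. *)
Lemma integral_noise_sum (H : E -> \bar R) :
  measurable_fun setT H -> (forall y, 0 <= H y)%E ->
  (\int[leb R n]_z \int[leb R n]_z' ((gaussd s z * gaussd tau z')%:E *
     H (scalet g z + z')%R) =
   \int[leb R n]_y ((gaussd 1 y)%:E * H y))%E.
Proof.
move=> mH H0.
transitivity (\int[leb R n]_z \int[leb R n]_y
  ((gaussd s z * gaussd tau (y - scalet g z))%:E * H y))%E.
  apply: eq_integral => z _.
  rewrite -(ge0_integral_shift_tuple (scalet g z) (f := fun y =>
    ((gaussd s z * gaussd tau (y - scalet g z))%:E * H y)%E)).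
  - by apply: eq_integral => z' _; rewrite addrK addrC.
  - by mfun.
  - by move=> y; rewrite mule_ge0// lee_fin mulr_ge0// gaussd_ge0.
rewrite (fubini_tonelli (m1 := leb R n) (m2 := leb R n) (fun p : E * E =>
  ((gaussd s p.1 * gaussd tau (p.2 - scalet g p.1))%:E * H p.2)%E)); last 2 first.
- by mfun.
- by move=> y; rewrite mule_ge0// lee_fin mulr_ge0// gaussd_ge0.
apply: eq_integral => y _ /=; rewrite ge0_integralZr ?gaussd_convolutionE//.
- by mfun.
- by move=> z _; rewrite lee_fin mulr_ge0// gaussd_ge0.
Qed.

End noise_laws.

Section swap.
Context d1 d2 d3 d4 (T1 : measurableType d1) (T2 : measurableType d2)
  (T3 : measurableType d3) (T4 : measurableType d4) (R : realType).
Variables (m1 : {sigma_finite_measure set T1 -> \bar R})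
  (m2 : {sigma_finite_measure set T2 -> \bar R})
  (m3 : {sigma_finite_measure set T3 -> \bar R})
  (m4 : {sigma_finite_measure set T4 -> \bar R}).
Local Open Scope ereal_scope.
Variable F : T1 * (T2 * (T3 * T4)) -> \bar R.
Hypotheses (mF : measurable_fun setT F) (F0 : forall p, 0 <= F p).

Let G (p : T1 * (T2 * T3)) := \int[m4]_d F (p.1, (p.2.1, (p.2.2, d))).

Let mG : measurable_fun setT G.
Proof.
apply: (measurable_fun_fubini_tonelli_F (m2 := m4)
  (fun q : (T1 * (T2 * T3)) * T4 => F (q.1.1, (q.1.2.1, (q.1.2.2, q.2))))) => //.
by apply: (measurableT_comp mF); mfun.
Qed.

Let G0 p : 0 <= G p. Proof. exact: integral_ge0. Qed.

(** Tonelli's theorem for the first variable against the pair of the second and third, the fourth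
    being integrated out already. The new order makes source 1 and z' adjacent, so that [s1 + z']
    can become a single variable. *)
Lemma integral_swap4 :
  \int[m1]_a \int[m2]_b \int[m3]_c \int[m4]_d F (a, (b, (c, d))) =
  \int[m2]_b \int[m3]_c \int[m1]_a \int[m4]_d F (a, (b, (c, d))).
Proof.
transitivity (\int[m1]_a \int[prodm m2 m3]_q G (a, q)).
  apply: eq_integral => a _.
  rewrite (@integral_prodm _ _ _ _ _ m2 m3 (fun q => G (a, q)))//.
  by apply: (measurableT_comp mG); mfun.
rewrite [LHS](fubini_tonelli G)//.
by rewrite integral_prodm//; [exact: measurable_fun_fubini_tonelli_G|move=> p; exact: integral_ge0].
Qed.

Lemma integral_prodm4 :
  \int[prodm m1 (prodm m2 (prodm m3 m4))]_p F p =
  \int[m1]_a \int[m2]_b \int[m3]_c \int[m4]_d F (a, (b, (c, d))).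
Proof.
rewrite integral_prodm//; apply: eq_integral => a _.
rewrite integral_prodm//; last by apply: (measurableT_comp mF); mfun.
apply: eq_integral => b _; rewrite integral_prodm//.
by apply: (measurableT_comp mF); mfun.
Qed.

End swap.

(** * Change of measure for one value of the cooperative signal *)

Section core.
Context (R : realType) (n : nat).
Notation E := (n.-tuple R).
Notation lam := (leb R n).
Context d1 d2 (T1 : measurableType d1) (T2 : measurableType d2).
(** [m2] is meant as the law of source 2 restricted, without normalisation, to one value of the
    cooperative signal; [pi2] is the probability of that value. Source 1 is independent of it, so
    [m1] stays a probability. *)
Variables (m1 : probability T1 R) (m2 : {finite_measure set T2 -> \bar R}).
Variables (s1 : T1 -> E) (s2 : T2 -> E) (w2 : T2 -> nat).
Hypotheses (ms1 : measurable_fun setT s1) (ms2 : measurable_fun setT s2)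
  (mw2 : measurable_fun setT w2).
Variables (s tau g pi2 : R).
Hypotheses (s0 : 0 < s) (tau0 : 0 < tau).
Hypothesis gst : g ^+ 2 * s ^+ 2 + tau ^+ 2 = 1.
Hypotheses (pi20 : 0 < pi2) (m2T : m2 setT = pi2%:E).
(* [D1] and [D2] are the decoding indicators multiplied by the numbers of
   messages; [e] is the inverse of the density of the joint law of message 2
   and [Y1] with respect to the product of the marginals [pW] and [mY]. *)
Variables (D1 : T1 * E -> R) (D2 e : nat * E -> R).
Hypotheses (mD1 : measurable_fun setT D1) (mD2 : measurable_fun setT D2)
  (me : measurable_fun setT e).
Hypotheses (D10 : forall p, 0 <= D1 p) (D20 : forall p, 0 <= D2 p)
  (e0 : forall p, 0 < e p).
Variables (mY : probability E R) (pW : probability nat R).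
Hypothesis D1_le1 : forall y, (\int[m1]_t (D1 (t, y))%:E <= 1)%E.
Hypothesis D2_le1 : forall y, (\int[pW]_w (D2 (w, y))%:E <= 1)%E.
(** The change of measure from the joint law of message 2 and Y1 to the product law. It is an
    inequality because one value of the cooperative signal carries only part of the joint law, and
    because the product law may charge points where the density vanishes. *)
Hypothesis HE : forall H : nat * E -> \bar R, measurable_fun setT H ->
  (forall p, 0 <= H p)%E ->
  (\int[m2]_t2 \int[m1]_t1 \int[lam]_z ((gaussd 1 z)%:E *
      ((e (w2 t2, (s1 t1 + z + scalet g (s2 t2))%R))%:E *
        H (w2 t2, (s1 t1 + z + scalet g (s2 t2))%R))) <=
   \int[mY]_y \int[pW]_w H (w, y))%E.

(* Densities of [U = g s2 + z1], [Y2 = s2 + z2], [s1 + z1], [s1 + z'] and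
   [Y1 = s1 + z1 + g s2], with [z1 = g z2 + z']; those that involve [s2] have
   total mass [pi2]. The four lemmas [integral_A] bound the expectations of the
   ratios to which [ln x <= x] is applied. *)
Definition fU := mixture m2 (gaussd 1) (fun t => scalet g (s2 t)).
Definition fY2 := mixture m2 (gaussd s) s2.
Definition bB := mixture m1 (gaussd 1) s1.
Definition kT := mixture m1 (gaussd tau) s1.
Definition fY1 := mixture m2 bB (fun t => scalet g (s2 t)).

Let mgs2 : measurable_fun setT (fun t => scalet g (s2 t)). Proof. by mfun. Qed.

Let mg (r : R) : measurable_fun setT (gaussd r (n := n)). Proof. by mfun. Qed.
Let g0 (r : R) (y : E) : 0 <= gaussd r y. Proof. exact: gaussd_ge0. Qed.
Let gb (r : R) : 0 < r -> exists C, forall y : E, gaussd r y <= C.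
Proof. by move=> r0; exists (normal_peak r ^+ n) => y; exact: gaussd_ub. Qed.

Let mfU : measurable_fun setT fU. Proof. by apply: measurable_mixture => //; exact: gb. Qed.
Let mfY2 : measurable_fun setT fY2. Proof. by apply: measurable_mixture => //; exact: gb. Qed.
Let mbB : measurable_fun setT bB. Proof. by apply: measurable_mixture => //; exact: gb. Qed.
Let mkT : measurable_fun setT kT. Proof. by apply: measurable_mixture => //; exact: gb. Qed.
Let m2T0 : (0 < m2 setT)%E. Proof. by rewrite m2T lte_fin. Qed.
Let m1T0 : (0 < m1 setT)%E. Proof. by rewrite probability_setT. Qed.
Let fU0 y : 0 < fU y.
Proof. by apply: mixture_gt0 => //; [exact: gb|move=> z; exact: gaussd_gt0]. Qed.
Let fY20 y : 0 < fY2 y.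
Proof. by apply: mixture_gt0 => //; [exact: gb|move=> z; exact: gaussd_gt0]. Qed.
Let bB0 y : 0 < bB y.
Proof. by apply: mixture_gt0 => //; [exact: gb|move=> z; exact: gaussd_gt0]. Qed.
Let kT0 y : 0 < kT y.
Proof. by apply: mixture_gt0 => //; [exact: gb|move=> z; exact: gaussd_gt0]. Qed.
Let bBge0 y : 0 <= bB y. Proof. exact: ltW. Qed.

(** A mixture of Gaussians stays below the Gaussian peak, so [bB] can itself serve as the kernel of
    the mixture [fY1]. *)
Let bBb : exists C, forall y, bB y <= C.
Proof.
exists (normal_peak 1 ^+ n) => y; rewrite -lee_fin mixtureE//; last exact: gb.
rewrite -[leRHS]mule1 -(probability_setT m1) -integral_cst//.
apply: ge0_le_integral => //.
- by move=> t _; rewrite lee_fin.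
- by mfun.
- by move=> t _; rewrite lee_fin gaussd_ub.
Qed.

Let mfY1 : measurable_fun setT fY1. Proof. exact: measurable_mixture. Qed.
Let fY10 y : 0 < fY1 y. Proof. exact: mixture_gt0. Qed.

Let int_fU : (\int[lam]_y (fU y)%:E = pi2%:E)%E.
Proof.
by rewrite integral_mixture1 ?m2T ?integral_gaussd ?mule1//; exact: gb.
Qed.
Let int_bB : (\int[lam]_y (bB y)%:E = 1)%E.
Proof.
rewrite integral_mixture1; [|by []|by []|by []|exact: gb].
by rewrite integral_gaussd ?mule1//; exact: probability_setT.
Qed.
Let int_fY1 : (\int[lam]_y (fY1 y)%:E = pi2%:E)%E.
Proof. by rewrite integral_mixture1 ?m2T ?int_bB ?mule1. Qed.

(** Expresses [s1 + z1 = g z2 + (s1 + z')] as a sum of independent terms. *)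
Let bB_convolution y : (\int[lam]_z (gaussd s z * kT (y - scalet g z))%:E = (bB y)%:E)%E.
Proof.
rewrite /bB mixtureE//; last exact: gb.
transitivity (\int[lam]_z \int[m1]_t (gaussd s z * gaussd tau (y - s1 t - scalet g z))%:E)%E.
  apply: eq_integral => z _; rewrite EFinM /kT mixtureE//; last exact: gb.
  rewrite (@ge0_integral_scale _ _ _ m1 (gaussd s z)
    (fun t => gaussd tau (y - s1 t - scalet g z)))//.
  - by congr (_ * _)%E; apply: eq_integral => t _; rewrite addrAC.
  - by mfun.
rewrite -(fubini_tonelli (m1 := m1) (m2 := lam)
  (fun p : T1 * E => (gaussd s p.2 * gaussd tau (y - s1 p.1 - scalet g p.2))%:E)).
- by apply: eq_integral => t _; rewrite -(gaussd_convolutionE s0 tau0 gst).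
- by mfun.
- by move=> p; rewrite lee_fin mulr_ge0.
Qed.

(** Since [Y1 = g Y2 + (s1 + z')] with independent terms, [kT (y1 - g y) * fY2 y] is the joint
    density of Y2 and Y1, here integrated over y. This is where independence of the two inputs given
    the cooperative signal is used. *)
Let fY1_convolution y1 :
  (\int[lam]_y (kT (y1 - scalet g y) * fY2 y)%:E = (fY1 y1)%:E)%E.
Proof.
transitivity (\int[lam]_y ((fY2 y)%:E * (kT (y1 - scalet g y))%:E))%E.
  by apply: eq_integral => y _; rewrite mulrC EFinM.
rewrite /fY2 -(@integral_mixture_cst _ _ _ _ m2 (gaussd s) s2 ms2 (mg s)
  (@g0 s) (gb s0) (fun y => (kT (y1 - scalet g y))%:E)).
- rewrite /fY1 mixtureE//; apply: eq_integral => t _.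
  rewrite -bB_convolution; apply: eq_integral => z _; rewrite -EFinM.
  congr (_ * kT _)%:E; apply: eq_from_tnth => i.
  by rewrite !(tnthD, tnthN, tnthZ); ring.
- by mfun.
- by move=> y; rewrite lee_fin ltW.
Qed.

Let noise (H : E -> \bar R) :
  measurable_fun setT H -> (forall y, 0 <= H y)%E ->
  (\int[lam]_z \int[lam]_z' ((gaussd s z * gaussd tau z')%:E *
     H (scalet g z + z')%R) =
   \int[lam]_y ((gaussd 1 y)%:E * H y))%E.
Proof. by move=> mH H0; exact: integral_noise_sum. Qed.

Let mass1D (d : measure_display) (T : measurableType d) (m : probability T R) (f : T -> R) :
  measurable_fun setT f -> (forall t, 0 <= f t) -> (\int[m]_t (f t)%:E <= 1)%E ->
  (\int[m]_t (1 + f t)%:E <= 2%:E)%E.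
Proof.
move=> mf f0 f1; under eq_integral do rewrite EFinD.
rewrite ge0_integralD//; last exact/measurable_EFinP.
  rewrite integral_cst// [X in (_ * X)%E](_ : _ = 1%E); last first.
    exact: probability_setT.
  by rewrite mule1 -[2%:E]/((1 + 1)%:E) EFinD leeD2l.
by move=> t _; rewrite lee_fin.
Qed.

(** For fixed source 1, U has density [fU], which cancels. There remains the integral of
    [(1 + D1) fY1], where averaging over source 1 bounds [1 + D1] by 2 and [fY1] has mass [pi2]. *)
Lemma integral_A1 :
  (\int[m1]_t1 \int[m2]_t2 \int[lam]_z \int[lam]_z'
    (gaussd s z * gaussd tau z' *
     ((1 + D1 (t1, s1 t1 + (scalet g z + z') + scalet g (s2 t2))%R) *
      fY1 (s1 t1 + (scalet g z + z') + scalet g (s2 t2)) /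
      fU (scalet g (s2 t2) + (scalet g z + z'))))%:E <= (2 * pi2)%:E)%E.
Proof.
have D11 p : 0 <= 1 + D1 p by rewrite addr_ge0.
have pos t1 y : 0 <= (1 + D1 (t1, y)) * fY1 y by rewrite mulr_ge0// ltW.
have E1 t1 : (\int[m2]_t2 \int[lam]_z \int[lam]_z'
    (gaussd s z * gaussd tau z' *
     ((1 + D1 (t1, s1 t1 + (scalet g z + z') + scalet g (s2 t2))%R) *
      fY1 (s1 t1 + (scalet g z + z') + scalet g (s2 t2)) /
      fU (scalet g (s2 t2) + (scalet g z + z'))))%:E =
    \int[lam]_y ((1 + D1 (t1, y)) * fY1 y)%:E)%E.
  (* At [U = u] with source 1 fixed, Y1 is [u + s1 t1]. *)
  pose H u := ((1 + D1 (t1, u + s1 t1)) * fY1 (u + s1 t1) / fU u)%:E.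
  have mH : measurable_fun setT H by rewrite /H; mfun.
  have H0 u : (0 <= H u)%E by rewrite lee_fin divr_ge0 ?pos ?ltW.
  rewrite -(ge0_integral_shift_tuple (s1 t1)
    (f := fun y => ((1 + D1 (t1, y)) * fY1 y)%:E)); last 2 first.
  - by mfun.
  - by move=> y; rewrite lee_fin.
  transitivity (\int[lam]_y ((fU y)%:E * H y))%E; last first.
    apply: eq_integral => y _; rewrite /H -EFinM; congr EFin.
    by rewrite mulrC divfK// gt_eqF.
  rewrite -[RHS](@integral_mixture_cst _ _ _ _ m2 (gaussd 1) _ mgs2 (mg 1)
    (@g0 1) (gb ltr01) H mH H0).
  apply: eq_integral => t2 _.
  have mHs : measurable_fun setT (fun u => H (scalet g (s2 t2) + u)).
    by apply: (measurableT_comp mH); mfun.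
  apply: etrans (noise mHs (fun u => H0 _)).
  apply: eq_integral => z _; apply: eq_integral => z' _.
  rewrite /H -EFinM; congr (_ * (_ / _))%:E.
  by rewrite (_ : s1 t1 + _ + _ = scalet g (s2 t2) + (scalet g z + z') + s1 t1)// addrC addrA addrAC.
under eq_integral do rewrite E1.
rewrite [leLHS](fubini_tonelli (m1 := m1) (m2 := lam)
  (fun p : T1 * E => ((1 + D1 (p.1, p.2)) * fY1 p.2)%:E)); last 2 first.
- by mfun.
- by move=> p; rewrite lee_fin.
rewrite EFinM -int_fY1 -ge0_integral_scale//; last by move=> y; exact: ltW.
apply: ge0_le_integral => //.
- by move=> y _; apply: integral_ge0 => t _; rewrite lee_fin.
- apply: (measurable_fun_fubini_tonelli_G
    (fun p : T1 * E => ((1 + D1 (p.1, p.2)) * fY1 p.2)%:E)).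
    by mfun.
  by move=> p; rewrite lee_fin.
- by mfun.
- move=> y _ /=.
  have mDy : measurable_fun setT (fun t => D1 (t, y)) by mfun.
  under eq_integral do rewrite mulrC.
  rewrite ge0_integral_scale//; last 2 first.
  - by mfun.
  - exact: ltW.
  rewrite [leRHS]EFinM [leRHS]muleC; apply: lee_wpmul2l; first by rewrite lee_fin ltW.
  exact: mass1D.
Qed.

(** The density [bB] of [s1 + z1] cancels the denominator and leaves a Gaussian of mass one, times
    the mass of [m2]. *)
Lemma integral_A3 (sB : R) : 0 < sB ->
  (\int[m1]_t1 \int[m2]_t2 \int[lam]_z \int[lam]_z'
    (gaussd s z * gaussd tau z' *
     (gaussd sB (s1 t1 + (scalet g z + z')) / bB (s1 t1 + (scalet g z + z'))))%:E
   = pi2%:E)%E.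
Proof.
move=> sB0.
pose H y := (gaussd sB y / bB y)%:E.
have mH : measurable_fun setT H by rewrite /H; mfun.
have H0 u : (0 <= H u)%E by rewrite lee_fin divr_ge0.
transitivity (\int[m1]_t1 (pi2%:E * \int[lam]_z ((gaussd 1 z)%:E * H (s1 t1 + z)%R)))%E.
  apply: eq_integral => t1 _.
  have mHs : measurable_fun setT (fun u => H (s1 t1 + u)).
    by apply: (measurableT_comp mH); mfun.
  apply: etrans (congr1 (mule pi2%:E) (noise mHs (fun u => H0 _))).
  under eq_integral do under eq_integral do under eq_integral do rewrite EFinM.
  rewrite [LHS](integral_cst m2 measurableT) muleC; congr (_ * _)%E; exact: m2T.
rewrite ge0_integralZl//; last 3 first.
- apply: (measurable_fun_fubini_tonelli_F (m2 := lam)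
    (fun p : T1 * E => ((gaussd 1 p.2)%:E * H (s1 p.1 + p.2)%R)%E)).
    by apply: emeasurable_funM; [mfun|apply: (measurableT_comp mH); mfun].
  by move=> p; rewrite mule_ge0// lee_fin.
- by move=> t _; apply: integral_ge0 => z _; rewrite mule_ge0// lee_fin.
- by rewrite lee_fin ltW.
rewrite [X in (_ * X)%E](@integral_mixture_cst _ _ _ _ m1 (gaussd 1) _ ms1 (mg 1)
  (@g0 1) (gb ltr01) H mH H0).
rewrite -/bB -[RHS]mule1 -(integral_gaussd sB n); congr (_ * _)%E.
apply: eq_integral => y _; rewrite /H -EFinM; congr EFin.
by rewrite mulrC divfK// gt_eqF.
Qed.

(** The density of z' has been cancelled, so for fixed Y2 the block U runs over Lebesgue measure.
    Then [fY2] cancels, the test channel integrates to one in y, and [fU] has mass [pi2]. *)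
Lemma integral_A4 (sq a : R) : 0 < sq ->
  (\int[m1]_t1 \int[m2]_t2 \int[lam]_z \int[lam]_z'
    (gaussd s z * (fU (scalet g (s2 t2) + (scalet g z + z')) *
      gaussd sq (s2 t2 + z - scalet a (scalet g (s2 t2) + (scalet g z + z'))) /
      fY2 (s2 t2 + z)))%:E
   = pi2%:E)%E.
Proof.
move=> sq0; rewrite integral_cst// [X in (_ * X)%E](_ : _ = 1%E) ?mule1; last first.
  exact: probability_setT.
pose f (p : E * E) := fU p.2 * gaussd sq (p.1 - scalet a p.2) / fY2 p.1.
pose F p := (f p)%:E.
have mf : measurable_fun setT f by rewrite /f; mfun.
have mF : measurable_fun setT F by rewrite /F; mfun.
have f0 p : 0 <= f p.
  apply: divr_ge0; last exact: ltW.
  by apply: mulr_ge0; [exact: ltW|exact: g0].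
have F0 p : (0 <= F p)%E by rewrite lee_fin.
pose H y := (\int[lam]_u F (y, u))%E.
have mH : measurable_fun setT H by apply: measurable_fun_fubini_tonelli_F.
have H0 u : (0 <= H u)%E by apply: integral_ge0.
transitivity (\int[m2]_t2 \int[lam]_z ((gaussd s z)%:E * H (s2 t2 + z)%R))%E.
  apply: eq_integral => t2 _; apply: eq_integral => z _.
  rewrite /H -(ge0_integral_shift_tuple (scalet g (s2 t2) + scalet g z)
    (f := fun u => F (s2 t2 + z, u))).
  - rewrite -[RHS](@ge0_integral_scale _ _ _ lam (gaussd s z)
      (fun z' => f (s2 t2 + z, z' + (scalet g (s2 t2) + scalet g z)))).
    + by apply: eq_integral => z' _; rewrite /f/= [z' + _]addrC addrA.
    + by apply: (measurableT_comp mf); mfun.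
    + by move=> z'; exact: f0.
    + exact: g0.
  - by apply: (measurableT_comp mF); mfun.
  - by move=> u; exact: F0.
rewrite [LHS](@integral_mixture_cst _ _ _ _ m2 (gaussd s) _ ms2 (mg s)
  (@g0 s) (gb s0) H mH H0).
transitivity (\int[lam]_y \int[lam]_u (fU u * gaussd sq (y - scalet a u))%:E)%E.
  apply: eq_integral => y _; rewrite /H.
  rewrite -[LHS](@ge0_integral_scale _ _ _ lam (fY2 y) (fun u => f (y, u))).
  - apply: eq_integral => u _; rewrite /f; congr EFin.
    by rewrite mulrC divfK// gt_eqF.
  - by apply: (measurableT_comp mf); mfun.
  - by move=> u; exact: f0.
  - exact: ltW.
rewrite [LHS](fubini_tonelli (m1 := lam) (m2 := lam)
  (fun p : E * E => (fU p.2 * gaussd sq (p.1 - scalet a p.2))%:E)); last 2 first.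
- by mfun.
- by move=> p; rewrite lee_fin mulr_ge0// ltW.
rewrite -int_fU; apply: eq_integral => u _ /=.
rewrite ge0_integral_scale//.
- by rewrite integral_gaussd_shift ?mule1.
- by mfun.
- exact: ltW.
Qed.

(** By [fY1_convolution] the weight [kT fY2 / fY1] is the conditional density of Y2 given Y1, so
    this is [pi2] times the conditional mean of [1 + D2] at message w given [Y1 = y1]. *)
Let Rr (p : nat * E) : \bar R :=
  (\int[lam]_y (pi2 * kT (p.2 - scalet g y) * (1 + D2 (p.1, y)) * fY2 y / fY1 p.2)%:E)%E.

Let D21 p : 0 <= 1 + D2 p. Proof. by rewrite addr_ge0. Qed.

Let rr0 (y1 : E) w (y : E) :
  0 <= pi2 * kT (y1 - scalet g y) * (1 + D2 (w, y)) * fY2 y / fY1 y1.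
Proof.
apply: divr_ge0; last exact: ltW.
apply: mulr_ge0; last exact: ltW.
by apply: mulr_ge0 => //; apply: mulr_ge0; exact: ltW.
Qed.

Let mrr : measurable_fun setT (fun q : (nat * E) * E =>
  (pi2 * kT (q.1.2 - scalet g q.2) * (1 + D2 (q.1.1, q.2)) * fY2 q.2 / fY1 q.1.2)%:E).
Proof. by mfun. Qed.

Let mRr : measurable_fun setT Rr.
Proof.
apply: (measurable_fun_fubini_tonelli_F (m2 := lam) _ mrr) => q.
by rewrite lee_fin.
Qed.

Let Rr0 p : (0 <= Rr p)%E.
Proof. by apply: integral_ge0 => y _; rewrite lee_fin. Qed.

(** Under the product law the message is independent of Y1, so averaging over it first bounds
    [1 + D2] by 2; the conditional density of Y2 then integrates to one. *)
Let integral_Rr y1 : (\int[pW]_w Rr (w, y1) <= (2 * pi2)%:E)%E.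
Proof.
pose f (y : E) := 2 * pi2 / fY1 y1 * (kT (y1 - scalet g y) * fY2 y).
have f0 y : 0 <= kT (y1 - scalet g y) * fY2 y by apply: mulr_ge0; exact: ltW.
have p0 : 0 <= pi2 / fY1 y1 by apply: divr_ge0; exact: ltW.
have int_f : (\int[lam]_y (f y)%:E = (2 * pi2)%:E)%E.
  rewrite [LHS]ge0_integral_scale//.
  - rewrite fY1_convolution -EFinM; congr EFin.
    by rewrite divfK// gt_eqF.
  - by mfun.
  - by rewrite -mulrA mulr_ge0.
rewrite -int_f.
rewrite [leLHS](fubini_tonelli (m1 := pW) (m2 := lam) (fun q : nat * E =>
  (pi2 * kT (y1 - scalet g q.2) * (1 + D2 (q.1, q.2)) * fY2 q.2 / fY1 y1)%:E)); last 2 first.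
- by mfun.
- by move=> q; rewrite lee_fin.
apply: ge0_le_integral => //.
- by move=> y _; apply: integral_ge0 => w _; rewrite lee_fin.
- apply: (measurable_fun_fubini_tonelli_G (m1 := pW) (fun q : nat * E =>
  (pi2 * kT (y1 - scalet g q.2) * (1 + D2 (q.1, q.2)) * fY2 q.2 / fY1 y1)%:E)).
    by mfun.
  by move=> q; rewrite lee_fin.
- by rewrite /f; mfun.
- move=> y _ /=.
  have mDy : measurable_fun setT (fun w => D2 (w, y)) by mfun.
  rewrite [leLHS](_ : _ = \int[pW]_w ((pi2 / fY1 y1 *
      (kT (y1 - scalet g y) * fY2 y)) * (1 + D2 (w, y)))%:E)%E; last first.
    by apply: eq_integral => w _; congr EFin; ring.
  rewrite ge0_integral_scale//; last exact: mulr_ge0.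
  rewrite /f (_ : 2 * pi2 / _ * _ =
    pi2 / fY1 y1 * (kT (y1 - scalet g y) * fY2 y) * 2); last by ring.
  rewrite [leRHS]EFinM; apply: lee_wpmul2l; first by rewrite lee_fin mulr_ge0.
  exact: mass1D.
Qed.

(** The density of z2 has been cancelled, so Y2 runs over Lebesgue measure. Given Y2, the variable
    [s1 + z'] has density [kT], which together with [fY2 / fY1] forms [Rr]. The remaining factor
    [bB] is the density of [s1 + z1], so the expression is an expectation of [e * Rr] under the law
    of Y1, to which [HE] applies. *)
Lemma integral_A2 :
  (\int[m1]_t1 \int[m2]_t2 \int[lam]_z \int[lam]_z'
    (gaussd tau z' *
     ((1 + D2 (w2 t2, s2 t2 + z)) *
      e (w2 t2, (s1 t1 + (scalet g z + z') + scalet g (s2 t2))%R) *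
      pi2 * bB (s1 t1 + (scalet g z + z')) * fY2 (s2 t2 + z) /
      fY1 (s1 t1 + (scalet g z + z') + scalet g (s2 t2))))%:E <= (2 * pi2)%:E)%E.
Proof.
pose F (p : T1 * (T2 * (E * E))) := (gaussd tau p.2.2.2 *
     ((1 + D2 (w2 p.2.1, s2 p.2.1 + p.2.2.1)) *
      e (w2 p.2.1, (s1 p.1 + (scalet g p.2.2.1 + p.2.2.2) + scalet g (s2 p.2.1))%R) *
      pi2 * bB (s1 p.1 + (scalet g p.2.2.1 + p.2.2.2)) * fY2 (s2 p.2.1 + p.2.2.1) /
      fY1 (s1 p.1 + (scalet g p.2.2.1 + p.2.2.2) + scalet g (s2 p.2.1))))%:E.
have pos x y b u v : 0 <= (1 + D2 x) * e y * pi2 * bB b * fY2 u / fY1 v.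
  apply: divr_ge0; last exact: ltW.
  apply: mulr_ge0; last exact: ltW.
  apply: mulr_ge0; last exact: ltW.
  apply: mulr_ge0; last exact: ltW.
  by apply: mulr_ge0 => //; exact: ltW.
have F0 p : (0 <= F p)%E by rewrite lee_fin; apply: mulr_ge0.
have mF : measurable_fun setT F by rewrite /F; mfun.
rewrite [leLHS](integral_swap4 m1 m2 lam lam mF F0).
apply: (@le_trans _ _ (\int[mY]_y \int[pW]_w Rr (w, y))%E); last first.
  rewrite -[leRHS]mule1 -(probability_setT mY) -integral_cst//.
  apply: ge0_le_integral => //.
  - by move=> y _; exact: integral_ge0.
  - by apply: (measurable_fun_fubini_tonelli_G (m1 := pW) Rr).
apply: le_trans (HE mRr Rr0).
rewrite le_eqVlt; apply/orP; left; apply/eqP; apply: eq_integral => t2 _.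
pose c := scalet g (s2 t2).
pose K y1 := ((e (w2 t2, y1))%:E * Rr (w2 t2, y1))%E.
have mK : measurable_fun setT K.
  by apply: emeasurable_funM; [mfun|apply: (measurableT_comp mRr); mfun].
have K0 y1 : (0 <= K y1)%E by rewrite mule_ge0// lee_fin ltW.
pose f (q : E * E) := kT (q.2 - scalet g q.1) * ((1 + D2 (w2 t2, q.1)) * e (w2 t2, q.2) *
    pi2 * bB (q.2 - c) * fY2 q.1 / fY1 q.2).
have mf : measurable_fun setT f by rewrite /f; mfun.
have f0 q : 0 <= f q by apply: mulr_ge0; [exact: ltW|exact: pos].
transitivity (\int[lam]_y \int[lam]_y1 (f (y, y1))%:E)%E.
  rewrite -[RHS](ge0_integral_shift_tuple (s2 t2)
    (f := fun y => (\int[lam]_y1 (f (y, y1))%:E)%E)); last 2 first.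
  - by apply: (measurable_fun_fubini_tonelli_F (fun q => (f q)%:E)); [mfun|move=> q; rewrite lee_fin].
  - by move=> y; apply: integral_ge0 => y1 _; rewrite lee_fin.
  apply: eq_integral => z _.
  (* Source 1 and z' enter only through [b = s1 + z']. *)
  pose H b := ((1 + D2 (w2 t2, s2 t2 + z)) * e (w2 t2, b + scalet g z + c) *
    pi2 * bB (b + scalet g z) * fY2 (s2 t2 + z) / fY1 (b + scalet g z + c))%:E.
  have mH : measurable_fun setT H by rewrite /H; mfun.
  have H0 b : (0 <= H b)%E by rewrite lee_fin.
  transitivity (\int[lam]_b ((kT b)%:E * H b))%E.
    apply: etrans (@integral_mixture_cst _ _ _ _ m1 _ _ ms1 (mg tau) (@g0 tau) (gb tau0) H mH H0).
    apply: eq_integral => t1 _; apply: eq_integral => z' _.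
    rewrite /F /H -EFinM /=.
    by rewrite (_ : s1 t1 + (scalet g z + z') = s1 t1 + z' + scalet g z)//
      -addrA [z' + _]addrC.
  (* The variable b is replaced by [y1 = b + g Y2], a translation once Y2 is fixed. *)
  rewrite -[RHS](ge0_integral_shift_tuple (scalet g (z + s2 t2))
    (f := fun y1 => (f (z + s2 t2, y1))%:E)).
  - apply: eq_integral => b _; rewrite /H /f -EFinM/= addrK.
    rewrite (_ : scalet g (z + s2 t2) = scalet g z + c).
      by rewrite !addrA addrK [z + _]addrC.
    by apply: eq_from_tnth => i; rewrite !(tnthD, tnthZ) mulrDr.
  - by apply: (measurableT_comp (f := fun q => (f q)%:E)); mfun.
  - by move=> y1; rewrite lee_fin.
rewrite [LHS](fubini_tonelli (fun q => (f q)%:E)); last 2 first.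
- by mfun.
- by move=> q; rewrite lee_fin.
transitivity (\int[lam]_y1 ((bB (y1 - c))%:E * K y1))%E.
  apply: eq_integral => y1 _.
  rewrite /K muleA -EFinM /Rr/=.
  rewrite -[RHS](@ge0_integral_scale _ _ _ lam (bB (y1 - c) * e (w2 t2, y1))
    (fun y => pi2 * kT (y1 - scalet g y) * (1 + D2 (w2 t2, y)) * fY2 y / fY1 y1)).
  - by apply: eq_integral => y _; rewrite /f/=; congr EFin; ring.
  - by mfun.
  - by move=> y; exact: rr0.
  - by apply: mulr_ge0; exact: ltW.
rewrite -[LHS](ge0_integral_shift_tuple c
  (f := fun y1 => ((bB (y1 - c))%:E * K y1)%E)); last 2 first.
- by apply: emeasurable_funM => //; mfun.
- by move=> y1; apply: mule_ge0 => //; rewrite lee_fin.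
(* Back to [b = y1 - g s2], which plays the role of [s1 + z1] and has density [bB]. *)
transitivity (\int[lam]_b ((bB b)%:E * K (b + c)%R))%E.
  by apply: eq_integral => b _; rewrite addrK.
apply/esym.
have mKc : measurable_fun setT (fun b : E => K (b + c)).
  by apply: (measurableT_comp mK); mfun.
exact: (@integral_mixture_cst _ _ _ _ m1 _ _ ms1 (mg 1) (@g0 1) (gb ltr01)
  (fun b => K (b + c)) mKc (fun b => K0 _)).
Qed.

Local Notation J F := (\int[m1]_t1 \int[m2]_t2 \int[lam]_z \int[lam]_z' F t1 t2 z z')%E.

(** Terms that see the noises only through [z1 = g z2 + z'] reduce to one standard normal block;
    source 2 is put outermost, so that the result can later be split by the cooperative signal. *)
Let one_noise (H : T1 * (T2 * E) -> R) :
  measurable_fun setT H -> (forall p, 0 <= H p) ->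
  J (fun t1 t2 z z' =>
      (gaussd s z * gaussd tau z' * H (t1, (t2, (scalet g z + z')%R)))%:E) =
  (\int[m2]_t2 \int[m1]_t1 \int[lam]_z (gaussd 1 z * H (t1, (t2, z)))%:E)%E.
Proof.
move=> mH H0.
transitivity (\int[m1]_t1 \int[m2]_t2 \int[lam]_z (gaussd 1 z * H (t1, (t2, z)))%:E)%E.
  apply: eq_integral => t1 _; apply: eq_integral => t2 _.
  have mHs : measurable_fun setT (fun y => (H (t1, (t2, y)))%:E).
    by apply/measurable_EFinP; apply: (measurableT_comp mH); mfun.
  have H0s (y : E) : (0 <= (H (t1, (t2, y)))%:E)%E by rewrite lee_fin.
  exact: noise mHs H0s.
rewrite [LHS](fubini_tonelli (fun p : T1 * T2 =>
  \int[lam]_z (gaussd 1 z * H (p.1, (p.2, z)))%:E)%E)//.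
- apply: (measurable_fun_fubini_tonelli_F (fun q : (T1 * T2) * E =>
    (gaussd 1 q.2 * H (q.1.1, (q.1.2, q.2)))%:E)).
    apply/measurable_EFinP; apply: measurable_funM; first by mfun.
    by apply: (measurableT_comp mH); mfun.
  by move=> q; rewrite lee_fin mulr_ge0.
- by move=> p; apply: integral_ge0 => z _; rewrite lee_fin mulr_ge0.
Qed.

Let const1 (x : \bar R) : (\int[m1]_t1 x = x)%E.
Proof.
rewrite (integral_cst m1 measurableT) -[RHS]mule1; congr (_ * _)%E.
exact: probability_setT.
Qed.

Let const2 (x : R) : (\int[m2]_t2 x%:E = (pi2 * x)%:E)%E.
Proof.
rewrite (integral_cst m2 measurableT) [LHS]muleC EFinM; congr (_ * _)%E.
exact: m2T.
Qed.

Let two_noises (H : T2 * E -> R) :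
  measurable_fun setT H -> (forall p, 0 <= H p) ->
  J (fun t1 t2 z z' => (gaussd s z * gaussd tau z' * H (t2, z))%:E) =
  (\int[m2]_t2 \int[lam]_z (gaussd s z * H (t2, z))%:E)%E.
Proof.
move=> mH H0; rewrite const1; apply: eq_integral => t2 _; apply: eq_integral => z _.
transitivity (\int[lam]_z' (gaussd s z * H (t2, z) * gaussd tau z')%:E)%E.
  by apply: eq_integral => z' _; congr EFin; ring.
rewrite ge0_integral_scale//; first by rewrite integral_gaussd mule1.
by rewrite mulr_ge0.
Qed.

Let scalet1 (x : E) : scalet 1 x = x.
Proof. by apply: eq_from_tnth => i; rewrite tnthZ mul1r. Qed.

Let integral_gaussd_sqnorm_scale (r k b : R) (c : E) : 0 < r -> 0 <= k ->
  (\int[lam]_x (gaussd r x * (sqnorm (c + scalet b x) * k))%:E =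
   ((sqnorm c + n%:R * (b ^+ 2 * r ^+ 2)) * k)%:E)%E.
Proof.
move=> r0 k0.
transitivity (\int[lam]_x (k * (gaussd r x * sqnorm (c + scalet b x)))%:E)%E.
  by apply: eq_integral => x _; congr EFin; ring.
rewrite ge0_integral_scale//.
- by rewrite integral_gaussd_sqnorm// -EFinM mulrC.
- by mfun.
- by move=> x; rewrite mulr_ge0// sqnorm_ge0.
Qed.

Let integral_quad_B (k : R) : 0 <= k ->
  J (fun t1 t2 z z' => (gaussd s z * gaussd tau z' *
      (sqnorm (s1 t1 + (scalet g z + z')) * k))%:E) =
  (\int[m2]_t2 \int[m1]_t1 ((sqnorm (s1 t1) + n%:R) * k)%:E)%E.
Proof.
move=> k0; rewrite (one_noise (H := fun p => sqnorm (s1 p.1 + p.2.2) * k)).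
- apply: eq_integral => t2 _; apply: eq_integral => t1 _.
  transitivity (\int[lam]_x (gaussd 1 x * (sqnorm (s1 t1 + scalet 1 x) * k))%:E)%E.
    by apply: eq_integral => x _; rewrite scalet1.
  by rewrite integral_gaussd_sqnorm_scale// expr1n !mulr1.
- by mfun.
- by move=> p; rewrite mulr_ge0// sqnorm_ge0.
Qed.

Let integral_quad_2 :
  J (fun t1 t2 z z' => (gaussd s z * gaussd tau z' *
      (sqnorm z * (2 * s ^+ 2)^-1))%:E) = (pi2 * (n%:R / 2))%:E.
Proof.
have k0 : 0 <= (2 * s ^+ 2)^-1 by rewrite invr_ge0 mulr_ge0// sqr_ge0.
rewrite (two_noises (H := fun p => sqnorm p.2 * (2 * s ^+ 2)^-1)).
- transitivity (\int[m2]_t2 (n%:R / 2)%:E)%E.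
    apply: eq_integral => t2 _.
    transitivity (\int[lam]_x (gaussd s x * (sqnorm (0 + scalet 1 x) * (2 * s ^+ 2)^-1))%:E)%E.
      by apply: eq_integral => x _; rewrite scalet1 add0r.
    rewrite integral_gaussd_sqnorm_scale// expr1n mul1r.
    have -> : sqnorm (0 : E) = 0.
      by rewrite /sqnorm big1// => i _; rewrite tnth_mktuple expr0n.
    by congr EFin; field; rewrite gt_eqF.
  exact: const2.
- by mfun.
- by move=> p; rewrite mulr_ge0// sqnorm_ge0.
Qed.

Let integral_quad_QQ' (c : T2 -> E -> E) (b k : R) : 0 <= k ->
  J (fun t1 t2 z z' => (gaussd s z * gaussd tau z' *
      (sqnorm (c t2 z + scalet b z') * k))%:E) =
  (\int[m2]_t2 \int[lam]_z (gaussd s z *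
      ((sqnorm (c t2 z) + n%:R * (b ^+ 2 * tau ^+ 2)) * k))%:E)%E.
Proof.
move=> k0; rewrite const1; apply: eq_integral => t2 _; apply: eq_integral => z _.
transitivity (\int[lam]_z' (gaussd s z * (gaussd tau z' * (sqnorm (c t2 z + scalet b z') * k)))%:E)%E.
  by apply: eq_integral => z' _; congr EFin; ring.
rewrite ge0_integral_scale//.
- by rewrite integral_gaussd_sqnorm_scale// -EFinM.
- by mfun.
- by move=> z'; rewrite mulr_ge0// mulr_ge0// sqnorm_ge0.
Qed.

Let integral_gaussd_cst (r k : R) : 0 <= k ->
  (\int[lam]_z (gaussd r z * k)%:E = k%:E)%E.
Proof.
move=> k0; under eq_integral do rewrite mulrC.
by rewrite ge0_integral_scale// integral_gaussd mule1.
Qed.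

Let sqnorm0 : sqnorm (0 : E) = 0.
Proof. by rewrite /sqnorm big1// => i _; rewrite tnth_mktuple expr0n. Qed.

Let integral_quad_z' :
  J (fun t1 t2 z z' => (gaussd s z * gaussd tau z' *
      (sqnorm z' * (2 * tau ^+ 2)^-1))%:E) = (pi2 * (n%:R / 2))%:E.
Proof.
have k0 : 0 <= (2 * tau ^+ 2)^-1 by rewrite invr_ge0 mulr_ge0// sqr_ge0.
transitivity (J (fun t1 t2 z z' => (gaussd s z * gaussd tau z' *
      (sqnorm (0 + scalet 1 z') * (2 * tau ^+ 2)^-1))%:E)).
  apply: eq_integral => t1 _; apply: eq_integral => t2 _.
  by apply: eq_integral => z _; apply: eq_integral => z' _; rewrite scalet1 add0r.
rewrite (integral_quad_QQ' (fun _ _ => 0))// -const2; apply: eq_integral => t2 _.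
rewrite integral_gaussd_cst.
  by rewrite sqnorm0; congr EFin; field; rewrite gt_eqF.
by rewrite sqnorm0 add0r mulr_ge0// mulr_ge0// mulr_ge0 ?sqr_ge0.
Qed.

(** The residual [Y2 - a U] equals [(1 - a g) Y2 - a z'], in which z' is independent of Y2. *)
Let integral_quad_Q (a k : R) : 0 <= k ->
  J (fun t1 t2 z z' => (gaussd s z * gaussd tau z' *
      (sqnorm (s2 t2 + z - scalet a (scalet g (s2 t2) + (scalet g z + z'))) * k))%:E) =
  (\int[m2]_t2 (((1 - a * g) ^+ 2 * (sqnorm (s2 t2) + n%:R * s ^+ 2) +
     n%:R * (a ^+ 2 * tau ^+ 2)) * k)%:E)%E.
Proof.
move=> k0; set r := 1 - a * g.
have sqZ (x : E) : sqnorm (scalet r x) = r ^+ 2 * sqnorm x.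
  by rewrite /sqnorm mulr_sumr; apply: eq_bigr => i _; rewrite tnthZ exprMn.
transitivity (J (fun t1 t2 z z' => (gaussd s z * gaussd tau z' *
      (sqnorm (scalet r (s2 t2 + z) + scalet (- a) z') * k))%:E)).
  apply: eq_integral => t1 _; apply: eq_integral => t2 _.
  apply: eq_integral => z _; apply: eq_integral => z' _; congr (_ * (sqnorm _ * _))%:E.
  by apply: eq_from_tnth => i; rewrite !(tnthD, tnthN, tnthZ) /r; ring.
rewrite (integral_quad_QQ' (fun t2 z => scalet r (s2 t2 + z)))// sqrrN.
apply: eq_integral => t2 _.
have nn : 0 <= n%:R * (a ^+ 2 * tau ^+ 2) by rewrite mulr_ge0// mulr_ge0 ?sqr_ge0.
transitivity (\int[lam]_z (gaussd s z * (sqnorm (s2 t2 + scalet 1 z) * (r ^+ 2 * k)) +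
    gaussd s z * (n%:R * (a ^+ 2 * tau ^+ 2) * k))%:E)%E.
  by apply: eq_integral => z _; congr EFin; rewrite sqZ scalet1; ring.
have rk0 : 0 <= r ^+ 2 * k by rewrite mulr_ge0 ?sqr_ge0.
rewrite ge0_integral_add//.
- rewrite integral_gaussd_sqnorm_scale// integral_gaussd_cst; last exact: mulr_ge0.
  by rewrite -EFinD; congr EFin; ring.
all: try by mfun.
all: by move=> z; rewrite mulr_ge0// mulr_ge0// ?sqnorm_ge0.
Qed.

Variables (sB sq a : R).
Hypotheses (sB0 : 0 < sB) (sq0 : 0 < sq).
(** The constant left by the Gaussian logarithms, plus the price [- ln pi2] of the cooperative
    value. Its sign allows it to be integrated as a nonnegative term. *)
Let K := n%:R * (ln sB + ln sq - ln s - ln tau) - ln pi2.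
Hypothesis K0 : 0 <= K.

Let Y1 t1 t2 (z : E) := s1 t1 + z + scalet g (s2 t2).

(** The integral of [sum_ln_le] against the density of the two noises. Each signed term goes to the
    side on which it is nonnegative: [ln e] is split into its two parts, and the quadratic parts of
    the two noise densities stand on the left, where they integrate to [pi2 * n] together. *)
Lemma core_inequality :
  (\int[m2]_t2 \int[m1]_t1 \int[lam]_z (gaussd 1 z * ln (1 + D1 (t1, Y1 t1 t2 z)))%:E +
   \int[m2]_t2 \int[lam]_z (gaussd s z * ln (1 + D2 (w2 t2, s2 t2 + z)))%:E +
   \int[m2]_t2 \int[m1]_t1 \int[lam]_z
     (gaussd 1 z * Num.max 0 (ln (e (w2 t2, Y1 t1 t2 z))))%:E +
   (pi2 * n%:R)%:E <=
   (6 * pi2)%:E +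
   \int[m2]_t2 \int[m1]_t1 \int[lam]_z
     (gaussd 1 z * Num.max 0 (- ln (e (w2 t2, Y1 t1 t2 z))))%:E +
   \int[m2]_t2 \int[m1]_t1 ((sqnorm (s1 t1) + n%:R) / (2 * sB ^+ 2))%:E +
   \int[m2]_t2 (((1 - a * g) ^+ 2 * (sqnorm (s2 t2) + n%:R * s ^+ 2) +
     n%:R * (a ^+ 2 * tau ^+ 2)) / (2 * sq ^+ 2))%:E +
   (pi2 * K)%:E)%E.
Proof.
pose W (p : T1 * (T2 * (E * E))) := gaussd s p.2.2.1 * gaussd tau p.2.2.2.
pose z1 (p : T1 * (T2 * (E * E))) := scalet g p.2.2.1 + p.2.2.2.
pose x1 p := W p * ln (1 + D1 (p.1, Y1 p.1 p.2.1 (z1 p))).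
pose x2 p := W p * ln (1 + D2 (w2 p.2.1, s2 p.2.1 + p.2.2.1)).
pose lm p := W p * Num.max 0 (ln (e (w2 p.2.1, Y1 p.1 p.2.1 (z1 p)))).
pose lp p := W p * Num.max 0 (- ln (e (w2 p.2.1, Y1 p.1 p.2.1 (z1 p)))).
pose q2 p := W p * (sqnorm p.2.2.1 * (2 * s ^+ 2)^-1).
pose q' p := W p * (sqnorm p.2.2.2 * (2 * tau ^+ 2)^-1).
pose qb p := W p * (sqnorm (s1 p.1 + z1 p) * (2 * sB ^+ 2)^-1).
pose qq p := W p * (sqnorm (s2 p.2.1 + p.2.2.1 - scalet a (scalet g (s2 p.2.1) + z1 p)) * (2 * sq ^+ 2)^-1).
pose kk p := W p * K.
pose a1 p := W p * ((1 + D1 (p.1, Y1 p.1 p.2.1 (z1 p))) * fY1 (Y1 p.1 p.2.1 (z1 p)) /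
  fU (scalet g (s2 p.2.1) + z1 p)).
(* In [a2] the density of z2, and in [a4] that of z', is already cancelled between the weight [W]
   and the denominator. *)
pose a2 (p : T1 * (T2 * (E * E))) := gaussd tau p.2.2.2 * ((1 + D2 (w2 p.2.1, s2 p.2.1 + p.2.2.1)) *
  e (w2 p.2.1, Y1 p.1 p.2.1 (z1 p)) * pi2 * bB (s1 p.1 + z1 p) *
  fY2 (s2 p.2.1 + p.2.2.1) / fY1 (Y1 p.1 p.2.1 (z1 p))).
pose a3 p := W p * (gaussd sB (s1 p.1 + z1 p) / bB (s1 p.1 + z1 p)).
pose a4 (p : T1 * (T2 * (E * E))) := gaussd s p.2.2.1 * (fU (scalet g (s2 p.2.1) + z1 p) *
  gaussd sq (s2 p.2.1 + p.2.2.1 - scalet a (scalet g (s2 p.2.1) + z1 p)) /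
  fY2 (s2 p.2.1 + p.2.2.1)).
have W0 p : 0 < W p by rewrite mulr_gt0 ?gaussd_gt0.
have d1p p : 1 <= 1 + D1 p by rewrite lerDl.
have d2p p : 1 <= 1 + D2 p by rewrite lerDl.
have max0 (x : R) : 0 <= Num.max 0 x by rewrite le_max lexx.
have maxE (x : R) : x = Num.max 0 x - Num.max 0 (- x).
  by rewrite !maxEle; case: (leP 0 x) => x0; case: (leP 0 (- x)) => x1'; lra.
have ptw p : x1 p + x2 p + lm p + q2 p + q' p <=
    a1 p + a2 p + a3 p + a4 p + lp p + qb p + qq p + kk p.
  have := @sum_ln_le R (1 + D1 (p.1, Y1 p.1 p.2.1 (z1 p))) (1 + D2 (w2 p.2.1, s2 p.2.1 + p.2.2.1))
    (e (w2 p.2.1, Y1 p.1 p.2.1 (z1 p))) pi2 (fY1 (Y1 p.1 p.2.1 (z1 p)))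
    (fU (scalet g (s2 p.2.1) + z1 p)) (bB (s1 p.1 + z1 p)) (fY2 (s2 p.2.1 + p.2.2.1))
    (gaussd s p.2.2.1) (gaussd tau p.2.2.2) (gaussd sB (s1 p.1 + z1 p))
    (gaussd sq (s2 p.2.1 + p.2.2.1 - scalet a (scalet g (s2 p.2.1) + z1 p))).
  rewrite !(lt_le_trans ltr01 (d1p _)) !(lt_le_trans ltr01 (d2p _)) e0 pi20 fY10 fU0 bB0 fY20 !gaussd_gt0//.
  move=> /(_ isT isT isT isT isT isT isT isT isT isT isT isT).
  rewrite !ln_gaussd//; set A1 := _ / fU _; set A2 := _ / (_ * fY1 _).
  set A3 := _ / bB _; set A4 := _ / (fY2 _ * _) => key.
  have -> : a1 p = W p * A1 by [].
  have -> : a3 p = W p * A3 by [].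
  have -> : a2 p = W p * A2.
    rewrite /a2 /A2 /W; field.
    by rewrite (gt_eqF (gaussd_gt0 s0 _)) (gt_eqF (fY10 _)).
  have -> : a4 p = W p * A4.
    rewrite /a4 /A4 /W; field.
    by rewrite (gt_eqF (gaussd_gt0 tau0 _)) (gt_eqF (fY20 _)).
  rewrite /x1 /x2 /lm /q2 /q' /lp /qb /qq /kk -!mulrDr ler_pM2l//.
  move: key; rewrite {1}(maxE (ln (e _))) /K; lra.
have mx1 : measurable_fun setT x1 by rewrite /x1 /W /Y1 /z1; mfun.
have mx2 : measurable_fun setT x2 by rewrite /x2 /W /Y1 /z1; mfun.
have mlm : measurable_fun setT lm by rewrite /lm /W /Y1 /z1; mfun.
have mlp : measurable_fun setT lp by rewrite /lp /W /Y1 /z1; mfun.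
have mq2 : measurable_fun setT q2 by rewrite /q2 /W /Y1 /z1; mfun.
have mq' : measurable_fun setT q' by rewrite /q' /W /Y1 /z1; mfun.
have mqb : measurable_fun setT qb by rewrite /qb /W /Y1 /z1; mfun.
have mqq : measurable_fun setT qq by rewrite /qq /W /Y1 /z1; mfun.
have mkk : measurable_fun setT kk by rewrite /kk /W /Y1 /z1; mfun.
have ma1 : measurable_fun setT a1 by rewrite /a1 /W /Y1 /z1; mfun.
have ma2 : measurable_fun setT a2 by rewrite /a2 /W /Y1 /z1; mfun.
have ma3 : measurable_fun setT a3 by rewrite /a3 /W /Y1 /z1; mfun.
have ma4 : measurable_fun setT a4 by rewrite /a4 /W /Y1 /z1; mfun.
have WM p (x : R) : 0 <= x -> 0 <= W p * x by move=> x0; rewrite mulr_ge0// ltW.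
have i2 (x : R) : 0 <= (2 * x ^+ 2)^-1 by rewrite invr_ge0 mulr_ge0// sqr_ge0.
have x10 p : 0 <= x1 p by apply: WM; exact: ln_ge0.
have x20 p : 0 <= x2 p by apply: WM; exact: ln_ge0.
have lm0 p : 0 <= lm p by exact: WM.
have lp0 p : 0 <= lp p by exact: WM.
have q20 p : 0 <= q2 p by apply: WM; rewrite mulr_ge0 ?sqnorm_ge0.
have q'0 p : 0 <= q' p by apply: WM; rewrite mulr_ge0 ?sqnorm_ge0.
have qb0 p : 0 <= qb p by apply: WM; rewrite mulr_ge0 ?sqnorm_ge0.
have qq0 p : 0 <= qq p by apply: WM; rewrite mulr_ge0 ?sqnorm_ge0.
have kk0 p : 0 <= kk p by exact: WM.
have d1p' p : 0 <= 1 + D1 p := le_trans ler01 (d1p p).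
have a10 p : 0 <= a1 p.
  apply: WM; apply: divr_ge0; last exact: ltW.
  by apply: mulr_ge0 => //; exact: ltW.
have a20 p : 0 <= a2 p.
  apply: mulr_ge0 => //; apply: divr_ge0; last exact: ltW.
  apply: mulr_ge0; last exact: ltW.
  apply: mulr_ge0; last exact: ltW.
  apply: mulr_ge0; last exact: ltW.
  by apply: mulr_ge0 => //; exact: ltW.
have a30 p : 0 <= a3 p by apply: WM; apply: divr_ge0.
have a40 p : 0 <= a4 p.
  apply: mulr_ge0 => //; apply: divr_ge0; last exact: ltW.
  by apply: mulr_ge0 => //; exact: ltW.
pose M : {measure set (T1 * (T2 * (E * E)))%type -> \bar R} :=
  prodm m1 (prodm m2 (prodm lam lam)).
have IE (f : T1 * (T2 * (E * E)) -> R) : measurable_fun setT f -> (forall p, 0 <= f p) ->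
    (\int[M]_p (f p)%:E = J (fun t1 t2 z z' => (f (t1, (t2, (z, z'))))%:E))%E.
  move=> mf f0; apply: (integral_prodm4 m1 m2 lam lam (F := fun p => (f p)%:E)).
    exact/measurable_EFinP.
  by move=> p; rewrite lee_fin.
have Ix1 : (\int[M]_p (x1 p)%:E = \int[m2]_t2 \int[m1]_t1 \int[lam]_z
    (gaussd 1 z * ln (1 + D1 (t1, Y1 t1 t2 z)))%:E)%E.
  rewrite (IE _ mx1 x10); apply: (one_noise (H := fun p =>
    ln (1 + D1 (p.1, s1 p.1 + p.2.2 + scalet g (s2 p.2.1))))); first by mfun.
  by move=> p; exact: ln_ge0.
have Ix2 : (\int[M]_p (x2 p)%:E = \int[m2]_t2 \int[lam]_z
    (gaussd s z * ln (1 + D2 (w2 t2, s2 t2 + z)))%:E)%E.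
  rewrite (IE _ mx2 x20); apply: (two_noises (H := fun p =>
    ln (1 + D2 (w2 p.1, s2 p.1 + p.2)))); first by mfun.
  by move=> p; exact: ln_ge0.
have Ilm : (\int[M]_p (lm p)%:E = \int[m2]_t2 \int[m1]_t1 \int[lam]_z
     (gaussd 1 z * Num.max 0 (ln (e (w2 t2, Y1 t1 t2 z))))%:E)%E.
  have mH : measurable_fun setT (fun p : T1 * (T2 * E) =>
      Num.max 0 (ln (e (w2 p.2.1, s1 p.1 + p.2.2 + scalet g (s2 p.2.1))))).
    by mfun.
  rewrite (IE _ mlm lm0); exact: (one_noise mH (fun p => max0 _)).
have Ilp : (\int[M]_p (lp p)%:E = \int[m2]_t2 \int[m1]_t1 \int[lam]_z
     (gaussd 1 z * Num.max 0 (- ln (e (w2 t2, Y1 t1 t2 z))))%:E)%E.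
  have mH : measurable_fun setT (fun p : T1 * (T2 * E) =>
      Num.max 0 (- ln (e (w2 p.2.1, s1 p.1 + p.2.2 + scalet g (s2 p.2.1))))).
    by mfun.
  rewrite (IE _ mlp lp0); exact: (one_noise mH (fun p => max0 _)).
have Iq2 : (\int[M]_p (q2 p)%:E = (pi2 * (n%:R / 2))%:E)%E.
  by rewrite (IE _ mq2 q20); exact: integral_quad_2.
have Iq' : (\int[M]_p (q' p)%:E = (pi2 * (n%:R / 2))%:E)%E.
  by rewrite (IE _ mq' q'0); exact: integral_quad_z'.
have Iqb : (\int[M]_p (qb p)%:E =
    \int[m2]_t2 \int[m1]_t1 ((sqnorm (s1 t1) + n%:R) / (2 * sB ^+ 2))%:E)%E.
  by rewrite (IE _ mqb qb0); exact: integral_quad_B.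
have Iqq : (\int[M]_p (qq p)%:E =
    \int[m2]_t2 (((1 - a * g) ^+ 2 * (sqnorm (s2 t2) + n%:R * s ^+ 2) +
     n%:R * (a ^+ 2 * tau ^+ 2)) / (2 * sq ^+ 2))%:E)%E.
  by rewrite (IE _ mqq qq0); exact: integral_quad_Q.
have Ikk : (\int[M]_p (kk p)%:E = (pi2 * K)%:E)%E.
  rewrite (IE _ mkk kk0); apply: etrans (two_noises (H := fun=> K) _ _) _ => //.
  by rewrite -const2; apply: eq_integral => t2 _; exact: integral_gaussd_cst.
have Ia1 : (\int[M]_p (a1 p)%:E <= (2 * pi2)%:E)%E by rewrite (IE _ ma1 a10); exact: integral_A1.
have Ia2 : (\int[M]_p (a2 p)%:E <= (2 * pi2)%:E)%E by rewrite (IE _ ma2 a20); exact: integral_A2.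
have Ia3 : (\int[M]_p (a3 p)%:E = pi2%:E)%E by rewrite (IE _ ma3 a30); exact: integral_A3.
have Ia4 : (\int[M]_p (a4 p)%:E = pi2%:E)%E by rewrite (IE _ ma4 a40); exact: integral_A4.
(* All integrals are evaluated; abstracting the integrands keeps the terms of the list argument
   small. *)
clear IE WM W0.
clearbody x1 x2 lm lp q2 q' qb qq kk a1 a2 a3 a4 M; clear W z1.
have H : (\sum_(f <- [:: x1; x2; lm; q2; q']) \int[M]_p (f p)%:E <=
    \sum_(f <- [:: a1; a2; a3; a4; lp; qb; qq; kk]) \int[M]_p (f p)%:E)%E.
  apply: ge0_integral_le_sums.
  - by move=> f /=; repeat (case=> [<-|]; first assumption).
  - move=> f p Hf; move: p; move: Hf => /=.
    by repeat (case=> [<-|]; first assumption).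
  - by move=> p; rewrite !big_cons !big_nil !addr0 !addrA; exact: ptw.
move: H; rewrite !big_cons !big_nil Iq2 Iq' Ia3 Ia4 => H.
have := le_sums_collect H Ia1 Ia2.
rewrite Ix1 Ix2 Ilm Ilp Iqb Iqq Ikk.
by rewrite (_ : pi2 * (n%:R / 2) + pi2 * (n%:R / 2) = pi2 * n%:R)//; lra.
Qed.

End core.

(** * Point-to-point converse *)

Section point_to_point.
Context (R : realType) (n : nat) d (T : measurableType d) (m : probability T R).
Notation E := (n.-tuple R).
Notation lam := (leb R n).
Variables (x : T -> E) (D : T * E -> R) (r : R).
Hypotheses (mx : measurable_fun setT x) (mD : measurable_fun setT D).
Hypothesis D0 : forall p, 0 <= D p.
Hypothesis D_le1 : forall y, (\int[m]_t (D (t, y))%:E <= 1)%E.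
Hypothesis r1 : 1 <= r.
Hypothesis power : (\int[m]_t (sqnorm (x t))%:E <= (n%:R * (r ^+ 2 - 1))%:E)%E.

(** One application of [ln x <= x] to the ratio of [(1 + D)] times the [N(0, r^2)] density of the
    output and the [N(0, 1)] density of the noise. Its expectation is at most 2, and under the power
    constraint the two quadratic terms balance at [n / 2] each. *)
Lemma point_to_point_bound :
  (\int[m]_t \int[lam]_z (gaussd 1 z * ln (1 + D (t, x t + z)))%:E <=
   (n%:R * ln r + 2)%:E)%E.
Proof.
have r0 : 0 < r by rewrite (lt_le_trans ltr01).
have d1p p : 1 <= 1 + D p by rewrite lerDl.
have d0p p : 0 <= 1 + D p by rewrite (le_trans ler01).
have g0 (u : R) (y : E) : 0 <= gaussd u y by exact: gaussd_ge0.
pose x1 (p : T * E) := gaussd 1 p.2 * ln (1 + D (p.1, x p.1 + p.2)).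
pose q2 (p : T * E) := gaussd 1 p.2 * (sqnorm p.2 / 2).
pose a1 (p : T * E) := (1 + D (p.1, x p.1 + p.2)) * gaussd r (x p.1 + p.2).
pose qb (p : T * E) := gaussd 1 p.2 * (sqnorm (x p.1 + p.2) / (2 * r ^+ 2)).
pose kk (p : T * E) := gaussd 1 p.2 * (n%:R * ln r).
have ptw p : x1 p + q2 p <= a1 p + qb p + kk p.
  have g1 := @gaussd_gt0 R 1 ltr01 n p.2.
  have gr := gaussd_gt0 r0 (x p.1 + p.2).
  have A0 : 0 < (1 + D (p.1, x p.1 + p.2)) * gaussd r (x p.1 + p.2) / gaussd 1 p.2.
    by rewrite divr_gt0// mulr_gt0// (lt_le_trans ltr01).
  have := ltW (ln_sublinear A0).
  rewrite ln_div ?posrE//; last by rewrite mulr_gt0// (lt_le_trans ltr01).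
  rewrite lnM ?posrE//; last by rewrite (lt_le_trans ltr01).
  rewrite !ln_gaussd// ln1 expr1n mulr1; set A := _ / gaussd 1 _ => key.
  have -> : a1 p = gaussd 1 p.2 * A by rewrite /a1 /A [RHS]mulrC divfK// gt_eqF.
  rewrite /x1 /q2 /qb /kk -!mulrDr ler_pM2l//.
  move: key; lra.
have mx1 : measurable_fun setT x1 by rewrite /x1; mfun.
have mq2 : measurable_fun setT q2 by rewrite /q2; mfun.
have ma1 : measurable_fun setT a1 by rewrite /a1; mfun.
have mqb : measurable_fun setT qb by rewrite /qb; mfun.
have mkk : measurable_fun setT kk by rewrite /kk; mfun.
have x10 p : 0 <= x1 p by apply: mulr_ge0 => //; exact: ln_ge0.
have q20 p : 0 <= q2 p by apply: mulr_ge0 => //; rewrite divr_ge0// sqnorm_ge0.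
have a10 p : 0 <= a1 p by exact: mulr_ge0.
have rr0 : 0 <= (2 * r ^+ 2)^-1 by rewrite invr_ge0 mulr_ge0// sqr_ge0.
have qb0 p : 0 <= qb p by apply: mulr_ge0 => //; rewrite mulr_ge0// sqnorm_ge0.
have kk0 p : 0 <= kk p.
  by apply: mulr_ge0 => //; rewrite mulr_ge0// ln_ge0.
pose M : {measure set (T * E)%type -> \bar R} := prodm m lam.
have IE (f : T * E -> R) : measurable_fun setT f -> (forall p, 0 <= f p) ->
    (\int[M]_p (f p)%:E = \int[m]_t \int[lam]_z (f (t, z))%:E)%E.
  move=> mf f0; apply: (@integral_prodm _ _ _ _ _ m lam (fun p => (f p)%:E)).
    exact/measurable_EFinP.
  by move=> p; rewrite lee_fin.
have const1 (k : \bar R) : (\int[m]_t k = k)%E.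
  rewrite (integral_cst m measurableT) -[RHS]mule1; congr (_ * _)%E.
  exact: probability_setT.
have scalet1 (y : E) : scalet 1 y = y.
  by apply: eq_from_tnth => i; rewrite tnthZ mul1r.
have sqn (c : E) (k : R) : 0 <= k ->
    (\int[lam]_z (gaussd 1 z * (sqnorm (c + z) * k))%:E = ((sqnorm c + n%:R) * k)%:E)%E.
  move=> k0.
  transitivity (\int[lam]_z (k * (gaussd 1 z * sqnorm (c + scalet 1 z)))%:E)%E.
    by apply: eq_integral => z _; rewrite scalet1; congr EFin; ring.
  rewrite ge0_integral_scale//.
  - rewrite (integral_gaussd_sqnorm ltr01) -EFinM; congr EFin.
    by rewrite !expr1n !mulr1 mulrC.
  - by mfun.
  - by move=> z; rewrite mulr_ge0// sqnorm_ge0.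
have sqnorm0 : sqnorm (0 : E) = 0.
  by rewrite /sqnorm big1// => i _; rewrite tnth_mktuple expr0n.
have Ix1 : (\int[M]_p (x1 p)%:E =
    \int[m]_t \int[lam]_z (gaussd 1 z * ln (1 + D (t, x t + z)))%:E)%E.
  exact: IE.
have Iq2 : (\int[M]_p (q2 p)%:E = (n%:R / 2)%:E)%E.
  rewrite (IE _ mq2 q20) -[RHS]const1; apply: eq_integral => t _.
  have := @sqn 0 2^-1; rewrite sqnorm0 add0r => <-//.
  by apply: eq_integral => z _; rewrite add0r.
have Ikk : (\int[M]_p (kk p)%:E = (n%:R * ln r)%:E)%E.
  rewrite (IE _ mkk kk0) -[RHS]const1; apply: eq_integral => t _.
  transitivity (\int[lam]_z (n%:R * ln r * gaussd 1 z)%:E)%E.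
    by apply: eq_integral => z _; rewrite /kk/= mulrC.
  rewrite ge0_integral_scale//.
  - by rewrite integral_gaussd mule1.
  - by mfun.
  - by rewrite mulr_ge0// ln_ge0.
have Iqb : (\int[M]_p (qb p)%:E <= (n%:R / 2)%:E)%E.
  rewrite (IE _ mqb qb0).
  rewrite [leLHS](_ : _ = \int[m]_t ((2 * r ^+ 2)^-1 * (sqnorm (x t) + n%:R))%:E)%E; last first.
    apply: eq_integral => t _; rewrite [RHS](_ : _ = ((sqnorm (x t) + n%:R) / (2 * r ^+ 2))%:E).
      by rewrite -sqn.
    by rewrite mulrC.
  rewrite ge0_integral_scale//; last 2 first.
  - by mfun.
  - by move=> t; rewrite addr_ge0// sqnorm_ge0.
  rewrite ge0_integral_add//; last 2 first.
  - by mfun.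
  - by move=> t; exact: sqnorm_ge0.
  rewrite const1.
  apply: (@le_trans _ _ ((2 * r ^+ 2)^-1%:E * ((n%:R * (r ^+ 2 - 1))%:E + n%:R%:E))%E).
    by apply: lee_wpmul2l; rewrite ?lee_fin// leeD2r.
  rewrite -EFinD -EFinM lee_fin le_eqVlt; apply/orP; left; apply/eqP.
  by field; rewrite gt_eqF.
have Ia1 : (\int[M]_p (a1 p)%:E <= 2%:E)%E.
  rewrite (IE _ ma1 a10).
  pose F (p : T * E) := ((1 + D p) * gaussd r p.2)%:E.
  have mF : measurable_fun setT F by rewrite /F; mfun.
  have F0 p : (0 <= F p)%E by rewrite lee_fin mulr_ge0.
  rewrite [leLHS](_ : _ = \int[m]_t \int[lam]_y F (t, y))%E; last first.
    apply: eq_integral => t _.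
    rewrite -[RHS](ge0_integral_shift_tuple (x t) (f := fun y => F (t, y))).
    - by apply: eq_integral => z _; rewrite /F /a1 [z + _]addrC.
    - by apply: (measurableT_comp mF); mfun.
    - by move=> y; exact: F0.
  rewrite [leLHS](fubini_tonelli (m1 := m) (m2 := lam) F)//.
  rewrite -[leRHS]mule1 -(integral_gaussd r n) -ge0_integral_scale//; last by mfun.
  apply: ge0_le_integral => //.
  - by move=> y _; apply: integral_ge0.
  - exact: measurable_fun_fubini_tonelli_G.
  - by mfun.
  - move=> y _ /=.
    rewrite [leLHS](_ : _ = \int[m]_t (gaussd r y * (1 + D (t, y)))%:E)%E; last first.
      by apply: eq_integral => t _; rewrite /F mulrC.
    have mDy : measurable_fun setT (fun t => D (t, y)) by mfun.
    rewrite ge0_integral_scale//; last by mfun.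
    rewrite [leRHS]EFinM [leRHS]muleC; apply: lee_wpmul2l; first by rewrite lee_fin.
    rewrite ge0_integral_add// const1.
    by rewrite -[2%:E]/((1 + 1)%:E) EFinD leeD2l.
clear IE; clearbody M x1 q2 a1 qb kk.
have H : (\sum_(f <- [:: x1; q2]) \int[M]_p (f p)%:E <=
    \sum_(f <- [:: a1; qb; kk]) \int[M]_p (f p)%:E)%E.
  apply: ge0_integral_le_sums.
  - by move=> f /=; repeat (case=> [<-|]; first assumption).
  - move=> f p Hf; move: p; move: Hf => /=.
    by repeat (case=> [<-|]; first assumption).
  - by move=> p; rewrite !big_cons !big_nil !addr0 !addrA; exact: ptw.
move: H; rewrite !big_cons !big_nil !adde0 Iq2 Ikk -Ix1.
move: (\int[M]_p (x1 p)%:E)%E => X H.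
have {}H : (X + (n%:R / 2)%:E <= (2 + n%:R / 2 + n%:R * ln r)%:E)%E.
  apply: le_trans H _; rewrite EFinD EFinD -addeA.
  by apply: leeD => //; apply: leeD.
move: H; rewrite -leeBrDr// -EFinB => H; apply: le_trans H _.
by rewrite lee_fin; lra.
Qed.

End point_to_point.

(** * Laws of the sources of a code *)

Lemma integral_tuple_stdnormal (R : realType) n (f : n.-tuple R -> \bar R) :
  measurable_fun setT f -> (forall x, 0 <= f x)%E ->
  (\int[tuple_measure (@stdnormal R) n]_x f x =
   \int[leb R n]_x ((gaussd 1 x)%:E * f x))%E.
Proof.
elim: n => [|n IH] in f * => mf f0.
  by rewrite !integral_tuple_measure0 gaussd.unlock big_ord0 mul1e.
rewrite !integral_tuple_measureS//; last 2 first.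
- by mfun.
- by move=> x; rewrite mule_ge0// lee_fin gaussd_ge0.
transitivity (\int[@stdnormal R]_a
    \int[leb R n]_v ((gaussd 1 v)%:E * f [tuple of a :: v]))%E.
  apply: eq_integral => a _; rewrite IH//.
  by apply: (measurableT_comp mf); exact: measurable_cons.
have mfc : measurable_fun setT (fun p : R * n.-tuple R => f [tuple of p.1 :: p.2]).
  by apply: (measurableT_comp mf); exact: measurable_consp.
rewrite integral_stdnormal.
- apply: eq_integral => a _; rewrite muleC -ge0_integralZl//.
  + by apply: eq_integral => v _; rewrite gaussd_cons EFinM muleA.
  + apply: emeasurable_funM; first by mfun.
    by apply: (measurableT_comp mf); exact: measurable_cons.
  + by move=> v _; rewrite mule_ge0// lee_fin gaussd_ge0.
  + by rewrite lee_fin normal_pdf_ge0.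
- apply: (measurable_fun_fubini_tonelli_F (m2 := leb R n)
    (fun p : R * n.-tuple R => ((gaussd 1 p.2)%:E * f [tuple of p.1 :: p.2])%E)).
    by apply: emeasurable_funM => //; mfun.
  by move=> p; rewrite mule_ge0// lee_fin gaussd_ge0.
- by move=> a; apply: integral_ge0 => v _; rewrite mule_ge0// lee_fin gaussd_ge0.
Qed.

Section independence.
Context d (T : measurableType d) (R : realType) (P : probability T R).
Local Open Scope ereal_scope.

(** Rectangles form a generating system stable under intersection. The event [D] with its factor [k]
    lets the lemma be iterated: variables already treated are moved into [D]. *)
Lemma joint_law_pair d1 d2 (S1 : measurableType d1) (S2 : measurableType d2)
    (X : T -> S1) (Y : T -> S2)
    (m1 : {sigma_finite_measure set S1 -> \bar R})
    (m2 : {sigma_finite_measure set S2 -> \bar R}) (D : set T) (k : R) :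
  measurable_fun setT X -> measurable_fun setT Y -> measurable D -> (0 <= k)%R ->
  (forall A B, measurable A -> measurable B ->
    P (D `&` X @^-1` A `&` Y @^-1` B) = k%:E * (m1 A * m2 B)) ->
  forall C, measurable C ->
    P (D `&` (fun t => (X t, Y t)) @^-1` C) = k%:E * (m1 \x m2) C.
Proof.
move=> mX mY mD k0 H C mC.
have mXY : measurable_fun setT (fun t => (X t, Y t)) by exact: measurable_fun_pair.
pose XY t := (X t, Y t).
pose mu0 : {measure set (S1 * S2) -> \bar R} := pushforward (mrestr P mD) XY.
pose mu := mu0 mXY.
pose nu : {measure set (S1 * S2) -> \bar R} := mscale (NngNum k0) (m1 \x m2).
transitivity (mu C); first by rewrite /mu /mu0/= /pushforward/= /mrestr setIC.
transitivity (nu C); last by [].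
pose G : set_system (S1 * S2) := [set A `*` B | A in measurable & B in measurable].
apply: (measure_unique G (fun=> setT)) => //.
- exact: measurable_prod_measurableType.
- move=> _ _ [A1 mA1 [B1 mB1 <-]] [A2 mA2 [B2 mB2 <-]].
  rewrite -setXI; exists (A1 `&` A2); first exact: measurableI.
  by exists (B1 `&` B2) => //; exact: measurableI.
- by move=> _; exists setT => //; exists setT => //; rewrite setXTT.
- by rewrite bigcup_const.
- move=> _ [A mA [B mB <-]]; rewrite /mu /mu0/= /pushforward/= /mrestr /nu/= /mscale/=.
  rewrite product_measure1E// -H//; congr (P _).
  by apply/seteqP; split => t /=; [move=> [[]]|move=> [[]]].
- move=> _; rewrite /mu /mu0/= /pushforward/= /mrestr preimage_setT setTI.
  by apply: le_lt_trans (ltry 1); rewrite -(probability_setT P) le_measure// inE.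
Qed.

(** Induction on the number of coordinates, with the factor [k] general because each step changes
    it. *)
Lemma joint_law_tuple n (Z : 'I_n -> T -> R)
    (m : probability R R) (D : set T) (k : R) :
  (forall i, measurable_fun setT (Z i)) -> measurable D -> (0 <= k)%R ->
  (forall C : 'I_n -> set R, (forall i, measurable (C i)) ->
    P (D `&` \bigcap_i (Z i @^-1` C i)) = (k * \prod_(i < n) fine (m (C i)))%:E) ->
  forall C, measurable C ->
    P (D `&` (fun t => [tuple Z i t | i < n]) @^-1` C) =
    k%:E * tuple_measure m n C.
Proof.
elim: n => [|n IH] in Z D k * => mZ mD k0 H C mC.
  have := H (fun=> setT) (fun=> measurableT).
  rewrite big_ord0 mulr1 => PD.
  rewrite /= diracE; have [CT|CT] := pselect (C [tuple]).
    rewrite mem_set// mule1 -PD; congr (P _); apply/seteqP; split => t /= [Dt _] //.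
    by split => //; rewrite [X in C X](tuple0_eq _).
  rewrite memNset// mule0 (_ : _ `&` _ = set0) ?measure0//.
  by apply/seteqP; split => t //= [_]; rewrite [X in C X](tuple0_eq _).
pose Y t := [tuple Z (lift ord0 i) t | i < n].
have mY : measurable_fun setT Y.
  apply/measurable_fun_tnthP => i; rewrite (_ : _ \o _ = Z (lift ord0 i))//.
  by apply/funext => t /=; rewrite tnth_mktuple.
have mA0 (A : set R) : measurable A -> measurable (Z ord0 @^-1` A).
  by move=> mA; rewrite -[X in measurable X]setTI; exact: mZ.
have key A B : measurable A -> measurable B ->
    P (D `&` Z ord0 @^-1` A `&` Y @^-1` B) = k%:E * (m A * tuple_measure m n B).
  (* The condition on the first coordinate joins [D], and its probability joins [k]. *)
  move=> mA mB; rewrite (IH _ _ (k * fine (m A))%R)//.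
  - by rewrite EFinM fineK ?muleA// fin_num_measure.
  - by apply: measurableI => //; exact: mA0.
  - by rewrite mulr_ge0// fine_ge0.
  - move=> C' mC'; pose C'' i := if unlift ord0 i is Some j then C' j else A.
    have C0 : C'' ord0 = A by rewrite /C'' unlift_none.
    have Cl j : C'' (lift ord0 j) = C' j by rewrite /C'' liftK.
    have := H C''; rewrite big_ord_recl C0 mulrA.
    under eq_bigr do rewrite Cl.
    move=> <-; last by move=> i; rewrite /C''; case: unlift.
    congr (P _); apply/seteqP; split => t /=.
      move=> [[Dt At] Ct]; split => // i _.
      by case: (unliftP ord0 i) => [j ->|->]; rewrite /preimage/= ?Cl ?C0//; exact: Ct.
    move=> [Dt Ct]; split.
      by split => //; have := Ct ord0 I; rewrite /= C0.
    by move=> i _; have := Ct (lift ord0 i) I; rewrite /= Cl.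
have mC' : measurable (@consp _ R n @^-1` C).
  by rewrite -[X in measurable X]setTI; exact: measurable_consp.
have := joint_law_pair (mZ ord0) mY mD k0 key mC'.
rewrite -comp_preimage (_ : _ \o _ = (fun t => [tuple Z i t | i < n.+1]))//.
apply/funext => t /=; apply: eq_from_tnth => i; rewrite tnth_mktuple /consp/=.
have [->|i0] := eqVneq i ord0; first by [].
have [j ->] : exists j, i = lift ord0 j.
  by case: (unliftP ord0 i) i0 => [j ->|->//]; exists j.
by rewrite tnthS tnth_mktuple.
Qed.

End independence.

Section sources.
Context (R : realType) (M1 M2 N : nat) (c : zic_code R M1 M2 N) (b : bool).
Local Open Scope ereal_scope.
Notation P := (prob c).
Notation E := (N.-tuple R).

(** Receiver 1 for [b] true, receiver 2 for [b] false. Each error event and the leakage involve the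
    noise of one receiver, so the receivers can be treated one at a time. *)
Definition noise (i : 'I_N) : sample c -> R := if b then Z1 c i else Z2 c i.
Definition noises (t : sample c) : E := [tuple noise i t | i < N].
Definition source1 (t : sample c) := (W1 c t, Q1 c t).
Definition source2 (t : sample c) := (W2 c t, Q2 c t).

Lemma measurable_noise i : measurable_fun setT (noise i).
Proof. by rewrite /noise; case: b. Qed.

Lemma measurable_noises : measurable_fun setT noises.
Proof.
apply/measurable_fun_tnthP => i; rewrite (_ : _ \o _ = noise i).
  exact: measurable_noise.
by apply/funext => t /=; rewrite tnth_mktuple.
Qed.

Lemma measurable_source1 : measurable_fun setT source1.
Proof. exact: measurable_fun_pair. Qed.

Lemma measurable_source2 : measurable_fun setT source2.
Proof. exact: measurable_fun_pair. Qed.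

Let noise_law i A : measurable A -> P (noise i @^-1` A) = stdnormal A.
Proof. by rewrite /noise; case: b => mA; [exact: Z1_normal|exact: Z2_normal]. Qed.

Let noise_source (i : 'I_N) : source N := if b then noise1 i else noise2 i.

Let sources_boxes a1 a2 q1 q2 (C : 'I_N -> set R) :
  measurable a1 -> measurable a2 -> measurable q1 -> measurable q2 ->
  (forall i, measurable (C i)) ->
  P (W1 c @^-1` a1 `&` W2 c @^-1` a2 `&` (Q1 c @^-1` q1 `&` Q2 c @^-1` q2) `&`
     \bigcap_i (noise i @^-1` C i)) =
  (fine (P (W1 c @^-1` a1)) * fine (P (W2 c @^-1` a2)) *
   (fine (P (Q1 c @^-1` q1)) * fine (P (Q2 c @^-1` q2))) *
   \prod_(i < N) fine (stdnormal (C i)))%:E.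
Proof.
move=> ma1 ma2 mq1 mq2 mC.
(* Indices below 4 stand for the messages and the local randomness, the other N for the noises of
   the chosen receiver. *)
pose idx (k : 'I_(4 + N)) : source N := match fintype.split k with
  | inl j => nth message1 [:: message1; message2; local1; local2] j
  | inr j => noise_source j end.
pose S (k : 'I_(4 + N)) : set (sample c) := match fintype.split k with
  | inl j => nth setT [:: W1 c @^-1` a1; W2 c @^-1` a2; Q1 c @^-1` q1; Q2 c @^-1` q2] j
  | inr j => noise j @^-1` C j end.
have idx_inj : injective idx.
  move=> k l; rewrite /idx -(splitK k) -(splitK l) !unsplitK.
  case: (fintype.split k) => [[[|[|[|[|j]]]] jP]|j]; case: (fintype.split l) => [[[|[|[|[|j']]]] j'P]|j'] //=;
    rewrite /noise_source.
  all: try by case: b.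
  all: try by move=> _; congr lshift; apply/val_inj.
  by case: b => -[->].
have := @sources_independent _ _ _ _ c (4 + N)%N idx S idx_inj _.
move=> H.
have {}H := H _.
rewrite big_split_ord /= in H.
have SL j : S (lshift N j) = nth setT [:: W1 c @^-1` a1; W2 c @^-1` a2; Q1 c @^-1` q1; Q2 c @^-1` q2] j.
  by rewrite /S; case: split_ordP => k /eqP; rewrite ?eq_lrshift// eq_lshift => /eqP ->.
have SR j : S (rshift 4 j) = noise j @^-1` C j.
  by rewrite /S; case: split_ordP => k /eqP; rewrite ?eq_rlshift// eq_rshift => /eqP ->.
rewrite !big_ord_recl big_ord0 !SL /= mulr1 in H.
rewrite (eq_bigr (fun i => fine (stdnormal (C i)))) in H; last first.
  by move=> i _; rewrite SR noise_law.
rewrite -[(_ * _ * (_ * _))%R]mulrA -H => [|k]; last first.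
  rewrite /idx /S; case: (fintype.split k) => [[[|[|[|[|j]]]] jP]|j] //=.
  - by exists a1 => //; rewrite setTI.
  - by exists a2 => //; rewrite setTI.
  - by exists q1 => //; rewrite setTI.
  - by exists q2 => //; rewrite setTI.
  - rewrite /noise_source /noise; case: b => /=.
      by exists (C j) => //; rewrite setTI.
    by exists (C j) => //; rewrite setTI.
congr (P _); apply/seteqP; split => t.
  move=> [[[h1 h2] [h3 h4]] hC] k _.
  rewrite /S; case: (fintype.split k) => [[[|[|[|[|j]]]] jP]|j] //=.
  exact: hC.
move=> H'; split; last by move=> i _; have := H' (rshift 4 i) I; rewrite SR.
have g (j : 'I_4) := H' (lshift N j) I.
by split; split; [have := g 0%R|have := g (inord 1)|have := g (inord 2)|have := g (inord 3)];
  rewrite SL /= ?inordK.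
Qed.

Let indep_noises a1 a2 q1 q2 C :
  measurable a1 -> measurable a2 -> measurable q1 -> measurable q2 -> measurable C ->
  P (W1 c @^-1` a1 `&` W2 c @^-1` a2 `&` (Q1 c @^-1` q1 `&` Q2 c @^-1` q2) `&`
     noises @^-1` C) =
  (fine (P (W1 c @^-1` a1)) * fine (P (W2 c @^-1` a2)) *
   (fine (P (Q1 c @^-1` q1)) * fine (P (Q2 c @^-1` q2))))%:E *
   tuple_measure (@stdnormal R) N C.
Proof.
move=> ma1 ma2 mq1 mq2 mC.
have m1 (d' : measure_display) (T' : measurableType d') (f : {mfun sample c >-> T'}) A :
  measurable A -> measurable (f @^-1` A).
  by move=> mA; rewrite -[X in measurable X]setTI; exact: measurable_funP.
apply: joint_law_tuple => //.
- by apply: measurableI; apply: measurableI; exact: m1.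
- by rewrite !mulr_ge0// fine_ge0.
- by move=> C' mC'; rewrite sources_boxes.
Qed.

Let mpre (d' : measure_display) (T' : measurableType d') (f : sample c -> T') A :
  measurable_fun setT f -> measurable A -> measurable (f @^-1` A).
Proof. by move=> mf mA; rewrite -[X in measurable X]setTI; exact: mf. Qed.

Let fineP A : measurable A -> (fine (P A))%:E = P A.
Proof. by move=> mA; rewrite fineK// fin_num_measure. Qed.

(** The total mass is read off from [indep_noises] on full sets. *)
Let gammaT : tuple_measure (@stdnormal R) N setT = 1.
Proof.
have := indep_noises (@measurableT _ nat) (@measurableT _ nat)
  (@measurableT _ (local1_space c)) (@measurableT _ (local2_space c)) (@measurableT _ E).
by rewrite !preimage_setT !setIT !probability_setT /= !mulr1 mul1e => <-.
Qed.

Let gamma_fin C : measurable C -> (fine (tuple_measure (@stdnormal R) N C))%:E =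
  tuple_measure (@stdnormal R) N C.
Proof.
move=> mC; rewrite fineK// ge0_fin_numE//; apply: le_lt_trans (ltry 1).
by rewrite -gammaT le_measure// inE.
Qed.

(* An event that is independent of the rectangles of [(X, Y)] is independent
   of [(X, Y)]. *)
Let indep_merge d1 d2 (S1 : measurableType d1) (S2 : measurableType d2)
    (X : {mfun sample c >-> S1}) (Y : {mfun sample c >-> S2}) (D : set (sample c)) (k : R) :
  measurable D -> (0 <= k)%R ->
  (forall A B, measurable A -> measurable B ->
    P (X @^-1` A `&` Y @^-1` B) = P (X @^-1` A) * P (Y @^-1` B)) ->
  (forall A B, measurable A -> measurable B ->
    P (D `&` X @^-1` A `&` Y @^-1` B) = k%:E * (P (X @^-1` A) * P (Y @^-1` B))) ->
  forall C, measurable C ->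
    P (D `&` (fun t => (X t, Y t)) @^-1` C) = k%:E * P ((fun t => (X t, Y t)) @^-1` C).
Proof.
move=> mD k0 XY DXY C mC.
have mX : measurable_fun setT X by [].
have mY : measurable_fun setT Y by [].
pose dX : probability S1 R := distribution P X.
pose dY : probability S2 R := distribution P Y.
have DXY' A B : measurable A -> measurable B ->
    P (D `&` X @^-1` A `&` Y @^-1` B) = k%:E * (dX A * dY B) by exact: DXY.
have XY' A B : measurable A -> measurable B ->
    P (setT `&` X @^-1` A `&` Y @^-1` B) = 1%:E * (dX A * dY B).
  by move=> mA mB; rewrite setTI mul1e; exact: XY.
rewrite (joint_law_pair mX mY mD k0 DXY' mC); congr (_ * _).
by rewrite -[LHS]mul1e -(joint_law_pair mX mY measurableT ler01 XY' mC) setTI.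
Qed.

(** From boxes to arbitrary events of the pairs in two merges, first of [W1] with [Q1], then of [W2]
    with [Q2]; each time all other conditions form the event [D]. *)
Lemma indep_sources S1 S2 C : measurable S1 -> measurable S2 -> measurable C ->
  P (source1 @^-1` S1 `&` source2 @^-1` S2 `&` noises @^-1` C) =
  P (source1 @^-1` S1) * P (source2 @^-1` S2) * tuple_measure (@stdnormal R) N C.
Proof.
move=> mS1 mS2 mC.
have mn := measurable_noises.
have W1Q1 a q : measurable a -> measurable q ->
    P (W1 c @^-1` a `&` Q1 c @^-1` q) = P (W1 c @^-1` a) * P (Q1 c @^-1` q).
  move=> ma mq; have := indep_noises ma (@measurableT _ nat) mq
    (@measurableT _ (local2_space c)) (@measurableT _ E).
  rewrite !preimage_setT !setIT probability_setT gammaT /= !mulr1 mule1 => ->.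
  by rewrite EFinM !fineP//; exact: mpre.
have W2Q2 a q : measurable a -> measurable q ->
    P (W2 c @^-1` a `&` Q2 c @^-1` q) = P (W2 c @^-1` a) * P (Q2 c @^-1` q).
  move=> ma mq; have := indep_noises (@measurableT _ nat) ma
    (@measurableT _ (local1_space c)) mq (@measurableT _ E).
  rewrite !preimage_setT !setIT !setTI probability_setT gammaT /= !mul1r mule1 => ->.
  by rewrite EFinM !fineP//; exact: mpre.
have step1 a2 q2 : measurable a2 -> measurable q2 ->
    P (source1 @^-1` S1 `&` (W2 c @^-1` a2 `&` Q2 c @^-1` q2) `&` noises @^-1` C) =
    P (source1 @^-1` S1) * (P (W2 c @^-1` a2) * P (Q2 c @^-1` q2)) *
      tuple_measure (@stdnormal R) N C.
  move=> ma2 mq2.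
  pose D := W2 c @^-1` a2 `&` Q2 c @^-1` q2 `&` noises @^-1` C.
  pose k := (fine (P (W2 c @^-1` a2)) * fine (P (Q2 c @^-1` q2)) *
    fine (tuple_measure (@stdnormal R) N C))%R.
  have kE : k%:E = P (W2 c @^-1` a2) * P (Q2 c @^-1` q2) * tuple_measure (@stdnormal R) N C.
    by rewrite /k !EFinM gamma_fin// !fineP//; exact: mpre.
  have mD : measurable D.
    by apply: measurableI; [apply: measurableI|]; exact: mpre.
  have k0 : (0 <= k)%R by rewrite /k !mulr_ge0// fine_ge0.
  rewrite [X in P X](_ : _ = D `&` source1 @^-1` S1); last first.
    by apply/seteqP; split => t /=; rewrite /D /=; tauto.
  rewrite (indep_merge (X := W1 c) (Y := Q1 c) mD k0 W1Q1)//.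
    by rewrite kE muleC muleA.
  move=> A B mA mB.
  rewrite [X in P X](_ : _ = W1 c @^-1` A `&` W2 c @^-1` a2 `&` (Q1 c @^-1` B `&` Q2 c @^-1` q2) `&`
     noises @^-1` C); last by apply/seteqP; split => t /=; rewrite /D /=; tauto.
  rewrite indep_noises// -(gamma_fin mC).
  rewrite -[X in _ = _ * (X * _)]fineP; last exact: mpre.
  rewrite -[X in _ = _ * (_ * X)]fineP; last exact: mpre.
  by rewrite -!EFinM; congr EFin; rewrite /k; ring.
pose D := source1 @^-1` S1 `&` noises @^-1` C.
pose k := (fine (P (source1 @^-1` S1)) * fine (tuple_measure (@stdnormal R) N C))%R.
have kE : k%:E = P (source1 @^-1` S1) * tuple_measure (@stdnormal R) N C.
  by rewrite /k EFinM gamma_fin// fineP//; apply: mpre => //; exact: measurable_source1.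
have mD : measurable D.
  by apply: measurableI; apply: mpre => //; exact: measurable_source1.
have k0 : (0 <= k)%R by rewrite /k mulr_ge0// fine_ge0.
rewrite [X in P X](_ : _ = D `&` source2 @^-1` S2); last first.
  by apply/seteqP; split => t /=; rewrite /D /=; tauto.
rewrite (indep_merge (X := W2 c) (Y := Q2 c) mD k0 W2Q2)//.
  by rewrite kE -[LHS]muleA [X in _ * X]muleC muleA.
move=> A B mA mB; rewrite kE.
rewrite [X in P X](_ : _ = source1 @^-1` S1 `&` (W2 c @^-1` A `&` Q2 c @^-1` B) `&` noises @^-1` C).
  by rewrite step1// -[LHS]muleA [X in _ * X]muleC muleA.
by apply/seteqP; split => t /=; rewrite /D /=; tauto.
Qed.

Notation gamma := (tuple_measure (@stdnormal R) N).

(** Independence is expressed by two copies of the sample space: [u] supplies source 2 and [t]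
    supplies source 1, so the laws of the sources need no separate names. *)
Lemma integral_sources
    (F : (nat * local1_space c) * ((nat * local2_space c) * E) -> \bar R) :
  measurable_fun setT F -> (forall p, 0 <= F p) ->
  \int[P]_t F (source1 t, (source2 t, noises t)) =
  \int[P]_u \int[P]_t \int[leb R N]_z
    ((gaussd 1 z)%:E * F (source1 t, (source2 u, z))).
Proof.
move=> mF F0.
have ms1 := measurable_source1; have ms2 := measurable_source2.
have mn := measurable_noises.
pose d1 : probability _ R := distribution P (pairRV (W1 c) (Q1 c)).
pose d2 : probability _ R := distribution P (pairRV (W2 c) (Q2 c)).
pose d2n : {sigma_finite_measure set _ -> \bar R} := prodm d2 gamma.
have ms2n : measurable_fun setT (fun t => (source2 t, noises t)).
  exact: measurable_fun_pair.
have law2 A B : measurable A -> measurable B ->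
    P (setT `&` source1 @^-1` A `&` (fun t => (source2 t, noises t)) @^-1` B) =
    1%:E * (d1 A * d2n B).
  move=> mA mB; rewrite setTI mul1e.
  have mD : measurable (source1 @^-1` A) by exact: mpre.
  have k0 : (0 <= fine (P (source1 @^-1` A)))%R by exact: fine_ge0.
  have H S2 C : measurable S2 -> measurable C ->
      P (source1 @^-1` A `&` source2 @^-1` S2 `&` noises @^-1` C) =
      (fine (P (source1 @^-1` A)))%:E * (d2 S2 * gamma C).
    by move=> mS2 mC; rewrite indep_sources// fineP// muleA.
  by rewrite (joint_law_pair ms2 mn mD k0 H mB) fineP.
have law C : measurable C -> P ((fun t => (source1 t, (source2 t, noises t))) @^-1` C) =
    prodm d1 d2n C.
  move=> mC.
  by have := joint_law_pair ms1 ms2n measurableT ler01 law2 mC; rewrite setTI mul1e.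
have mS : measurable_fun setT (fun t => (source1 t, (source2 t, noises t))).
  exact: measurable_fun_pair.
pose mu0 : {measure set _ -> \bar R} :=
  pushforward P (fun t => (source1 t, (source2 t, noises t))).
transitivity (\int[mu0 mS]_p F p); first by rewrite (ge0_integral_pushforward mS).
transitivity (\int[prodm d1 d2n]_p F p).
  by apply: eq_measure_integral => C mC _; exact: law.
rewrite integral_prodm//.
transitivity (\int[d1]_a \int[d2]_b \int[gamma]_z F (a, (b, z))).
  apply: eq_integral => a _; rewrite /d2n integral_prodm//.
  by apply: (measurableT_comp mF); mfun.
pose G (q : (nat * local1_space c) * (nat * local2_space c)) :=
  \int[leb R N]_z ((gaussd 1 z)%:E * F (q.1, (q.2, z))).
have mG : measurable_fun setT G.
  apply: (measurable_fun_fubini_tonelli_F (m2 := leb R N) (fun q :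
    ((nat * local1_space c) * (nat * local2_space c)) * E =>
    (gaussd 1 q.2)%:E * F (q.1.1, (q.1.2, q.2)))).
    by apply: emeasurable_funM; [mfun|apply: (measurableT_comp mF); mfun].
  by move=> q; rewrite mule_ge0// lee_fin gaussd_ge0.
have G0 q : 0 <= G q.
  by apply: integral_ge0 => z _; rewrite mule_ge0// lee_fin gaussd_ge0.
transitivity (\int[d1]_a \int[d2]_b G (a, b)).
  apply: eq_integral => a _; apply: eq_integral => b' _.
  rewrite integral_tuple_stdnormal//.
  by apply: (measurableT_comp mF); mfun.
rewrite [LHS](fubini_tonelli G)//.
have mH : measurable_fun setT (fun b => \int[d1]_a G (a, b)).
  exact: measurable_fun_fubini_tonelli_G.
have H0 y : 0 <= \int[d1]_a G (a, y) by exact: integral_ge0.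
apply: etrans (ge0_integral_distribution (pairRV (W2 c) (Q2 c)) mH H0) _.
apply: eq_integral => u _ /=.
have mGu : measurable_fun setT (fun a => G (a, source2 u)).
  by apply: (measurableT_comp mG); mfun.
exact: (ge0_integral_distribution (pairRV (W1 c) (Q1 c)) mGu (fun a => G0 _)).
Qed.

End sources.

(** * Leakage and decoding *)

(* [e] is the inverse of the density of [mu] with respect to [nu]. *)
Lemma kl_divergence_fin_num d (T : measurableType d) (R : realType)
    (mu nu : probability T R) : kl_divergence mu nu \is a fin_num ->
  exists e : T -> R, [/\ measurable_fun setT e, forall x, 0 < e x,
    forall H : T -> \bar R, measurable_fun setT H -> (forall x, 0 <= H x)%E ->
      (\int[mu]_x ((e x)%:E * H x) <= \int[nu]_x H x)%E &
    exists l : R * R,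
      [/\ (\int[mu]_x (Num.max 0 (- ln (e x)))%:E = l.1%:E)%E,
          (\int[mu]_x (Num.max 0 (ln (e x)))%:E = l.2%:E)%E &
          l.1 - l.2 = ln 2 * fine (kl_divergence mu nu)]].
Proof.
rewrite /kl_divergence; case: pselect => [munu|//].
set h := Radon_Nikodym _ nu => klfin.
have mh : measurable_fun setT h.
  exact: measurable_int (Radon_Nikodym_integrable _).
pose f x := fine (h x).
have mf : measurable_fun setT f by exact: measurableT_comp.
(* Where the density is not positive, [e] is 1. It is thus positive everywhere, and [ln e = - ln f]
   persists because [ln] vanishes at such arguments. *)
pose e x := if 0 < f x then (f x)^-1 else 1.
have me : measurable_fun setT e.
  apply: measurable_fun_ifT; [exact: measurable_fun_ltr|exact: measurable_invr|exact: measurable_cst].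
have lne x : ln (e x) = - ln (f x).
  rewrite /e; case: ltP => f0; first by rewrite lnV.
  by rewrite ln1 ln0// oppr0.
have e0 x : 0 < e x by rewrite /e; case: (ltrP 0 (f x)) => f0; [rewrite invr_gt0|exact: ltr01].
exists e; split => //.
- move=> H mH H0.
  (* This version of the derivative is nonnegative and finite everywhere and agrees with [h] almost
     everywhere. *)
  pose rn := Radon_Nikodym_SigmaFinite.f mu nu.
  have mrn : measurable_fun setT rn.
    exact: measurable_int (Radon_Nikodym_SigmaFinite.f_integrable munu).
  have eH0 x : (0 <= (e x)%:E * H x)%E by rewrite mule_ge0// lee_fin ltW.
  have meH : measurable_fun setT (fun x => ((e x)%:E * H x)%E) by mfun.
  rewrite -(Radon_Nikodym_SigmaFinite.change_of_variables munu)//.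
  apply: ae_ge0_le_integral => //.
  + by move=> x _; rewrite mule_ge0//; exact: Radon_Nikodym_SigmaFinite.f_ge0.
  + exact: emeasurable_funM.
  + have := ae_eq_Radon_Nikodym_SigmaFinite munu measurableT.
    apply: filterS => x /= /(_ I) rnE _.
    have r0 := Radon_Nikodym_SigmaFinite.f_ge0 munu x.
    have rf := Radon_Nikodym_SigmaFinite.f_fin_num munu x.
    have hE : Radon_Nikodym_SigmaFinite.f mu nu x = (f x)%:E.
      by rewrite /f /h -rnE fineK.
    have fx0 : 0 <= f x by rewrite -lee_fin -hE.
    rewrite hE muleC muleA -EFinM -[leRHS]mul1e lee_wpmul2r// lee_fin /e.
    by case: ltP => fx; [rewrite divff ?gt_eqF|rewrite mulr1 (le_trans fx)].
- have ln2 : 0 < ln 2 :> R by rewrite ln_gt0// ltr1n.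
  pose L x : \bar R := (log2 (f x))%:E.
  have mL : measurable_fun setT L by rewrite /L /log2; mfun.
  have [mLp mLn] := (measurable_funepos mL, measurable_funeneg mL).
  move: klfin; rewrite (_ : (\int[mu]_x _)%E = (\int[mu]_x L x)%E)// integralE.
  (* A finite difference of extended reals has finite terms, so both parts of the logarithm have
     finite integrals. *)
  rewrite fin_numD fin_numN => /andP[Lp Ln].
  exists (ln 2 * fine (\int[mu]_x L^\+ x)%E, ln 2 * fine (\int[mu]_x L^\- x)%E) => /=.
  split; last by rewrite -mulrBr; congr (_ * _); apply/esym/fineB.
  + rewrite EFinM fineK// -ge0_integralZl//; last by rewrite lee_fin ltW.
    apply: eq_integral => x _; rewrite lne opprK funeposE /L -EFin_max -EFinM.
    by rewrite maxr_pMr ?ltW// mulr0 /log2 mulrCA divff ?gt_eqF// mulr1 maxC.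
  + rewrite EFinM fineK// -ge0_integralZl//; last by rewrite lee_fin ltW.
    apply: eq_integral => x _; rewrite lne funenegE /L -EFinN -EFin_max -EFinM.
    by rewrite maxr_pMr ?ltW// mulr0 /log2 mulrN mulrCA divff ?gt_eqF// mulr1 maxC.
Qed.

Lemma integral_mfrestr d (T : measurableType d) (R : realType)
    (mu : {finite_measure set T -> \bar R}) (D : set T) (mD : measurable D)
    (muD : (mu D < +oo)%E) (f : T -> \bar R) :
  measurable_fun setT f -> (forall x, 0 <= f x)%E ->
  (\int[mfrestr mD muD]_x f x = \int[mu]_(x in D) f x)%E.
Proof.
move=> mf f0.
have mDC : measurable (~` D) by exact: measurableC.
rewrite (ge0_negligible_integral mDC)//; last first.
  by rewrite /= /mfrestr /mrestr setICl measure0.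
rewrite setTD setCK; apply: eq_measure_integral => A mA AD.
by rewrite [LHS]/= /mfrestr /mrestr (setIidl AD).
Qed.

Lemma measurable_eqn_indic d (T : measurableType d) (R : realType) (f g : T -> nat) :
  measurable_fun setT f -> measurable_fun setT g ->
  measurable_fun setT (fun x => ((f x == g x)%:R : R)).
Proof.
move=> mf mg.
rewrite (_ : (fun _ => _) = (fun x => if f x == g x then 1 else 0)).
  by apply: measurable_fun_ifT => //; exact: measurable_fun_eqn.
by apply/funext => x; case: eqP.
Qed.

(** Concavity: [p ln M + (1 - p) ln 1 <= ln (p M + 1 - p)], which is at most [ln (1 + M p)]. It is
    proved from the tangent at [1 + M p]. Values of p strictly between 0 and 1 arise from the
    averaged decisions of receiver 2. *)
Lemma mul_ln_le_ln1M (R : realType) (M p : R) : 0 < M -> 0 <= p -> p <= 1 ->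
  p * ln M <= ln (1 + M * p).
Proof.
move=> M0 p0 p1; have t0 : 0 < 1 + M * p by rewrite ltr_pwDl// mulr_ge0// ltW.
have h (x : R) : 0 < x -> ln x - ln (1 + M * p) <= x / (1 + M * p) - 1.
  move=> x0; rewrite -ln_div ?posrE//.
  have xt : 0 < x / (1 + M * p) by rewrite divr_gt0.
  by have := @le_ln1Dx R (x / (1 + M * p) - 1) ltac:(lra); rewrite addrC subrK.
have h1 := h M M0; have h2 := h 1 ltr01; rewrite ln1 in h2.
have q0 : 0 <= 1 - p by lra.
have {}h1 := ler_wpM2l p0 h1; have {}h2 := ler_wpM2l q0 h2.
have e : p * (M / (1 + M * p) - 1) + (1 - p) * (1 / (1 + M * p) - 1) =
    - (p / (1 + M * p)) by field; rewrite gt_eqF.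
have : 0 <= p / (1 + M * p) by rewrite divr_ge0// ltW.
lra.
Qed.

Section uniform.
Context d (T : measurableType d) (R : realType) (P : probability T R).
Variables (W : {RV P >-> nat}) (M : nat).
Hypothesis M0 : (0 < M)%N.
Hypothesis WM : forall w, (w < M)%N -> P (W @^-1` [set w]) = (M%:R^-1)%:E.
Local Open Scope ereal_scope.

Let mWw w : measurable (W @^-1` [set w]).
Proof. by rewrite -[X in measurable X]setTI; exact: measurable_funP. Qed.

(** The values below [M] already carry mass one, so any other value has probability 0. A decoder may
    output any natural number. *)
Lemma uniform_le w : P (W @^-1` [set w]) <= (M%:R^-1)%:E.
Proof.
have [wM|Mw] := ltnP w M; first by rewrite WM.
pose F k := W @^-1` [set k].
have tF : trivIset [set: nat] F.
  by move=> i j _ _ [t [/= <- <-]].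
have := @measure_bigsetU _ _ _ P F mWw tF M.
rewrite (eq_bigr (fun=> (M%:R^-1)%:E)) => [|i _]; last exact: WM.
have Mne0 : (M%:R != 0 :> R)%R by rewrite pnatr_eq0 -lt0n.
rewrite sumEFin sumr_const card_ord -[(_ *+ M)%R]mulr_natl divff// => PF.
set U := \big[setU/set0]_(i < M) F i in PF.
have mU : measurable U by apply: bigsetU_measurable => i _; exact: mWw.
have h : P U + P (F w) <= 1.
  rewrite -measureU//; [exact: probability_le1 (measurableU _ _ mU (mWw w))|exact: mWw|].
  apply/seteqP; split => t //= -[].
  rewrite /U -bigcup_mkord => -[k /= kM Fk] Fw.
  by move: kM; rewrite -Fk Fw ltnNge Mw.
have : P (F w) <= 0.
  have Pf : P (F w) \is a fin_num by exact: fin_num_measure (mWw w).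
  by move: h; rewrite [P U]PF -(fineK Pf) -EFinD !lee_fin; lra.
by move=> /le_trans; apply; rewrite lee_fin invr_ge0.
Qed.

(** A guess made without observation is right with probability at most [1 / M]. *)
Lemma integral_uniform_le1 w : \int[P]_t (M%:R * (w == W t)%:R)%:E <= 1.
Proof.
have mW : measurable_fun setT W by [].
have mI : measurable_fun setT (fun t => ((w == W t)%:R : R)).
  by apply: measurable_eqn_indic => //; exact: measurable_cst.
rewrite (ge0_integral_scale _ mI) => [|t|]; rewrite ?ler0n//.
rewrite (_ : \int[P]_t _ = P (W @^-1` [set w])); last first.
  rewrite -[X in P X]setIT -(integral_indic P measurableT (mWw w)).
  apply: eq_integral => t _; rewrite indicE; congr (_ : bool)%:R%:E.
  by apply/eqP/idP; rewrite inE /=.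
rewrite -[leRHS](_ : M%:R%:E * (M%:R^-1)%:E = 1).
  by rewrite lee_wpmul2l ?uniform_le// lee_fin.
by rewrite -EFinM divff// pnatr_eq0 -lt0n.
Qed.

End uniform.

Section decoding.
Context d (T : measurableType d) (R : realType) (P : probability T R).
Local Open Scope ereal_scope.

Lemma integral_eqn_indic (f g : T -> nat) :
  measurable_fun setT f -> measurable_fun setT g ->
  \int[P]_t ((f t == g t)%:R)%:E = (1 - fine (P [set t | f t <> g t]))%:E.
Proof.
move=> mf mg.
have mE : measurable [set t | f t = g t].
  have := measurable_fun_eqn mf mg measurableT (I : measurable [set true]).
  rewrite setTI; congr measurable; apply/seteqP; split => t /=; first by move/eqP.
  by move=> ->; exact/eqP.
have -> : [set t | f t <> g t] = ~` [set t | f t = g t] by [].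
have Pf : P [set t | f t = g t] \is a fin_num by exact: fin_num_measure.
rewrite probability_setC// -(fineK Pf) -EFinB [X in (1 - X)%R]/= subKr (fineK Pf).
rewrite -[X in P X]setIT -(integral_indic P measurableT mE).
apply: eq_integral => t _; rewrite indicE; congr (_ : bool)%:R%:E.
by apply/eqP/idP; rewrite inE.
Qed.

(** Pointwise, an error contributes 0 to both sides and a correct decision [ln M] against
    [ln (1 + M)]. *)
Lemma decoding_ln_le (f g : T -> nat) (M : nat) : (0 < M)%N ->
  measurable_fun setT f -> measurable_fun setT g ->
  ((1 - fine (P [set t | f t <> g t])) * ln M%:R)%:E <=
  \int[P]_t (ln (1 + M%:R * (f t == g t)%:R))%:E.
Proof.
move=> M0 mf mg; have mI := @measurable_eqn_indic _ _ R _ _ mf mg.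
have lM0 : (0 <= ln (M%:R : R))%R by rewrite ln_ge0// ler1n.
rewrite EFinM -integral_eqn_indic// muleC -ge0_integral_scale => [|//|t|//]; last by rewrite ler0n.
apply: ge0_le_integral => //.
- by move=> t _; rewrite lee_fin mulr_ge0.
- by mfun.
- by mfun.
- move=> t _; rewrite lee_fin mulrC; apply: mul_ln_le_ln1M => //.
  + by rewrite ltr0n.
  + by rewrite lern1; case: eqP.
Qed.

End decoding.

Section codes.
Context (R : realType) (M1 M2 N : nat) (c : zic_code R M1 M2 N).
Local Open Scope ereal_scope.
Notation P := (prob c).
Notation E := (N.-tuple R).
Notation I1 := (nat * local1_space c)%type.
Notation I2 := (nat * local2_space c)%type.

Let ms1 := @measurable_source1 R M1 M2 N c.
Let ms2 := @measurable_source2 R M1 M2 N c.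

Lemma integral_inputs (F : I1 * I2 -> \bar R) :
  measurable_fun setT F -> (forall p, 0 <= F p) ->
  \int[P]_t F (source1 t, source2 t) = \int[P]_u \int[P]_t F (source1 t, source2 u).
Proof.
move=> mF F0.
have mG : measurable_fun setT (fun p : I1 * (I2 * E) => F (p.1, p.2.1)).
  by apply: (measurableT_comp mF); mfun.
rewrite [LHS](@integral_sources _ _ _ _ _ true _ mG (fun=> F0 _)).
apply: eq_integral => u _; apply: eq_integral => t _.
rewrite /= ge0_integralZr//; first by rewrite integral_gaussd mul1e.
- by apply/measurable_EFinP; mfun.
- by move=> z _; rewrite lee_fin gaussd_ge0.
Qed.

(** On [P \x P] the first coordinate supplies source 2 and the second supplies source 1, in
    accordance with [integral_sources]; the signal and the decision may depend on both. *)
Lemma code_point_to_point (b : bool) (x : I1 * I2 -> E) (D : (I1 * I2) * E -> R) (r : R) :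
  measurable_fun setT x -> measurable_fun setT D -> (forall p, 0 <= D p)%R ->
  (forall y, \int[P]_u \int[P]_t (D ((source1 t, source2 u), y))%:E <= 1) ->
  (1 <= r)%R ->
  \int[P]_t (sqnorm (x (source1 t, source2 t)))%:E <= (N%:R * (r ^+ 2 - 1))%:E ->
  \int[P]_t (ln (1 + D ((source1 t, source2 t),
     (x (source1 t, source2 t) + noises b t)%R)))%:E <= (N%:R * ln r + 2)%:E.
Proof.
move=> mx mD D0 D1 r1 pw.
pose T := (sample c * sample c)%type.
pose m : probability T R := P \x P.
pose p (q : T) := (source1 q.2, source2 q.1).
have mp : measurable_fun setT p.
  by apply: measurable_fun_pair; apply: measurableT_comp => //; exact: measurable_snd.
have mD' : measurable_fun setT (fun q : T * E => D (p q.1, q.2)).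
  by apply: (measurableT_comp mD); apply: measurable_fun_pair; mfun.
have mx' : measurable_fun setT (x \o p) by exact: measurableT_comp.
have lnD q : (0 <= ln (1 + D q))%R by rewrite ln_ge0// lerDl.
have tonelli (f : T -> \bar R) : measurable_fun setT f -> (forall q, 0 <= f q) ->
    \int[m]_q f q = \int[P]_u \int[P]_t f (u, t).
  by move=> mf f0; exact: fubini_tonelli1.
pose F (q : I1 * (I2 * E)) := (ln (1 + D ((q.1, q.2.1), (x (q.1, q.2.1) + q.2.2)%R)))%:E.
have mF : measurable_fun setT F.
  by rewrite /F; mfun.
have F0 q : 0 <= F q by rewrite lee_fin.
rewrite (integral_sources b mF F0).
pose f q := \int[leb R N]_z (gaussd 1 z * ln (1 + D (p q, (x (p q) + z)%R)))%:E.
have mf : measurable_fun setT f.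
  apply: (measurable_fun_fubini_tonelli_F (m2 := leb R N) (fun q : T * E =>
    (gaussd 1 q.2 * ln (1 + D (p q.1, (x (p q.1) + q.2)%R)))%:E)).
    have mpq : measurable_fun setT (fun q : T * E => p q.1) by mfun.
    by mfun.
  by move=> q; rewrite lee_fin mulr_ge0// gaussd_ge0.
have f0 q : 0 <= f q.
  by apply: integral_ge0 => z _; rewrite lee_fin mulr_ge0// gaussd_ge0.
have -> : \int[P]_u \int[P]_t \int[leb R N]_z
    ((gaussd 1 z)%:E * F (source1 t, (source2 u, z))) = \int[m]_q f q.
  by rewrite [RHS](tonelli f mf f0).
apply: (@point_to_point_bound R N _ T m (x \o p) (fun q => D (p q.1, q.2)) r mx' mD') => //.
- move=> y; apply: le_trans (D1 y).
  rewrite [leLHS](tonelli (fun q => (D (p q, y))%:E))//.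
    by have mpy := measurable_fun_pair mp (@measurable_cst _ _ _ _ setT y); mfun.
  by move=> q; rewrite lee_fin.
- apply: le_trans pw.
  rewrite [leLHS](tonelli (fun q => (sqnorm (x (p q)))%:E)).
  + rewrite [leRHS](@integral_inputs (fun q => (sqnorm (x q))%:E))//.
    * by mfun.
    * by move=> q; rewrite lee_fin sqnorm_ge0.
  + by mfun.
  + by move=> q; rewrite lee_fin sqnorm_ge0.
Qed.
End codes.

Section rates.
Context (R : realType) (M1 M2 N : nat) (c : zic_code R M1 M2 N).
Variables (hd hc pw cg : R).
Hypotheses (M10 : (0 < M1)%N) (M20 : (0 < M2)%N) (pw0 : 0 < pw).
Hypothesis constraints : meets_constraints c pw cg.
Local Open Scope ereal_scope.
Notation P := (prob c).
Notation E := (N.-tuple R).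
Notation I1 := (nat * local1_space c)%type.
Notation I2 := (nat * local2_space c)%type.
Notation S := (hd ^+ 2 * pw)%R.

Let ms1 := @measurable_source1 R M1 M2 N c.
Let ms2 := @measurable_source2 R M1 M2 N c.

Lemma measurable_enc1 d (T : measurableType d) (w : T -> nat) (v : T -> N.-tuple nat)
    (q : T -> local1_space c) :
  measurable_fun setT w -> measurable_fun setT v -> measurable_fun setT q ->
  measurable_fun setT (fun t => enc1 c (w t, v t, q t)).
Proof.
move=> mw mv mq; apply: measurableT_comp => //.
by apply: measurable_fun_pair => //; exact: measurable_fun_pair.
Qed.

Lemma Y1E t : Y1 (c := c) hd hc t =
  (scalet hd (X1 t) + noises true t + scalet hc (X2 t))%R.
Proof.
apply: eq_from_tnth => k; rewrite !tnthD !tnthZ !tnth_mktuple /noise.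
by rewrite addrAC.
Qed.

Lemma Y2E t : Y2 (c := c) hd t = (scalet hd (X2 t) + noises false t)%R.
Proof.
by apply: eq_from_tnth => k; rewrite !tnthD !tnthZ !tnth_mktuple /noise.
Qed.

Lemma integral_sqnorm_le (X : sample c -> E) : measurable_fun setT X ->
  (forall k, 'E_P[fun t => (`|tnth (X t) k| ^+ 2)%R] <= pw%:E) ->
  \int[P]_t (sqnorm (scalet hd (X t)))%:E <= (N%:R * S)%:E.
Proof.
move=> mX power.
have mXk k : measurable_fun setT (fun t => tnth (X t) k).
  exact: (measurableT_comp (measurable_tnth k) mX).
have sE t : (sqnorm (scalet hd (X t)))%:E =
    \sum_(k <- enum 'I_N) (hd ^+ 2 * (`|tnth (X t) k| ^+ 2))%:E.
  rewrite sumEFin big_enum/=; congr EFin; apply: eq_bigr => k _.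
  by rewrite tnthZ exprMn real_normK ?num_real.
under eq_integral do rewrite sE.
have hd0 : (0 <= hd ^+ 2)%R by exact: sqr_ge0.
rewrite ge0_integral_sum//; last 2 first.
- by move=> k; apply/measurable_EFinP; apply: measurable_funM => //;
    apply: measurable_funX; apply: measurableT_comp.
- by move=> k t _; rewrite lee_fin mulr_ge0// sqr_ge0.
rewrite big_enum/=.
apply: (@le_trans _ _ (\sum_(k < N) (hd ^+ 2 * pw)%:E)); last first.
  by rewrite sumEFin sumr_const card_ord mulr_natl.
apply: lee_sum => k _.
rewrite ge0_integral_scale//; last first.
  by apply: measurable_funX; apply: measurableT_comp.
rewrite [leRHS]EFinM; apply: lee_wpmul2l; first by rewrite lee_fin.
by have := power k; rewrite unlock.
Qed.

Let lnr : ln (Num.sqrt (1 + S)) = (ln (1 + S) / 2)%R.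
Proof.
have S0 : (0 <= S)%R by rewrite mulr_ge0 ?sqr_ge0// ltW.
have r0 : (0 < Num.sqrt (1 + S))%R by rewrite sqrtr_gt0; lra.
have := sqr_sqrtr (a := 1 + S); rewrite addr_ge0// => /(_ isT) {2}<-.
by rewrite expr2 lnM ?posrE//; field.
Qed.

Let r1 : (1 <= Num.sqrt (1 + S))%R.
Proof. by rewrite -[leLHS]sqrtr1 ler_sqrt ?lerDl ?addr_ge0// mulr_ge0 ?sqr_ge0// ltW. Qed.

Let power_r (X : sample c -> E) : measurable_fun setT X ->
  (forall k, 'E_P[fun t => (`|tnth (X t) k| ^+ 2)%R] <= pw%:E) ->
  \int[P]_t (sqnorm (scalet hd (X t)))%:E <=
    (N%:R * (Num.sqrt (1 + S) ^+ 2 - 1))%:E.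
Proof.
move=> mX power; have S0 : (0 <= S)%R by rewrite mulr_ge0 ?sqr_ge0// ltW.
rewrite sqr_sqrtr; last lra.
rewrite (_ : (1 + S - 1 = S)%R); last lra.
exact: integral_sqnorm_le.
Qed.

Let mW1 : measurable_fun setT (W1 c). Proof. by []. Qed.
Let mW2 : measurable_fun setT (W2 c). Proof. by []. Qed.
Let mdec1 : measurable_fun setT (dec1 c). Proof. by []. Qed.
Let mdec2 : measurable_fun setT (dec2 c). Proof. by []. Qed.
Let menc2 : measurable_fun setT (enc2 c). Proof. by []. Qed.
Let mcoop : measurable_fun setT (coop c). Proof. by []. Qed.
Let mY1 : measurable_fun setT (Y1 (c := c) hd hc). Proof. exact: measurable_Y1. Qed.
Lemma measurable_Y2 : measurable_fun setT (Y2 (c := c) hd).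
Proof.
have mX2 := @measurable_X2 R M1 M2 N c; have mn := @measurable_noises R M1 M2 N c false.
by rewrite (_ : Y2 hd = fun t => scalet hd (X2 t) + noises false t)%R; [mfun|apply/funext => t; rewrite Y2E].
Qed.

Let mY2 := measurable_Y2.

Lemma rate1_le : ((1 - fine (error1 c hd hc)) * ln M1%:R)%:E <=
  (N%:R * (ln (1 + S) / 2) + 2)%:E.
Proof.
have mf : measurable_fun setT (fun t : sample c => dec1 c (Y1 hd hc t)) by mfun.
apply: le_trans (decoding_ln_le P M10 mf mW1) _.
pose x (q : I1 * I2) : E := scalet hd (enc1 c (q.1.1, coop c q.2, q.1.2)).
(* A genie gives source 2 to receiver 1: the interference is added back inside the decision
   function, and the channel becomes point to point with input [hd x1]. *)
pose k (q : (I1 * I2) * E) := dec1 c (q.2 + scalet hc (enc2 c q.1.2))%R.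
have mx : measurable_fun setT x.
  by apply: measurable_scalet; apply: measurable_enc1; mfun.
have mk : measurable_fun setT k by rewrite /k; mfun.
pose D (q : (I1 * I2) * E) : R := (M1%:R * (k q == q.1.1.1)%:R)%R.
have mD : measurable_fun setT D.
  by apply: measurable_funM => //; apply: measurable_eqn_indic; mfun.
have D0 q : (0 <= D q)%R by rewrite mulr_ge0.
rewrite -lnr.
apply: le_trans (code_point_to_point true mx mD D0 _ r1 _).
- rewrite le_eqVlt; apply/orP; left; apply/eqP; apply: eq_integral => t _.
  by rewrite /D /k /x /= Y1E.
- move=> y.
  have -> : 1 = \int[P]_u 1.
    by rewrite (integral_cst P measurableT) [X in _ * X]probability_setT mule1.
  apply: ge0_le_integral => //.
  + by move=> u _; apply: integral_ge0 => t _; rewrite lee_fin.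
  + apply: (measurable_fun_fubini_tonelli_F (m2 := P) (fun q : sample c * sample c =>
      (D ((source1 q.2, source2 q.1), y))%:E)); last by move=> q; rewrite lee_fin.
    by mfun.
  + by move=> u _; exact: (integral_uniform_le1 M10 (@W1_uniform _ _ _ _ c)
      (dec1 c (y + scalet hc (enc2 c (source2 u)))%R)).
- by case: constraints => _ h _; apply: power_r => //; exact: measurable_X1.
Qed.

Lemma rate2_le : ((1 - fine (error2 c hd)) * ln M2%:R)%:E <=
  (N%:R * (ln (1 + S) / 2) + 2)%:E.
Proof.
have mf : measurable_fun setT (fun t : sample c => dec2 c (Y2 hd t)) by mfun.
apply: le_trans (decoding_ln_le P M20 mf mW2) _.
pose x (q : I1 * I2) : E := scalet hd (enc2 c q.2).
have mx : measurable_fun setT x by apply: measurable_scalet; mfun.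
pose D (q : (I1 * I2) * E) : R := (M2%:R * (dec2 c q.2 == q.1.2.1)%:R)%R.
have mD : measurable_fun setT D.
  by apply: measurable_funM => //; apply: measurable_eqn_indic; mfun.
have D0 q : (0 <= D q)%R by rewrite mulr_ge0.
rewrite -lnr.
apply: le_trans (code_point_to_point false mx mD D0 _ r1 _).
- rewrite le_eqVlt; apply/orP; left; apply/eqP; apply: eq_integral => t _.
  by rewrite /D /x /= Y2E.
- move=> y; apply: le_trans (integral_uniform_le1 M20 (@W2_uniform _ _ _ _ c) (dec2 c y)).
  rewrite le_eqVlt; apply/orP; left; apply/eqP; apply: eq_integral => t _.
  transitivity (\int[P]_x cst (M2%:R * (dec2 c y == W2 c t)%:R)%:E x) => //.
  by rewrite (integral_cst P measurableT) [X in _ * X]probability_setT mule1.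
- by case: constraints => _ _ h; apply: power_r => //; exact: measurable_X2.
Qed.
End rates.

(** * The sum-rate inequality *)

(** Numbering the values by [pickle] gives a countable partition; numbers that code no value give
    empty sets and contribute 0. *)
Lemma ge0_integral_fibers d (T : measurableType d) (R : realType)
    (m : {measure set T -> \bar R}) (A : countType) (V : T -> A) (f : T -> \bar R) :
  (forall a, measurable (V @^-1` [set a])) -> measurable_fun setT f ->
  (forall x, 0 <= f x)%E ->
  (\int[m]_x f x = \esum_(a in [set: A]) \int[m]_(x in V @^-1` [set a]) f x)%E.
Proof.
move=> mV mf f0; pose F n := [set x | pickle (V x) = n].
have Fpickle a : F (pickle a) = V @^-1` [set a].
  by apply/seteqP; split => x /=; [exact: (pcan_inj (@pickleK A))|by rewrite /F /= => ->].
have F0 n : ~ range (@pickle A) n -> F n = set0.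
  move=> nr; apply/seteqP; split => x //= Fx; apply: nr.
  by exists (V x).
have mF n : measurable (F n).
  have [[a _ <-]|/F0 ->] := pselect (range (@pickle A) n); last exact: measurable0.
  by rewrite Fpickle.
have int0 D : (0 <= \int[m]_(x in D) f x)%E by exact: integral_ge0.
have FT : \bigcup_n F n = setT.
  by apply/seteqP; split => x // _; exists (pickle (V x)).
have tF : trivIset [set: nat] F by move=> i j _ _ [x [/= <- <-]].
rewrite -[in LHS]FT ge0_integral_bigcup ?FT//.
rewrite nneseries_esumT// (esumID (range (@pickle A)))// !setTI.
rewrite [X in (_ + X)%E]esum1 => [|n /F0 ->]; last by rewrite integral_set0.
rewrite adde0 (@esum_image R _ _ setT (@pickle A) (fun n => \int[m]_(x in F n) f x)%E); last first.
  by move=> a b _ _; exact: (pcan_inj (@pickleK A)).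
by apply: eq_esum => a _; rewrite Fpickle.
Qed.

Section side_information.
Context (R : realType) (n : nat).
Notation E := (n.-tuple R).
Notation lam := (leb R n).
Context d1 d2 (T1 : measurableType d1) (T2 : measurableType d2).
Variables (m1 : probability T1 R) (m2 : probability T2 R) (A : countType).
Variables (V : T2 -> A) (s1 : A -> T1 -> E) (s2 : T2 -> E) (w2 : T2 -> nat).
Hypotheses (mV : forall a, measurable (V @^-1` [set a]))
  (ms1 : forall a, measurable_fun setT (s1 a))
  (ms1V : measurable_fun setT (fun q : T2 * T1 => s1 (V q.1) q.2))
  (ms2 : measurable_fun setT s2) (mw2 : measurable_fun setT w2).
Variables (s tau g : R).
Hypotheses (s0 : 0 < s) (tau0 : 0 < tau).
Hypothesis gst : g ^+ 2 * s ^+ 2 + tau ^+ 2 = 1.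
Variables (D1 : T1 * E -> R) (D2 e : nat * E -> R).
Hypotheses (mD1 : measurable_fun setT D1) (mD2 : measurable_fun setT D2)
  (me : measurable_fun setT e).
Hypotheses (D10 : forall p, 0 <= D1 p) (D20 : forall p, 0 <= D2 p)
  (e0 : forall p, 0 < e p).
Variables (mY : probability E R) (pW : probability nat R).
Hypothesis D1_le1 : forall y, (\int[m1]_t (D1 (t, y))%:E <= 1)%E.
Hypothesis D2_le1 : forall y, (\int[pW]_w (D2 (w, y))%:E <= 1)%E.
Hypothesis HE : forall H : nat * E -> \bar R, measurable_fun setT H ->
  (forall p, 0 <= H p)%E ->
  (\int[m2]_u \int[m1]_t \int[lam]_z ((gaussd 1 z)%:E *
      ((e (w2 u, s1 (V u) t + z + scalet g (s2 u))%R)%:E *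
        H (w2 u, s1 (V u) t + z + scalet g (s2 u))%R)) <=
   \int[mY]_y \int[pW]_w H (w, y))%E.
Variables (sB sq a : R).
Hypotheses (sB0 : 0 < sB) (sq0 : 0 < sq).
Hypothesis L0 : 0 <= ln sB + ln sq - ln s - ln tau.

Let max0 (x : R) : 0 <= Num.max 0 x. Proof. by rewrite le_max lexx. Qed.
Let lnD (x : R) : 0 <= x -> 0 <= ln (1 + x).
Proof. by move=> x0; rewrite ln_ge0// lerDl. Qed.

(** The signal [sg] is a parameter because it occurs in two versions, with the actual value [V u]
    and with a constant value v, which agree on the fibre of v. *)
Let noisy (G : (T2 * T1) * E -> \bar R) (sg : T2 -> T1 -> E) u :=
  (\int[m1]_t \int[lam]_z
     ((gaussd 1 z)%:E * G ((u, t), sg u t + z + scalet g (s2 u))%R))%E.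

Let noisy_ge0 (G : (T2 * T1) * E -> \bar R) sg u :
  (forall q, 0 <= G q)%E -> (0 <= noisy G sg u)%E.
Proof.
move=> G0; do 2 apply: integral_ge0 => ? _.
by rewrite mule_ge0 ?lee_fin ?gaussd_ge0.
Qed.

Let measurable_noisy (G : (T2 * T1) * E -> \bar R) (sg : T2 -> T1 -> E) :
  measurable_fun setT G -> (forall q, 0 <= G q)%E ->
  measurable_fun setT (fun q : T2 * T1 => sg q.1 q.2) ->
  measurable_fun setT (noisy G sg).
Proof.
move=> mG G0 msg.
have msq : measurable_fun setT (fun q : (T2 * T1) * E => sg q.1.1 q.1.2).
  exact: (measurableT_comp msg measurable_fst).
have mF : measurable_fun setT (fun q : T2 * T1 => \int[lam]_z
    ((gaussd 1 z)%:E * G (q, sg q.1 q.2 + z + scalet g (s2 q.1))%R))%E.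
  apply: (measurable_fun_fubini_tonelli_F (m2 := lam) (fun q : (T2 * T1) * E =>
    ((gaussd 1 q.2)%:E * G (q.1, sg q.1.1 q.1.2 + q.2 + scalet g (s2 q.1.1))%R)%E)).
    by mfun.
  by move=> q; rewrite mule_ge0 ?lee_fin ?gaussd_ge0.
apply: (measurable_fun_fubini_tonelli_F (m2 := m1) (fun q : T2 * T1 => \int[lam]_z
    ((gaussd 1 z)%:E * G (q, sg q.1 q.2 + z + scalet g (s2 q.1))%R))%E) => //.
by move=> q; apply: integral_ge0 => z _; rewrite mule_ge0 ?lee_fin ?gaussd_ge0.
Qed.

Let G1 (q : (T2 * T1) * E) := (ln (1 + D1 (q.1.2, q.2)))%:E.
Let G2 (q : (T2 * T1) * E) := (Num.max 0 (ln (e (w2 q.1.1, q.2))))%:E.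
Let G3 (q : (T2 * T1) * E) := (Num.max 0 (- ln (e (w2 q.1.1, q.2))))%:E.

Let mG1 : measurable_fun setT G1. Proof. by rewrite /G1; mfun. Qed.
Let mG2 : measurable_fun setT G2. Proof. by rewrite /G2; mfun. Qed.
Let mG3 : measurable_fun setT G3. Proof. by rewrite /G3; mfun. Qed.
Let G10 q : (0 <= G1 q)%E. Proof. by rewrite lee_fin lnD. Qed.
Let G20 q : (0 <= G2 q)%E. Proof. by rewrite lee_fin. Qed.
Let G30 q : (0 <= G3 q)%E. Proof. by rewrite lee_fin. Qed.

Let A2 u := (\int[lam]_z (gaussd s z * ln (1 + D2 (w2 u, s2 u + z)))%:E)%E.
Let B2 (sg : T2 -> T1 -> E) u :=
  (\int[m1]_t ((sqnorm (sg u t) + n%:R) / (2 * sB ^+ 2))%:E)%E.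
Let B3 u := (((1 - a * g) ^+ 2 * (sqnorm (s2 u) + n%:R * s ^+ 2) +
     n%:R * (a ^+ 2 * tau ^+ 2)) / (2 * sq ^+ 2)).

Let mA2 : measurable_fun setT A2.
Proof.
apply: (measurable_fun_fubini_tonelli_F (m2 := lam)
  (fun q : T2 * E => (gaussd s q.2 * ln (1 + D2 (w2 q.1, s2 q.1 + q.2)))%:E)).
  by mfun.
by move=> q; rewrite lee_fin mulr_ge0 ?gaussd_ge0 ?lnD.
Qed.

Let mB2 (sg : T2 -> T1 -> E) : measurable_fun setT (fun q : T2 * T1 => sg q.1 q.2) ->
  measurable_fun setT (B2 sg).
Proof.
move=> msg; apply: (measurable_fun_fubini_tonelli_F (m2 := m1)
  (fun q : T2 * T1 => ((sqnorm (sg q.1 q.2) + n%:R) / (2 * sB ^+ 2))%:E)).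
  by mfun.
by move=> q; rewrite lee_fin divr_ge0 ?addr_ge0 ?sqnorm_ge0// mulr_ge0 ?sqr_ge0.
Qed.

Let mB3 : measurable_fun setT (fun u => (B3 u)%:E).
Proof. by rewrite /B3; mfun. Qed.

Let A20 u : (0 <= A2 u)%E.
Proof. by apply: integral_ge0 => z _; rewrite lee_fin mulr_ge0 ?gaussd_ge0 ?lnD. Qed.

Let B20 sg u : (0 <= B2 sg u)%E.
Proof.
apply: integral_ge0 => t _.
by rewrite lee_fin divr_ge0 ?addr_ge0 ?sqnorm_ge0// mulr_ge0 ?sqr_ge0.
Qed.

Let B30 u : (0 <= (B3 u)%:E)%E.
Proof.
rewrite lee_fin; apply: divr_ge0; last by apply: mulr_ge0; rewrite ?sqr_ge0.
apply: addr_ge0; apply: mulr_ge0; rewrite ?sqr_ge0//.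
  by apply: addr_ge0; [exact: sqnorm_ge0|apply: mulr_ge0; rewrite ?sqr_ge0].
by apply: mulr_ge0; exact: sqr_ge0.
Qed.

Notation sV := (fun u t => s1 (V u) t).

Let pr v := fine (m2 (V @^-1` [set v])).

Let prE v : (pr v)%:E = m2 (V @^-1` [set v]).
Proof. by rewrite fineK// fin_num_measure. Qed.

Let pr0 v : 0 <= pr v. Proof. exact: fine_ge0. Qed.

Let pr1 v : pr v <= 1.
Proof. by rewrite -lee_fin prE probability_le1. Qed.

(** [core_inequality] for the law of source 2 restricted to [V = v]. The term [- ln pi2] of its
    constant, weighted by the mass of the fibre, becomes one summand of the entropy of [V]. *)
Let fiber_inequality v :
  (\int[m2]_(u in V @^-1` [set v]) noisy G1 sV u +
   \int[m2]_(u in V @^-1` [set v]) A2 u +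
   \int[m2]_(u in V @^-1` [set v]) noisy G2 sV u + (n%:R * pr v)%:E <=
   \int[m2]_(u in V @^-1` [set v]) noisy G3 sV u +
   \int[m2]_(u in V @^-1` [set v]) B2 sV u +
   \int[m2]_(u in V @^-1` [set v]) (B3 u)%:E +
   ((6 + n%:R * (ln sB + ln sq - ln s - ln tau)) * pr v)%:E +
   (- (pr v * ln (pr v)))%:E)%E.
Proof.
set D := V @^-1` [set v]; have mD : measurable D by exact: mV.
(* On a null fibre all integrals vanish, and so does every term with the factor [pr v]. *)
have [p0|p0] := eqVneq (pr v) 0.
  have m20 : m2 D = 0%E by rewrite -prE p0.
  have null f : measurable_fun setT f -> (forall u, 0 <= f u)%E ->
      (\int[m2]_(u in D) f u = 0)%E.
    move=> mf f0; rewrite (ge0_negligible_integral mD)// ?setDv ?integral_set0//.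
    exact: measurable_funTS.
  have aux (x1 x2 x3 y1 y2 y3 : \bar R) : x1 = 0%E -> x2 = 0%E -> x3 = 0%E ->
      y1 = 0%E -> y2 = 0%E -> y3 = 0%E ->
      (x1 + x2 + x3 + (n%:R * pr v)%:E <= y1 + y2 + y3 +
        ((6 + n%:R * (ln sB + ln sq - ln s - ln tau)) * pr v)%:E +
        (- (pr v * ln (pr v)))%:E)%E.
    by move=> -> -> -> -> -> ->; rewrite p0 !(mulr0, mul0r) oppr0 !adde0.
  apply: aux.
  - exact: null (measurable_noisy mG1 G10 ms1V) (fun u => noisy_ge0 sV u G10).
  - exact: null mA2 A20.
  - exact: null (measurable_noisy mG2 G20 ms1V) (fun u => noisy_ge0 sV u G20).
  - exact: null (measurable_noisy mG3 G30 ms1V) (fun u => noisy_ge0 sV u G30).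
  - exact: null (mB2 ms1V) (B20 sV).
  - exact: null mB3 B30.
have {}p0 : 0 < pr v by rewrite lt_neqAle eq_sym p0 pr0.
have m2D : (m2 D < +oo)%E by rewrite -prE ltry.
pose m2' : {finite_measure set T2 -> \bar R} := mfrestr mD m2D.
have m2'E f : measurable_fun setT f -> (forall u, 0 <= f u)%E ->
    (\int[m2']_u f u = \int[m2]_(u in D) f u)%E.
  by move=> mf f0; exact: integral_mfrestr.
have m2'T : m2' setT = (pr v)%:E.
  by rewrite /= /mfrestr /mrestr setTI -prE.
have m2'C f f' : measurable_fun setT f -> (forall u, 0 <= f u)%E ->
    (forall u, V u = v -> f u = f' u) ->
    (\int[m2']_u f u = \int[m2]_(u in D) f' u)%E.
  move=> mf f0 ff'; rewrite m2'E//; apply: eq_integral => u.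
  by rewrite inE => /ff'.
pose sv (u : T2) t := s1 v t.
have msv : measurable_fun setT (fun q : T2 * T1 => sv q.1 q.2).
  exact: (measurableT_comp (ms1 v) measurable_snd).
have K0 : 0 <= n%:R * (ln sB + ln sq - ln s - ln tau) - ln (pr v).
  have : ln (pr v) <= 0 by exact: ln_le0.
  by have := mulr_ge0 (ler0n R n) L0; lra.
have noisyD G : measurable_fun setT G -> (forall q, 0 <= G q)%E ->
    (\int[m2']_u noisy G sv u = \int[m2]_(u in D) noisy G sV u)%E.
  move=> mG G0; apply: m2'C.
  - exact: measurable_noisy mG G0 msv.
  - by move=> u; exact: noisy_ge0.
  - by move=> u Vu; rewrite /noisy /sv -Vu.
have I1 := noisyD _ mG1 G10; have I2 := noisyD _ mG2 G20; have I3 := noisyD _ mG3 G30.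
have I4 : (\int[m2']_u B2 sv u = \int[m2]_(u in D) B2 sV u)%E.
  apply: m2'C; [exact: mB2|exact: B20|by move=> u Vu; rewrite /B2 /sv -Vu].
have I5 := m2'E _ mA2 A20; have I6 := m2'E _ mB3 B30.
have HE' (H : nat * E -> \bar R) : measurable_fun setT H -> (forall p, 0 <= H p)%E ->
    (\int[m2']_u \int[m1]_t \int[lam]_z ((gaussd 1 z)%:E *
      ((e (w2 u, s1 v t + z + scalet g (s2 u))%R)%:E *
        H (w2 u, s1 v t + z + scalet g (s2 u))%R)) <=
   \int[mY]_y \int[pW]_w H (w, y))%E.
  move=> mH H0; apply: le_trans (HE mH H0).
  pose GH (q : (T2 * T1) * E) := ((e (w2 q.1.1, q.2))%:E * H (w2 q.1.1, q.2))%E.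
  have mGH : measurable_fun setT GH by rewrite /GH; mfun.
  have GH0 q : (0 <= GH q)%E by rewrite mule_ge0// lee_fin ltW.
  have -> := noisyD GH mGH GH0.
  (* The fibre carries part of the law of source 2, so its integral is at most the full one. *)
  apply: ge0_subset_integral => //; first exact: measurable_noisy mGH GH0 ms1V.
  by move=> u _; exact: noisy_ge0.
have core := @core_inequality R n _ _ T1 T2 m1 m2' (s1 v) s2 w2 (ms1 v) ms2 mw2
  s tau g (pr v) s0 tau0 gst p0 m2'T D1 D2 e mD1 mD2 me D10 D20 e0 mY pW D1_le1
  D2_le1 HE' sB sq a sB0 sq0 K0.
have aux (x1 x2 x3 y1 y2 y3 x1' x2' x3' y1' y2' y3' : \bar R) k :
    x1 = x1' -> x3 = x3' -> y1 = y1' -> y2 = y2' -> x2 = x2' -> y3 = y3' ->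
    (x1 + x2 + x3 + (pr v * n%:R)%:E <=
      (6 * pr v)%:E + y1 + y2 + y3 + (pr v * (k - ln (pr v)))%:E)%E ->
    (x1' + x2' + x3' + (n%:R * pr v)%:E <= y1' + y2' + y3' + ((6 + k) * pr v)%:E +
      (- (pr v * ln (pr v)))%:E)%E.
  move=> <- <- <- <- <- <-; rewrite [in (n%:R * _)%R]mulrC => /le_trans; apply.
  rewrite -[leRHS]addeA -EFinD -!addeA addeC -!addeA -EFinD.
  by do 3 apply: leeD2l; rewrite lee_fin; lra.
by apply: (aux _ _ _ _ _ _ _ _ _ _ _ _ _ I1 I2 I3 I4 I5 I6); exact: core.
Qed.

(** The sum of [fiber_inequality] over all values. The constant is proportional to the mass of the
    fibre, so it survives once and not once per value. *)
Lemma side_information_inequality :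
  (\int[m2]_u \int[m1]_t \int[lam]_z
     (gaussd 1 z * ln (1 + D1 (t, s1 (V u) t + z + scalet g (s2 u))))%:E +
   \int[m2]_u \int[lam]_z (gaussd s z * ln (1 + D2 (w2 u, s2 u + z)))%:E +
   \int[m2]_u \int[m1]_t \int[lam]_z
     (gaussd 1 z * Num.max 0 (ln (e (w2 u, s1 (V u) t + z + scalet g (s2 u)))))%:E +
   n%:R%:E <=
   \int[m2]_u \int[m1]_t \int[lam]_z
     (gaussd 1 z * Num.max 0 (- ln (e (w2 u, s1 (V u) t + z + scalet g (s2 u)))))%:E +
   \int[m2]_u \int[m1]_t ((sqnorm (s1 (V u) t) + n%:R) / (2 * sB ^+ 2))%:E +
   \int[m2]_u (((1 - a * g) ^+ 2 * (sqnorm (s2 u) + n%:R * s ^+ 2) +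
     n%:R * (a ^+ 2 * tau ^+ 2)) / (2 * sq ^+ 2))%:E +
   (6 + n%:R * (ln sB + ln sq - ln s - ln tau))%:E +
   \esum_(v in [set: A])
     (- (fine (m2 (V @^-1` [set v])) * ln (fine (m2 (V @^-1` [set v])))))%:E)%E.
Proof.
have fib f : measurable_fun setT f -> (forall u, 0 <= f u)%E ->
    (\int[m2]_u f u = \esum_(v in [set: A]) \int[m2]_(u in V @^-1` [set v]) f u)%E.
  by move=> mf f0; exact: ge0_integral_fibers.
have mass k : 0 <= k -> (\esum_(v in [set: A]) (k * pr v)%:E = k%:E)%E.
  move=> k0; transitivity (\int[m2]_u (cst k%:E u))%E; last first.
    by rewrite (integral_cst m2 measurableT) [X in (_ * X)%E]probability_setT mule1.
  rewrite fib//; apply: eq_esum => v _.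
  by rewrite integral_cst// EFinM prE.
have h0 v : (0 <= (- (pr v * ln (pr v)))%:E)%E.
  by rewrite lee_fin oppr_ge0 mulr_ge0_le0// ln_le0.
have int0 f v : (forall u, 0 <= f u)%E -> (0 <= \int[m2]_(u in V @^-1` [set v]) f u)%E.
  by move=> f0; exact: integral_ge0.
set K := 6 + n%:R * (ln sB + ln sq - ln s - ln tau).
have K0 : 0 <= K by rewrite addr_ge0// mulr_ge0.
have kp0 k v : 0 <= k -> (0 <= (k * pr v)%:E)%E by move=> k0; rewrite lee_fin mulr_ge0.
have e1 := fib _ (measurable_noisy mG1 G10 ms1V) (fun u => noisy_ge0 sV u G10).
have e2 := fib _ mA2 A20.
have e3 := fib _ (measurable_noisy mG2 G20 ms1V) (fun u => noisy_ge0 sV u G20).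
have e4 := fib _ (measurable_noisy mG3 G30 ms1V) (fun u => noisy_ge0 sV u G30).
have e5 := fib _ (mB2 ms1V) (B20 sV).
have e6 := fib _ mB3 B30.
have p1 v := int0 _ v (fun u => noisy_ge0 sV u G10).
have p2 v := int0 _ v A20.
have p3 v := int0 _ v (fun u => noisy_ge0 sV u G20).
have p4 v := int0 _ v (fun u => noisy_ge0 sV u G30).
have p5 v := int0 _ v (B20 sV).
have p6 v := int0 _ v B30.
have aux (x1 x2 x3 y1 y2 y3 : \bar R) (f1 f2 f3 g1 g2 g3 : A -> \bar R) :
    x1 = \esum_(v in [set: A]) f1 v -> x2 = \esum_(v in [set: A]) f2 v ->
    x3 = \esum_(v in [set: A]) f3 v -> y1 = \esum_(v in [set: A]) g1 v ->
    y2 = \esum_(v in [set: A]) g2 v -> y3 = \esum_(v in [set: A]) g3 v ->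
    (forall v, 0 <= f1 v)%E -> (forall v, 0 <= f2 v)%E -> (forall v, 0 <= f3 v)%E ->
    (forall v, 0 <= g1 v)%E -> (forall v, 0 <= g2 v)%E -> (forall v, 0 <= g3 v)%E ->
    (forall v, f1 v + f2 v + f3 v + (n%:R * pr v)%:E <=
      g1 v + g2 v + g3 v + (K * pr v)%:E + (- (pr v * ln (pr v)))%:E)%E ->
    (x1 + x2 + x3 + n%:R%:E <= y1 + y2 + y3 + K%:E +
      \esum_(v in [set: A]) (- (pr v * ln (pr v)))%:E)%E.
  move=> -> -> -> -> -> -> f10 f20 f30 g10 g20 g30 H.
  rewrite -(mass n%:R)// -(mass K)//.
  rewrite -!esumD//; first by apply: le_esum => v _; exact: H.
  all: try by move=> *; repeat apply: adde_ge0; first [done|exact: kp0].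
exact: (aux _ _ _ _ _ _ _ _ _ _ _ _ e1 e2 e3 e4 e5 e6 p1 p2 p3 p4 p5 p6 fiber_inequality).
Qed.

End side_information.

Lemma ge0_integral_affine_le d (T : measurableType d) (R : realType)
    (P : probability T R) (f : T -> R) (al be C : R) :
  measurable_fun setT f -> (forall t, 0 <= f t) -> 0 <= al -> 0 <= be ->
  (\int[P]_t (f t)%:E <= C%:E)%E ->
  (\int[P]_t (al * f t + be)%:E <= (al * C + be)%:E)%E.
Proof.
move=> mf f0 al0 be0 fC.
have maf : measurable_fun setT (fun t => al * f t) by mfun.
rewrite (ge0_integral_add _ maf)//; last by move=> t; rewrite mulr_ge0.
rewrite (integral_cst P measurableT be%:E) [X in (_ + _ * X)%E]probability_setT mule1.
rewrite EFinD leeD2r// ge0_integral_scale// EFinM lee_wpmul2l// lee_fin.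
Qed.

Lemma esum_le_scale (R : realType) (A : choiceType) (f : A -> R) (k C : R) :
  0 <= k -> (forall i, 0 <= f i) ->
  (\esum_(i in [set: A]) (f i)%:E <= C%:E)%E ->
  (\esum_(i in [set: A]) (k * f i)%:E <= (k * C)%:E)%E.
Proof.
move=> k0 f0 fC; apply: ge_ereal_sup => _ [X [finX XT] <-].
under eq_fsbigr do rewrite EFinM.
rewrite -ge0_mule_fsumr => [|i]; last by rewrite lee_fin.
rewrite EFinM lee_wpmul2l ?lee_fin//; apply: le_trans fC.
by apply: ereal_sup_ubound; exists X.
Qed.

Lemma measurable_tuple_nat_set1 n (v : n.-tuple nat) : measurable [set v].
Proof.
rewrite (_ : [set v] = \bigcap_(i in [set: 'I_n]) (fun w : n.-tuple nat => tnth w i) @^-1` [set tnth v i]).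
  apply: fin_bigcap_measurable => // i _.
  by rewrite -[X in measurable X]setTI; exact: measurable_tnth.
apply/seteqP; split => w /=; first by move=> ->.
by move=> h; apply: eq_from_tnth => i; exact: h.
Qed.

(* [a] and [sq ^+ 2] are the slope and the error variance of the linear estimate
   of [Y2] (variance [S + s ^+ 2]) from [U = g Y2 + z'] (variance
   [1 + g ^+ 2 * S]), where [z'] has variance [tau ^+ 2]. *)
Lemma test_channel_exists (R : realType) (S g s : R) :
  0 <= S -> g ^+ 2 <= 1 -> 0 < s -> s < 1 ->
  exists r : R * R * (R * R), let: (tau, sB, (sq, a)) := r in
  [/\ 0 < tau, 0 < sB, 0 < sq, g ^+ 2 * s ^+ 2 + tau ^+ 2 = 1 & sB ^+ 2 = 1 + S] /\
  [/\ ln sB + ln sq - ln s - ln tau =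
      ln ((1 + S) * (S + s ^+ 2) / (s ^+ 2 * (1 + g ^+ 2 * S))) / 2,
      0 <= ln sB + ln sq - ln s - ln tau &
      (1 - a * g) ^+ 2 * (S + s ^+ 2) + a ^+ 2 * tau ^+ 2 = sq ^+ 2].
Proof.
move=> S0 g1 s0 s1.
have s20 : 0 < s ^+ 2 by rewrite exprn_gt0.
have s21 : s ^+ 2 < 1 by rewrite expr_lt1// ltW.
have g20 : 0 <= g ^+ 2 by exact: sqr_ge0.
have gs : g ^+ 2 * s ^+ 2 < 1 by apply: le_lt_trans s21; rewrite ler_piMl// ltW.
have gS : 0 <= g ^+ 2 * S by exact: mulr_ge0.
have gSS : g ^+ 2 * S <= S by rewrite ler_piMl.
set tau := Num.sqrt (1 - g ^+ 2 * s ^+ 2).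
set sB := Num.sqrt (1 + S).
set T := S + s ^+ 2; set J := 1 + g ^+ 2 * S.
have T0 : 0 < T by rewrite /T; lra.
have J0 : 0 < J by rewrite /J; lra.
have tau0 : 0 < tau by rewrite sqrtr_gt0; lra.
have tau2 : tau ^+ 2 = 1 - g ^+ 2 * s ^+ 2 by rewrite sqr_sqrtr//; lra.
have sB0 : 0 < sB by rewrite sqrtr_gt0; lra.
have sB2 : sB ^+ 2 = 1 + S by rewrite sqr_sqrtr//; lra.
have TJ0 : 0 < T * tau ^+ 2 / J by rewrite divr_gt0// mulr_gt0// exprn_gt0.
set sq := Num.sqrt (T * tau ^+ 2 / J).
have sq0 : 0 < sq by rewrite sqrtr_gt0.
have sq2 : sq ^+ 2 = T * tau ^+ 2 / J by rewrite sqr_sqrtr// ltW.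
have ln2x (x : R) : 0 < x -> ln (x ^+ 2) = 2 * ln x.
  by move=> x0; rewrite expr2 lnM ?posrE//; ring.
have LE : ln sB + ln sq - ln s - ln tau = ln ((1 + S) * T / (s ^+ 2 * J)) / 2.
  apply: (mulfI (_ : 2 != 0 :> R)); first by rewrite pnatr_eq0.
  rewrite [RHS]mulrC divfK ?pnatr_eq0// mulrBr mulrBr mulrDr -!ln2x// sB2 sq2.
  have S1 : 0 < 1 + S by lra.
  have t20 : 0 < tau ^+ 2 by rewrite exprn_gt0.
  rewrite !ln_div ?posrE ?mulr_gt0// !lnM ?posrE//; lra.
exists (tau, sB, (sq, g * T / J)) => /=; split; first by split => //; lra.
split => //.
  (* The argument of the logarithm is at least 1 because [J <= 1 + S], by [g^2 <= 1], and
     [s^2 <= T]. *)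
  rewrite LE divr_ge0// ln_ge0// ler_pdivlMr ?mulr_gt0// mul1r mulrC.
  by apply: ler_pM; [exact: ltW|exact: ltW|rewrite /J; lra|rewrite /T; lra].
have -> : 1 - g * T / J * g = tau ^+ 2 / J.
  apply: (mulIf (lt0r_neq0 J0)); rewrite divfK ?gt_eqF// mulrBl mul1r.
  rewrite [X in J - X](_ : _ = g ^+ 2 * T); last by field; rewrite gt_eqF.
  by rewrite tau2 /J /T; ring.
rewrite sq2.
rewrite [LHS](_ : _ = T * tau ^+ 2 / J * ((tau ^+ 2 + g ^+ 2 * T) / J)); last first.
  by field; rewrite gt_eqF.
rewrite (_ : tau ^+ 2 + g ^+ 2 * T = J); last by rewrite tau2 /J /T; ring.
by rewrite divff ?gt_eqF// mulr1.
Qed.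

Section sum_rate.
Context (R : realType) (M1 M2 N : nat) (c : zic_code R M1 M2 N).
Variables (hd hc pw cg g s : R).
Hypotheses (M10 : (0 < M1)%N) (M20 : (0 < M2)%N) (pw0 : 0 < pw).
Hypothesis constraints : meets_constraints c pw cg.
Hypotheses (hcE : hc = g * hd) (g1 : g ^+ 2 <= 1) (s0 : 0 < s) (s1 : s < 1).
Local Open Scope ereal_scope.
Notation P := (prob c).
Notation E := (N.-tuple R).
Notation lam := (leb R N).
Notation I1 := (nat * local1_space c)%type.
Notation I2 := (nat * local2_space c)%type.
Notation S := (hd ^+ 2 * pw)%R.

Let ms1 := @measurable_source1 R M1 M2 N c.
Let ms2 := @measurable_source2 R M1 M2 N c.
Let mW1 : measurable_fun setT (W1 c). Proof. by []. Qed.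
Let mW2 : measurable_fun setT (W2 c). Proof. by []. Qed.
Let mdec1 : measurable_fun setT (dec1 c). Proof. by []. Qed.
Let mdec2 : measurable_fun setT (dec2 c). Proof. by []. Qed.
Let menc2 : measurable_fun setT (enc2 c). Proof. by []. Qed.
Let mcoop : measurable_fun setT (coop c). Proof. by []. Qed.
Let mY1 : measurable_fun setT (Y1 (c := c) hd hc). Proof. exact: measurable_Y1. Qed.

Let x1 (v : N.-tuple nat) (a : I1) : E := scalet hd (enc1 c (a.1, v, a.2)).
Let x2 (b : I2) : E := scalet hd (enc2 c b).

Let mx2 : measurable_fun setT x2.
Proof. by apply: measurable_scalet. Qed.

Let mx1 d (T : measurableType d) (v : T -> N.-tuple nat) (a : T -> I1) :
  measurable_fun setT v -> measurable_fun setT a ->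
  measurable_fun setT (fun t => x1 (v t) (a t)).
Proof.
by move=> mv ma; apply: measurable_scalet; apply: measurable_enc1; mfun.
Qed.

Let Y1E' t : Y1 (c := c) hd hc t =
  (x1 (V21 t) (source1 t) + noises true t + scalet g (x2 (source2 t)))%R.
Proof.
rewrite Y1E; congr (_ + _)%R; apply: eq_from_tnth => k.
by rewrite !tnthZ hcE mulrA.
Qed.

(** Translates between expectations under the law of the code and iterated integrals over
    independent sources and a Gaussian block. *)
Let integral_Y1 (G : (I1 * I2) * E -> \bar R) :
  measurable_fun setT G -> (forall q, 0 <= G q) ->
  \int[P]_u \int[P]_t \int[lam]_z ((gaussd 1 z)%:E *
     G ((source1 t, source2 u),
        x1 (V21 u) (source1 t) + z + scalet g (x2 (source2 u)))%R) =
  \int[P]_t G ((source1 t, source2 t), Y1 hd hc t).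
Proof.
move=> mG G0.
pose F (q : I1 * (I2 * E)) :=
  G ((q.1, q.2.1), x1 (coop c q.2.1) q.1 + q.2.2 + scalet g (x2 q.2.1))%R.
have mF : measurable_fun setT F.
  have h : measurable_fun setT (fun q : I1 * (I2 * E) => x1 (coop c q.2.1) q.1).
    by apply: mx1; mfun.
  by rewrite /F; mfun.
have F0 q : 0 <= F q by exact: G0.
apply: etrans (esym (integral_sources true mF F0)) _.
by apply: eq_integral => t _; rewrite Y1E'.
Qed.

Let s3 := Num.sqrt (1 - s ^+ 2).
Let s2lt1 : (s ^+ 2 < 1)%R. Proof. by rewrite expr_lt1// ltW. Qed.
Let s30 : (0 < s3)%R. Proof. by rewrite sqrtr_gt0 subr_gt0. Qed.
Let s3E : (1 ^+ 2 * s ^+ 2 + s3 ^+ 2 = 1)%R.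
Proof. by rewrite sqr_sqrtr ?expr1n ?mul1r ?subrKC// subr_ge0 ltW. Qed.

(* Receiver 2 observes its input through noise of variance [s ^+ 2] only; the
   missing variance is averaged out in the decoder. *)
Let hit w (y : E) : R := ((dec2 c y == w)%:R)%R.
Let soft_e (q : nat * E) := \int[lam]_z (gaussd s3 z * hit q.1 (q.2 + z)%R)%:E.
Let soft (q : nat * E) : R := fine (soft_e q).

Let hit0 w y : (0 <= hit w y)%R. Proof. by rewrite ler0n. Qed.
Let hit1 w y : (hit w y <= 1)%R. Proof. by rewrite /hit lern1; case: eqP. Qed.

Let mhit d (T : measurableType d) (w : T -> nat) (y : T -> E) :
  measurable_fun setT w -> measurable_fun setT y ->
  measurable_fun setT (fun t => hit (w t) (y t)).
Proof. by move=> mw my; apply: measurable_eqn_indic; mfun. Qed.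

Let msoft_e : measurable_fun setT soft_e.
Proof.
apply: (measurable_fun_fubini_tonelli_F (m2 := lam) (fun q : (nat * E) * E =>
  (gaussd s3 q.2 * hit q.1.1 (q.1.2 + q.2)%R)%:E)).
  have h : measurable_fun setT (fun q : (nat * E) * E => hit q.1.1 (q.1.2 + q.2)%R).
    by apply: mhit; mfun.
  by mfun.
by move=> q; rewrite lee_fin mulr_ge0 ?gaussd_ge0.
Qed.

Let soft_e0 q : 0 <= soft_e q.
Proof. by apply: integral_ge0 => z _; rewrite lee_fin mulr_ge0 ?gaussd_ge0. Qed.

Let soft_e1 q : soft_e q <= 1.
Proof.
rewrite -(integral_gaussd s3 N).
have h : measurable_fun setT (fun z : E => hit q.1 (q.2 + z)%R) by apply: mhit; mfun.
apply: ge0_le_integral => //.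
- by move=> z _; rewrite lee_fin mulr_ge0 ?gaussd_ge0.
- by mfun.
- by mfun.
- by move=> z _; rewrite lee_fin ler_piMr// gaussd_ge0.
Qed.

Let softE q : (soft q)%:E = soft_e q.
Proof. by rewrite fineK// ge0_fin_numE// (le_lt_trans (soft_e1 q))// ltry. Qed.

Let soft0 q : (0 <= soft q)%R. Proof. exact: fine_ge0. Qed.
Let soft1 q : (soft q <= 1)%R. Proof. by rewrite -lee_fin softE. Qed.
Let msoft : measurable_fun setT soft. Proof. exact: measurableT_comp. Qed.

Let D1 (q : sample c * E) : R := (M1%:R * (dec1 c q.2 == W1 c q.1)%:R)%R.
Let D2 (q : nat * E) : R := (M2%:R * soft q)%R.

Let mD1 : measurable_fun setT D1.
Proof. by apply: measurable_funM => //; apply: measurable_eqn_indic; mfun. Qed.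
Let mD2 : measurable_fun setT D2. Proof. by rewrite /D2; mfun. Qed.
Let D10 q : (0 <= D1 q)%R. Proof. by rewrite mulr_ge0. Qed.
Let D20 q : (0 <= D2 q)%R. Proof. by rewrite mulr_ge0. Qed.

Let D1_le1 y : \int[P]_t (D1 (t, y))%:E <= 1.
Proof. exact: (integral_uniform_le1 M10 (@W1_uniform _ _ _ _ c) (dec1 c y)). Qed.

(** For each value of the averaged noise the decision is a guess independent of the message, right
    with probability at most [1 / M2]. *)
Let D2_le1 y : \int[distribution P (W2 c)]_w (D2 (w, y))%:E <= 1.
Proof.
have mD2y : measurable_fun setT (fun w => (D2 (w, y))%:E).
  by apply/measurable_EFinP; apply: (measurableT_comp mD2); mfun.
have D2y0 w : 0 <= (D2 (w, y))%:E by rewrite lee_fin.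
rewrite [leLHS](ge0_integral_distribution (W2 c) mD2y D2y0) /comp.
pose F (q : sample c * E) := (gaussd s3 q.2 * (M2%:R * hit (W2 c q.1) (y + q.2)))%:E.
have mh : measurable_fun setT (fun q : sample c * E => hit (W2 c q.1) (y + q.2)%R).
  by apply: mhit; mfun.
have mF : measurable_fun setT F by rewrite /F; mfun.
have F0 q : 0 <= F q by rewrite lee_fin mulr_ge0 ?gaussd_ge0// mulr_ge0.
have -> : \int[P]_t (D2 (W2 c t, y))%:E = \int[P]_t \int[lam]_z F (t, z).
  apply: eq_integral => t _; rewrite /D2 EFinM softE /soft_e.
  rewrite -(@ge0_integral_scale _ _ _ _ _ (fun z => gaussd s3 z * hit (W2 c t) (y + z))%R)//.
  - by apply: eq_integral => z _; rewrite /F /= mulrCA.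
  - have h : measurable_fun setT (fun z : E => hit (W2 c t) (y + z)%R) by apply: mhit; mfun.
    by mfun.
  - by move=> z; rewrite mulr_ge0 ?gaussd_ge0.
rewrite [leLHS](fubini_tonelli F mF F0) -(integral_gaussd s3 N).
apply: ge0_le_integral => //.
- by move=> z _; apply: integral_ge0.
- exact: measurable_fun_fubini_tonelli_G.
- by mfun.
move=> z _; rewrite /F /= ge0_integral_scale ?gaussd_ge0//.
- rewrite -[leRHS]mule1 lee_wpmul2l ?lee_fin ?gaussd_ge0//.
  exact: (integral_uniform_le1 M20 (@W2_uniform _ _ _ _ c) (dec2 c (y + z)%R)).
- have h : measurable_fun setT (fun t => hit (W2 c t) (y + z)%R) by apply: mhit; mfun.
  by mfun.
- by move=> t; rewrite mulr_ge0.
Qed.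

Let rate1 : ((1 - fine (error1 c hd hc)) * ln M1%:R)%:E <=
  \int[P]_u \int[P]_t \int[lam]_z (gaussd 1 z * ln (1 + D1 (t,
    (x1 (V21 u) (source1 t) + z + scalet g (x2 (source2 u)))%R)))%:E.
Proof.
have mf : measurable_fun setT (fun t : sample c => dec1 c (Y1 hd hc t)) by mfun.
apply: le_trans (decoding_ln_le P M10 mf mW1) _.
pose G (q : (I1 * I2) * E) : \bar R := (ln (1 + M1%:R * (dec1 c q.2 == q.1.1.1)%:R))%:E.
have mG : measurable_fun setT G.
  have h : measurable_fun setT (fun q : (I1 * I2) * E => ((dec1 c q.2 == q.1.1.1)%:R : R)%R).
    by apply: measurable_eqn_indic; mfun.
  by rewrite /G; mfun.
have G0 q : 0 <= G q by rewrite lee_fin ln_ge0// lerDl mulr_ge0.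
by have -> := esym (integral_Y1 mG G0).
Qed.

(** The unit noise is split into parts of variance [s^2] and [1 - s^2]. Averaging over the second
    part turns the correct decision into its probability [soft], and [mul_ln_le_ln1M] passes to the
    logarithm. *)
Let rate2 : ((1 - fine (error2 c hd)) * ln M2%:R)%:E <=
  \int[P]_u \int[lam]_z (gaussd s z * ln (1 + D2 (W2 c u,
    (x2 (source2 u) + z)%R)))%:E.
Proof.
have mY2 : measurable_fun setT (Y2 (c := c) hd) by exact: measurable_Y2.
have mf : measurable_fun setT (fun t : sample c => dec2 c (Y2 hd t)) by mfun.
have lM : (0 <= ln (M2%:R : R))%R by rewrite ln_ge0// ler1n.
rewrite mulrC EFinM -(integral_eqn_indic P mf mW2).
pose G (q : I1 * (I2 * E)) := (hit q.2.1.1 (x2 q.2.1 + q.2.2)%R)%:E.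
have mG : measurable_fun setT G.
  have h : measurable_fun setT (fun q : I1 * (I2 * E) => hit q.2.1.1 (x2 q.2.1 + q.2.2)%R).
    by apply: mhit; mfun.
  by rewrite /G; mfun.
have G0 q : 0 <= G q by rewrite lee_fin.
have -> : \int[P]_t ((dec2 c (Y2 hd t) == W2 c t)%:R)%:E =
    \int[P]_u \int[lam]_z (gaussd 1 z * hit (W2 c u) (x2 (source2 u) + z))%:E.
  transitivity (\int[P]_t G (source1 t, (source2 t, noises false t))).
    by apply: eq_integral => t _; rewrite Y2E.
  rewrite [LHS](integral_sources false mG G0); apply: eq_integral => u _.
  apply: etrans (integral_cst P measurableT
    (\int[lam]_z (gaussd 1 z * hit (W2 c u) (x2 (source2 u) + z)%R)%:E)) _.
  by rewrite [X in _ * X]probability_setT mule1.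
have shift u : \int[lam]_z (gaussd 1 z * hit (W2 c u) (x2 (source2 u) + z))%:E =
    \int[lam]_z (gaussd s z * soft (W2 c u, x2 (source2 u) + z)%R)%:E.
  pose H y := (hit (W2 c u) (x2 (source2 u) + y)%R)%:E.
  have mh (a : E) : measurable_fun setT (fun z : E => hit (W2 c u) (a + z)%R).
    by apply: mhit; mfun.
  have mH : measurable_fun setT H by apply/measurable_EFinP; exact: mh.
  have H0 y : 0 <= H y by rewrite lee_fin.
  apply: etrans (esym (integral_noise_sum s0 s30 s3E mH H0)) _.
  apply: eq_integral => z _; rewrite EFinM softE /soft_e /=.
  rewrite -ge0_integralZl//.
  - apply: eq_integral => z' _; rewrite /H -!EFinM mulrA; congr (_ * hit _ _)%:E.
    by apply: eq_from_tnth => k; rewrite !tnthD [tnth (scalet 1 z) k]tnthZ mul1r addrA.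
  - by have h := mh (x2 (source2 u) + z)%R; mfun.
  - by move=> z' _; rewrite lee_fin mulr_ge0 ?gaussd_ge0.
  - by rewrite lee_fin gaussd_ge0.
under eq_integral do rewrite shift.
have mK : measurable_fun setT (fun q : sample c * E =>
    (gaussd s q.2 * soft (W2 c q.1, x2 (source2 q.1) + q.2)%R)%R) by mfun.
have mKl : measurable_fun setT (fun q : sample c * E =>
    (gaussd s q.2 * ln (1 + D2 (W2 c q.1, x2 (source2 q.1) + q.2)%R))%R) by mfun.
have lnD (q : nat * E) : (0 <= ln (1 + D2 q))%R by rewrite ln_ge0// lerDl.
have mI (f : sample c * E -> R) : measurable_fun setT f -> (forall q, 0 <= f q)%R ->
    measurable_fun setT (fun u => \int[lam]_z (f (u, z))%:E).
  move=> mf' f0; apply: (measurable_fun_fubini_tonelli_F (m2 := lam) (EFin \o f)).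
    exact/measurable_EFinP.
  by move=> q; rewrite lee_fin.
have K0 q : (0 <= gaussd s q.2 * soft (W2 c q.1, x2 (source2 q.1) + q.2)%R)%R.
  by rewrite mulr_ge0 ?gaussd_ge0.
have Kl0 (q : sample c * E) : (0 <= gaussd s q.2 * ln (1 + D2 (W2 c q.1, x2 (source2 q.1) + q.2)%R))%R.
  by rewrite mulr_ge0 ?gaussd_ge0.
rewrite -(ge0_integralZl P measurableT (mI _ mK K0)) ?lee_fin//; last first.
  by move=> u _; apply: integral_ge0 => z _; rewrite lee_fin (K0 (u, z)).
apply: ge0_le_integral => //.
- move=> u _; rewrite mule_ge0 ?lee_fin//; apply: integral_ge0 => z _.
  by rewrite lee_fin (K0 (u, z)).
- by apply: emeasurable_funM; [exact: measurable_cst|exact: mI mK K0].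
- exact: mI mKl Kl0.
move=> u _.
have mKu : measurable_fun setT (fun z => gaussd s z * soft (W2 c u, x2 (source2 u) + z)%R)%R.
  by mfun.
have mKlu : measurable_fun setT (fun z => gaussd s z * ln (1 + D2 (W2 c u, x2 (source2 u) + z)%R))%R.
  by mfun.
rewrite -(ge0_integral_scale _ mKu (fun z => K0 (u, z)) lM).
apply: ge0_le_integral => //.
- by move=> z _; rewrite lee_fin mulr_ge0// (K0 (u, z)).
- by mfun.
- by mfun.
move=> z _; rewrite lee_fin mulrCA ler_wpM2l ?gaussd_ge0// mulrC.
by apply: mul_ln_le_ln1M => //; rewrite ltr0n.
Qed.

Hypothesis leak : leakage c hd hc \is a fin_num.

Notation INR := (hc ^+ 2 * pw)%R.

(** [side_information_inequality] with the parameters of [test_channel_exists]. By the power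
    constraints each quadratic term on the right is at most [N / 2], and together they cancel the
    term N on the left. *)
Lemma sum_rate_le :
  ((1 - fine (error1 c hd hc)) * ln M1%:R + (1 - fine (error2 c hd)) * ln M2%:R <=
   6 + N%:R / 2 * ln ((1 + S) * (S + s ^+ 2) / (s ^+ 2 * (1 + INR))) +
   ln 2 * fine (leakage c hd hc) + ln 2 * (N%:R * cg))%R.
Proof.
have [e [me e0 eH [[lp lm] /= [elp elm lpm]]]] := kl_divergence_fin_num leak.
rewrite -/(mutual_information _ _) -/(leakage c hd hc) in lpm.
have S0 : (0 <= S)%R by rewrite mulr_ge0 ?sqr_ge0// ltW.
have IS : INR = (g ^+ 2 * S)%R by rewrite hcE; ring.
have [[[tau sB] [sq a]] [[tau0 sB0 sq0 gst sB2] [LE L0 QE]]] :=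
  test_channel_exists S0 g1 s0 s1.
rewrite -IS in LE.
have mV21 : measurable_fun setT (V21 (c := c)) by exact: measurableT_comp mcoop ms2.
have mV v : measurable ((V21 (c := c)) @^-1` [set v]).
  rewrite -[X in measurable X]setTI.
  by apply: mV21 => //; exact: measurable_tuple_nat_set1.
have mx1V : measurable_fun setT (fun q : sample c * sample c => x1 (V21 q.1) (source1 q.2)).
  by apply: mx1; mfun.
have mx1v v : measurable_fun setT (fun t => x1 v (source1 t)).
  by apply: mx1; mfun.
have mx2s : measurable_fun setT (fun u => x2 (source2 u)) by exact: measurableT_comp mx2 ms2.
have integral_law (H : nat * E -> \bar R) : measurable_fun setT H -> (forall p, 0 <= H p) ->
    \int[P]_u \int[P]_t \int[lam]_z ((gaussd 1 z)%:E *
      H (W2 c u, (x1 (V21 u) (source1 t) + z + scalet g (x2 (source2 u)))%R)) =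
    \int[distribution P (pairRV (W2 c) (Y1 hd hc))]_p H p.
  move=> mH H0; rewrite [RHS]ge0_integral_distribution//.
  have mG : measurable_fun setT (fun q : (I1 * I2) * E => H (q.1.2.1, q.2)).
    by apply: (measurableT_comp mH); mfun.
  exact: (integral_Y1 mG).
have HE (H : nat * E -> \bar R) : measurable_fun setT H -> (forall p, 0 <= H p) ->
    \int[P]_u \int[P]_t \int[lam]_z ((gaussd 1 z)%:E *
      ((e (W2 c u, (x1 (V21 u) (source1 t) + z + scalet g (x2 (source2 u)))%R))%:E *
        H (W2 c u, (x1 (V21 u) (source1 t) + z + scalet g (x2 (source2 u)))%R))) <=
    \int[distribution P (Y1 hd hc)]_y \int[distribution P (W2 c)]_w H (w, y).
  move=> mH H0.
  have meH : measurable_fun setT (fun p => (e p)%:E * H p) by mfun.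
  have eH0 p : 0 <= (e p)%:E * H p by rewrite mule_ge0// lee_fin ltW.
  rewrite [leLHS](integral_law _ meH eH0); apply: le_trans (eH _ mH H0) _.
  by rewrite [leLHS](fubini_tonelli2 H).
have max0 (x : R) : (0 <= Num.max 0 x)%R by rewrite le_max lexx.
have Ilm : \int[P]_u \int[P]_t \int[lam]_z
    (gaussd 1 z * Num.max 0 (ln (e (W2 c u,
      (x1 (V21 u) (source1 t) + z + scalet g (x2 (source2 u)))%R))))%:E = lm%:E.
  rewrite -elm; apply: (integral_law (fun p => (Num.max 0 (ln (e p)))%:E)).
    by mfun.
  by move=> p; rewrite lee_fin.
have Ilp : \int[P]_u \int[P]_t \int[lam]_z
    (gaussd 1 z * Num.max 0 (- ln (e (W2 c u,
      (x1 (V21 u) (source1 t) + z + scalet g (x2 (source2 u)))%R))))%:E = lp%:E.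
  rewrite -elp; apply: (integral_law (fun p => (Num.max 0 (- ln (e p)))%:E)).
    by mfun.
  by move=> p; rewrite lee_fin.
have [ent pow1 pow2] := constraints.
have mX1 := @measurable_X1 R M1 M2 N c; have mX2 := @measurable_X2 R M1 M2 N c.
have N0 : (0 <= N%:R :> R)%R by rewrite ler0n.
have IB : \int[P]_u \int[P]_t ((sqnorm (x1 (V21 u) (source1 t)) + N%:R) / (2 * sB ^+ 2))%:E <=
    (N%:R / 2)%:E.
  pose F (q : I1 * I2) : \bar R :=
    ((2 * sB ^+ 2)^-1 * sqnorm (x1 (coop c q.2) q.1) + N%:R * (2 * sB ^+ 2)^-1)%:E.
  have mF : measurable_fun setT F.
    have h : measurable_fun setT (fun q : I1 * I2 => x1 (coop c q.2) q.1).
      by apply: mx1; mfun.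
    by rewrite /F; mfun.
  have k0 : (0 <= (2 * sB ^+ 2)^-1)%R by rewrite invr_ge0 mulr_ge0 ?sqr_ge0.
  have F0 q : 0 <= F q by rewrite lee_fin addr_ge0// mulr_ge0 ?sqnorm_ge0.
  rewrite [leLHS](_ : _ = \int[P]_u \int[P]_t F (source1 t, source2 u)); last first.
    by apply: eq_integral => u _; apply: eq_integral => t _; rewrite /F mulrDl mulrC.
  rewrite -[leLHS](integral_inputs mF F0).
  have mf : measurable_fun setT (fun t : sample c => sqnorm (scalet hd (X1 t))) by mfun.
  have := ge0_integral_affine_le mf (fun t => sqnorm_ge0 _) k0 (mulr_ge0 N0 k0)
    (integral_sqnorm_le hd mX1 pow1).
  rewrite (_ : ((2 * sB ^+ 2)^-1 * (N%:R * S) + N%:R * (2 * sB ^+ 2)^-1 = N%:R / 2)%R)//.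
  by rewrite sB2; field; rewrite gt_eqF// ltr_pwDl.
have IQ : \int[P]_u (((1 - a * g) ^+ 2 * (sqnorm (x2 (source2 u)) + N%:R * s ^+ 2) +
     N%:R * (a ^+ 2 * tau ^+ 2)) / (2 * sq ^+ 2))%:E <= (N%:R / 2)%:E.
  have q0 : (0 < 2 * sq ^+ 2)%R by rewrite mulr_gt0// exprn_gt0.
  pose al : R := ((1 - a * g) ^+ 2 / (2 * sq ^+ 2))%R.
  pose be : R := (N%:R * ((1 - a * g) ^+ 2 * s ^+ 2 + a ^+ 2 * tau ^+ 2) / (2 * sq ^+ 2))%R.
  have al0 : (0 <= al)%R by apply: divr_ge0; [exact: sqr_ge0|exact: ltW].
  have be0 : (0 <= be)%R.
    apply: divr_ge0; last exact: ltW.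
    by apply: mulr_ge0 => //; apply: addr_ge0; apply: mulr_ge0; exact: sqr_ge0.
  have mf : measurable_fun setT (fun t : sample c => sqnorm (scalet hd (X2 t))) by mfun.
  have := ge0_integral_affine_le mf (fun t => sqnorm_ge0 _) al0 be0
    (integral_sqnorm_le hd mX2 pow2).
  (* At full power the residual variance of the test channel is exactly [sq^2], by [QE], so the
     quadratic term is [N / 2]. *)
  rewrite (_ : (al * (N%:R * S) + be = N%:R / 2)%R); last first.
    have q20 : (sq ^+ 2 != 0)%R by rewrite gt_eqF// exprn_gt0.
    rewrite (_ : (al * (N%:R * S) + be = N%:R *
      ((1 - a * g) ^+ 2 * (S + s ^+ 2) + a ^+ 2 * tau ^+ 2) / (2 * sq ^+ 2))%R).
      by rewrite QE; field; rewrite lt0r_neq0.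
    by rewrite /al /be; ring.
  apply: le_trans; rewrite le_eqVlt; apply/orP; left; apply/eqP.
  apply: eq_integral => u _; congr (_%:E); rewrite /al /be.
  by rewrite -[sqnorm (scalet hd (X2 u))]/(sqnorm (x2 (source2 u))); ring.
(* The factor [ln 2] converts the entropy from bits to natural units. *)
have Ient : \esum_(v in [set: N.-tuple nat])
     (- (fine (P (V21 (c := c) @^-1` [set v])) *
        ln (fine (P (V21 (c := c) @^-1` [set v])))))%:E <= (ln 2 * (N%:R * cg))%:E.
  pose p v : R := fine (P (V21 (c := c) @^-1` [set v])).
  have ln2 : (0 < ln 2 :> R)%R by rewrite ln_gt0// ltr1n.
  have p1 v : (p v <= 1)%R.
    by rewrite -lee_fin fineK ?probability_le1// fin_num_measure.
  have f0 v : (0 <= - (p v * log2 (p v)))%R.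
    rewrite oppr_ge0 mulr_ge0_le0 ?fine_ge0// /log2 mulr_le0_ge0 ?ln_le0//.
    by rewrite invr_ge0 ltW.
  apply: le_trans (esum_le_scale (ltW ln2) f0 ent).
  apply: le_esum => v _; rewrite lee_fin /log2 -/(p v).
  have E (x : R) : (ln 2 * (- (p v * (x / ln 2))) = - (p v * x))%R.
    by field; rewrite gt_eqF.
  by rewrite E.
have H := @side_information_inequality R N _ _ _ _ P P _ (V21 (c := c))
  (fun v t => x1 v (source1 t)) (fun u => x2 (source2 u)) (W2 c) mV mx1v mx1V mx2s mW2
  s tau g s0 tau0 gst D1 D2 e mD1 mD2 me D10 D20 e0 (distribution P (Y1 hd hc))
  (distribution P (W2 c)) D1_le1 D2_le1 HE sB sq a sB0 sq0 L0.
have aux (u1 u2 u3 y1 y2 y3 h : \bar R) (p1 p2 l k : R) :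
    p1%:E <= u1 -> p2%:E <= u2 -> u3 = lm%:E -> y1 = lp%:E -> y2 <= (N%:R / 2)%:E ->
    y3 <= (N%:R / 2)%:E -> h <= l%:E ->
    u1 + u2 + u3 + N%:R%:E <= y1 + y2 + y3 + k%:E + h ->
    (p1 + p2 <= k + (lp - lm) + l)%R.
  move=> px1 px2 -> -> hy2 hy3 hh H1.
  have := le_trans (leeD (leeD (leeD px1 px2) (lexx lm%:E)) (lexx N%:R%:E)) H1.
  move=> /le_trans /(_ (leeD (leeD (leeD (leeD (lexx _) hy2) hy3) (lexx _)) hh)).
  by rewrite -!EFinD lee_fin; lra.
have := aux _ _ _ _ _ _ _ _ _ _ _ rate1 rate2 Ilm Ilp IB IQ Ient H.
by rewrite LE lpm; lra.
Qed.

End sum_rate.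

(** * Limits *)

Lemma log2_correlation_max (R : realType) (S I : R) : 0 <= I -> I <= S ->
  is_max [set 1 / 2 * log2 (1 + S - (rho * S + Num.sqrt (S * I)) ^+ 2 /
                 (1 + S + I + 2 * rho * Num.sqrt (S * I)))
          | rho in `[(-1 : R), 1]] (1 / 2 * log2 (1 + S)).
Proof.
move=> I0 IS; have S0 : 0 <= S by exact: le_trans IS.
set w := Num.sqrt (S * I).
have w0 : 0 <= w by exact: sqrtr_ge0.
have w2 : w ^+ 2 = S * I by rewrite sqr_sqrtr// mulr_ge0.
have wS : w <= S.
  by rewrite -(ler_pXn2r (n := 2))// ?nnegrE// w2 expr2 ler_wpM2l.
have w2SI : 2 * w <= S + I.
  rewrite -(ler_pXn2r (n := 2))// ?nnegrE ?mulr_ge0 ?addr_ge0//.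
  rewrite exprMn w2 -subr_ge0 (_ : _ - _ = (S - I) ^+ 2) ?sqr_ge0//; ring.
split.
  (* [w / S] is [sqrt (I / S)]; for [S = 0] division gives 0, and [w] is 0 as well. *)
  exists (- (w / S)) => /=.
    rewrite in_itv/= lerN2 lerNl.
    have wSle : w / S <= 1.
      have [->|S_neq0] := eqVneq S 0; first by rewrite invr0 mulr0 ler01.
      by rewrite ler_pdivrMr ?mul1r// lt_neqAle eq_sym S_neq0.
    by rewrite wSle/= (le_trans _ (divr_ge0 w0 S0))// lerN10.
  rewrite (_ : - (w / S) * S + w = 0); first by rewrite expr0n/= mul0r subr0.
  have [S_eq0|S_neq0] := eqVneq S 0; last by rewrite mulNr divfK// addNr.
  by rewrite S_eq0 mulr0 add0r; apply/eqP; rewrite eq_le w0 andbT -S_eq0.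
move=> y [rho /=]; rewrite in_itv/= => /andP[rho1 rho2] <-.
rewrite ler_pM2l ?divr_gt0// /log2 ler_pM2r ?invr_gt0 ?ln_gt0 ?ltr1n//.
set x := _ / _.
have x0 : 0 <= x.
  apply: divr_ge0; first exact: sqr_ge0.
  (* Since [2 w <= S + I], the denominator is at least [1 + 2 (1 + rho) w], which is positive. *)
  have : (rho + 1) * w >= 0 by rewrite mulr_ge0// -lerBlDr sub0r.
  by lra.
(* Monotonicity of [ln] handles a positive argument; otherwise [ln] returns 0, which is below
   [ln (1 + S)]. *)
have [xS|Sx] := ltP 0 (1 + S - x).
  by rewrite ler_ln ?posrE//; lra.
by rewrite [leLHS]ln0// ln_ge0// lerDl.
Qed.

Lemma ln_message_count_ge (R : realType) N (r : R) :
  (0 < message_count N r)%N /\ N%:R * r * ln 2 <= ln (message_count N r)%:R :> R.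
Proof.
have x0 : 0 < 2 `^ (N%:R * r) :> R by rewrite powR_gt0.
have c0 : 0 < Num.ceil (2 `^ (N%:R * r)) by rewrite ceil_gt0.
have -> : (message_count N r)%:R = (Num.ceil (2 `^ (N%:R * r)))%:~R :> R.
  by rewrite /message_count natr_absz gtr0_norm.
split; first by rewrite /message_count absz_gt0 gt_eqF.
rewrite -ln_powR ler_ln ?posrE// ?ceil_ge//.
by rewrite ltr0z.
Qed.

Lemma closure_affine_le (R : realType) (A : set (R * R)) (f : R * R -> R) (C : R) p :
  continuous f -> (forall q, A q -> f q <= C) -> closure A p -> f p <= C.
Proof.
move=> cf AC Ap.
have cl : closed (f @^-1` [set x | x <= C]).
  by apply: preimage_closed; [move=> x _; exact: cf|exact: closed_le].
by have := closureS (AC : A `<=` f @^-1` [set x | x <= C]) Ap => /cl.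
Qed.

Section asymptotics.
Context (R : realType) (hd hc pw cg : R) (r : R * R).
Hypotheses (pw0 : 0 < pw).
Variables (N : nat -> nat) (c : forall n, zic_code R
  (message_count (N n) r.1) (message_count (N n) r.2) (N n)).
Hypotheses (r10 : 0 <= r.1) (r20 : 0 <= r.2) (Noo : N n @[n --> \oo] --> \oo)
  (cstr : forall n, meets_constraints (c n) pw cg)
  (e1 : error1 (c n) hd hc @[n --> \oo] --> 0%E)
  (e2 : error2 (c n) hd @[n --> \oo] --> 0%E)
  (lk : (((N n)%:R^-1)%:E * leakage (c n) hd hc)%E @[n --> \oo] --> 0%E).
Notation S := (hd ^+ 2 * pw).

Let ln2 : 0 < ln 2 :> R. Proof. by rewrite ln_gt0// ltr1n. Qed.

Let N0 : \forall n \near \oo, (0 < N n)%N.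
Proof. exact: (Noo (nbhs_infty_gt 0%N)). Qed.

Let Nr0 : \forall n \near \oo, 0 < (N n)%:R :> R.
Proof. by apply: filterS N0 => n; rewrite ltr0n. Qed.

Let invN : ((N n)%:R^-1 : R) @[n --> \oo] --> (0 : R).
Proof. by apply/(gtr0_cvgV0 Nr0); apply/cvgrnyP. Qed.

Let fe1 : fine (error1 (c n) hd hc) @[n --> \oo] --> (0 : R).
Proof. exact: fine_cvg e1. Qed.

Let fe2 : fine (error2 (c n) hd) @[n --> \oo] --> (0 : R).
Proof. exact: fine_cvg e2. Qed.

Let le1 (f : nat -> R) : f n @[n --> \oo] --> (0 : R) ->
  \forall n \near \oo, 0 <= 1 - f n.
Proof.
move=> f0; have : \forall n \near \oo, f n < 1 by exact: (cvgr_lt _ f0).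
by apply: filterS => n; rewrite subr_ge0 => /ltW.
Qed.

Let rate_limit (f : nat -> R) (a : R) : f n @[n --> \oo] --> (0 : R) ->
  (1 - f n) * a @[n --> \oo] --> a.
Proof.
move=> f0; rewrite -[X in _ --> X](_ : (1 - 0) * a = a); last by rewrite subr0 mul1r.
by apply: cvgM; [apply: cvgB => //; exact: cvg_cst|exact: cvg_cst].
Qed.

Let rate_le n (e a B : R) : (0 < N n)%N -> 0 <= 1 - e ->
  (1 - e) * ln (message_count (N n) a)%:R <= B ->
  (1 - e) * (a * ln 2) <= (N n)%:R^-1 * B.
Proof.
move=> n0 e0 H.
have n0' : 0 < (N n)%:R :> R by rewrite ltr0n.
rewrite -ler_pdivrMl ?invr_gt0// invrK; apply: le_trans H.
rewrite mulrCA ler_wpM2l// mulrA.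
by have [] := ln_message_count_ge (N n) a.
Qed.

Let point_to_point_limit (f : nat -> R) (a : R) : f n @[n --> \oo] --> (0 : R) ->
  (forall n, (1 - f n) * ln (message_count (N n) a)%:R <=
    (N n)%:R * (ln (1 + S) / 2) + 2) ->
  a * ln 2 <= ln (1 + S) / 2.
Proof.
move=> f0 fB.
have vl : ln (1 + S) / 2 + (N n)%:R^-1 * 2 @[n --> \oo] --> ln (1 + S) / 2.
  rewrite -[X in _ --> X](_ : ln (1 + S) / 2 + 0 * 2 = _); last by rewrite mul0r addr0.
  by apply: cvgD; [exact: cvg_cst|apply: cvgM => //; exact: cvg_cst].
apply: (ler_cvg_to (rate_limit (a := a * ln 2) f0) vl).
near=> n.
have n0 : (0 < N n)%N by near: n; exact: N0.
have fn0 : 0 <= 1 - f n by near: n; exact: le1.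
apply: le_trans (rate_le n0 fn0 (fB n)) _.
by rewrite mulrDr mulKf// pnatr_eq0 -lt0n.
Unshelve. all: by end_near. Qed.

Lemma rate1_limit : r.1 * ln 2 <= ln (1 + S) / 2.
Proof.
apply: (point_to_point_limit fe1) => n.
rewrite -lee_fin; apply: rate1_le => //.
by have [] := ln_message_count_ge (N n) r.1.
Qed.

Lemma rate2_limit : r.2 * ln 2 <= ln (1 + S) / 2.
Proof.
apply: (point_to_point_limit fe2) => n.
rewrite -lee_fin; apply: rate2_le => //.
by have [] := ln_message_count_ge (N n) r.2.
Qed.

Variable g : R.
Hypotheses (hcE : hc = g * hd) (g1 : g ^+ 2 <= 1).

Lemma sum_rate_limit s : 0 < s -> s < 1 ->
  (r.1 + r.2) * ln 2 <=
  ln ((1 + S) * (S + s ^+ 2) / (s ^+ 2 * (1 + hc ^+ 2 * pw))) / 2 + ln 2 * cg.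
Proof.
move=> s0 s1; set L := ln (_ / _).
have [lkfin flk] := (fine_cvgP _ _).1 lk.
have ul : (1 - fine (error1 (c n) hd hc)) * (r.1 * ln 2) +
    (1 - fine (error2 (c n) hd)) * (r.2 * ln 2) @[n --> \oo] -->
    r.1 * ln 2 + r.2 * ln 2 by apply: cvgD; exact: rate_limit.
have vl : (N n)%:R^-1 * 6 + L / 2 +
    ln 2 * (fine \o (fun n => ((N n)%:R^-1)%:E * leakage (c n) hd hc)%E) n + ln 2 * cg
    @[n --> \oo] --> L / 2 + ln 2 * cg.
  rewrite -[X in _ --> X](_ : 0 * 6 + L / 2 + ln 2 * 0 + ln 2 * cg = _); last first.
    by rewrite mul0r mulr0 addr0 add0r.
  apply: cvgD; last exact: cvg_cst.
  apply: cvgD; last by apply: cvgM => //; exact: cvg_cst.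
  by apply: cvgD; [apply: cvgM => //; exact: cvg_cst|exact: cvg_cst].
rewrite [leLHS]mulrDl; apply: (ler_cvg_to ul vl).
near=> n.
have n0 : (0 < N n)%N by near: n; exact: N0.
have n0' : 0 < (N n)%:R :> R by rewrite ltr0n.
have f1 : 0 <= 1 - fine (error1 (c n) hd hc) by near: n; exact: le1.
have f2 : 0 <= 1 - fine (error2 (c n) hd) by near: n; exact: le1.
have lf : (((N n)%:R^-1)%:E * leakage (c n) hd hc)%E \is a fin_num by near: n.
(* Multiplication by the positive real [1 / N] preserves infinite values, so a finite normalised
   leakage forces a finite leakage. *)
have leak : leakage (c n) hd hc \is a fin_num.
  have i0 : (0 < ((N n)%:R^-1)%:E :> \bar R)%E by rewrite lte_fin invr_gt0.
  by move: lf; case: leakage => [x| |]//; rewrite ?(gt0_muley i0) ?(gt0_muleNy i0).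
have [M10 l1] := ln_message_count_ge (N n) r.1.
have [M20 l2] := ln_message_count_ge (N n) r.2.
have := sum_rate_le M10 M20 pw0 (cstr n) hcE g1 s0 s1 leak.
rewrite -/L => H.
have h1 := rate_le n0 f1 (lexx _); have h2 := rate_le n0 f2 (lexx _).
apply: le_trans (lerD (h1 r.1) (h2 r.2)) _; rewrite -mulrDr.
have i0 : 0 <= (N n)%:R^-1 :> R by rewrite invr_ge0 ltW.
apply: le_trans (ler_wpM2l i0 H) _.
rewrite le_eqVlt; apply/orP; left; apply/eqP; rewrite /= fineM//=.
by field; rewrite gt_eqF.
Unshelve. all: by end_near. Qed.

End asymptotics.

(** The passage of s to 1 without continuity. Exponentiated, the hypothesis reads
    [t K <= (1 + S) (S + t)] with [t = s^2], and the claim reads [K <= C]. If [K > C], a single t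
    close enough to 1 gives a contradiction. *)
Lemma ln_noise_limit (R : realType) (S I a : R) : 0 <= S -> 0 <= I ->
  (forall s, 0 < s -> s < 1 ->
    a <= ln ((1 + S) * (S + s ^+ 2) / (s ^+ 2 * (1 + I))) / 2) ->
  a <= ln (1 + S) - ln (1 + I) / 2.
Proof.
move=> S0 I0 H; set K := expR (2 * a) * (1 + I); set C := (1 + S) ^+ 2.
have K0 : 0 < K by rewrite mulr_gt0 ?expR_gt0//; lra.
have C0 : 0 < C by rewrite exprn_gt0//; lra.
have KC : K <= C.
  rewrite leNgt; apply/negP => CK.
  (* Halfway between [C / K] and 1, so that [t K] is the mean of C and K and exceeds
     [C >= (1 + S) (S + t)]. *)
  pose t := (C / K + 1) / 2.
  have CK1 : C / K < 1 by rewrite ltr_pdivrMr// mul1r.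
  have CK0 : 0 < C / K by rewrite divr_gt0.
  have t0 : 0 < t by rewrite /t; lra.
  have t1 : t < 1 by rewrite /t; lra.
  have s0 : 0 < Num.sqrt t by rewrite sqrtr_gt0.
  have s1 : Num.sqrt t < 1 by rewrite -sqrtr1 ltr_sqrt.
  have := H _ s0 s1; rewrite sqr_sqrtr; last exact: ltW.
  rewrite ler_pdivlMr// mulrC.
  have q0 : 0 < (1 + S) * (S + t) / (t * (1 + I)).
    by rewrite divr_gt0// mulr_gt0//; lra.
  have tI : 0 < t * (1 + I) by apply: mulr_gt0 => //; lra.
  rewrite -ler_expR lnK ?posrE// ler_pdivlMr//.
  rewrite mulrCA -/K => h.
  have : t * K = (C + K) / 2 by rewrite /t; field; rewrite gt_eqF.
  have : (1 + S) * (S + t) <= C by rewrite /C expr2 ler_wpM2l//; lra.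
  lra.
have : ln K <= ln C by rewrite ler_ln ?posrE.
rewrite /K /C lnM ?posrE ?expR_gt0 ?expRK//; last lra.
rewrite expr2 lnM ?posrE; lra.
Qed.

Theorem theorem5 (R : realType) (hd hc pw cg R1 R2 : R) :
  0 < pw -> 0 <= cg ->
  let SNR := hd ^+ 2 * pw in
  let INR := hc ^+ 2 * pw in
  INR <= SNR ->
  secrecy_capacity_region hd hc pw cg (R1, R2) ->
  [/\ R1 <= 1 / 2 * log2 (1 + SNR),
      exists2 m : R,
        is_max
          [set 1 / 2 * log2 (1 + SNR -
                 (rho * SNR + Num.sqrt (SNR * INR)) ^+ 2 /
                 (1 + SNR + INR + 2 * rho * Num.sqrt (SNR * INR)))
          | rho in `[(-1 : R), 1]] m
        & R2 <= m
    & R1 + R2 <= log2 (1 + SNR) - 1 / 2 * log2 (1 + INR) + cg].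
Proof.
move=> pw0 cg0 SNR INR IS region.
have S0 : 0 <= SNR by rewrite mulr_ge0 ?sqr_ge0// ltW.
have I0 : 0 <= INR by rewrite mulr_ge0 ?sqr_ge0// ltW.
have hchd : hc ^+ 2 <= hd ^+ 2 by rewrite -(ler_pM2r pw0).
pose g := hc / hd.
have [hcE g1] : hc = g * hd /\ g ^+ 2 <= 1.
  (* If [hd = 0], then [INR <= SNR] forces [hc = 0], and division by 0 gives [g = 0], so the
     factorisation still holds. *)
  have [hd0|hd0] := eqVneq hd 0.
    move: hchd; rewrite hd0 expr0n/= => hc0.
    have hc0' : hc = 0 by apply/eqP; rewrite -sqrf_eq0 eq_le hc0 sqr_ge0.
    by rewrite /g hc0' !mul0r expr0n/= ler01.
  rewrite /g divfK//; split => //.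
  by rewrite expr_div_n ler_pdivrMr ?mul1r// lt_neqAle eq_sym sqrf_eq0 hd0 sqr_ge0.
have ln2 : 0 < ln 2 :> R by rewrite ln_gt0// ltr1n.
have p2p x : x * ln 2 <= ln (1 + SNR) / 2 -> x <= 1 / 2 * log2 (1 + SNR).
  rewrite -ler_pdivlMr// => /le_trans; apply.
  by rewrite (_ : 1 / 2 * log2 _ = ln (1 + SNR) / 2 / ln 2)// /log2; field; rewrite gt_eqF.
have bounds q : achievable hd hc pw cg q ->
    [/\ q.1 <= 1 / 2 * log2 (1 + SNR), q.2 <= 1 / 2 * log2 (1 + SNR) &
        q.1 + q.2 <= log2 (1 + SNR) - 1 / 2 * log2 (1 + INR) + cg].
  move=> [q1 q2 [N [c [Noo cstr e1 e2 lk]]]]; split.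
  - exact/p2p/(rate1_limit pw0 Noo cstr e1).
  - exact/p2p/(rate2_limit pw0 Noo cstr e2).
  (* The cooperation term is moved to the left first, so that the quantity compared with the
     logarithm is independent of s. *)
  - have := @ln_noise_limit R SNR INR ((q.1 + q.2) * ln 2 - ln 2 * cg) S0 I0.
    move=> /(_ _) H.
    have {H} : (q.1 + q.2) * ln 2 - ln 2 * cg <= ln (1 + SNR) - ln (1 + INR) / 2.
      apply: H => s s0 s1; rewrite lerBlDr.
      exact: (sum_rate_limit pw0 Noo cstr e1 e2 lk hcE g1 s0 s1).
    rewrite lerBlDr -ler_pdivlMr// => /le_trans; apply.
    by rewrite le_eqVlt; apply/orP; left; apply/eqP; rewrite /log2; field; rewrite gt_eqF.
have cfst : continuous (fst : R * R -> R) by move=> x; exact: cvg_fst.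
have csnd : continuous (snd : R * R -> R) by move=> x; exact: cvg_snd.
have csum : continuous (fun q : R * R => q.1 + q.2).
  by move=> x; apply: cvgD; [exact: cfst|exact: csnd].
split.
- by apply: (closure_affine_le cfst _ region) => q /bounds[].
- exists (1 / 2 * log2 (1 + SNR)); first exact: log2_correlation_max.
  by apply: (closure_affine_le csnd _ region) => q /bounds[].
- by apply: (closure_affine_le csum _ region) => q /bounds[].
Qed.
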